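(* Suppose Assumptions 1, 2 and 3 hold. Let $k\ge1$ be an integer and suppose that $E(\int_0^T\mu_s^{2k}\,ds)<\infty$ and $E(\int_0^T\sigma_s^{2k}\,ds)<\infty$, and that there exists $p\in(2,3]$ such that $M_{U,2kp}=E(|U|^{2kp})<\infty$. If $\xi=\xi_n=o(n^{-p/\{2(p-1)\}})$ as $n\to\infty$, then $$\hat M_{U,2k}(\xi)=M_{U,2k}+O_p(n^{-1/2}).$$
   Context: Setting. $T>0$ is fixed. For each $n$ there is a deterministic grid $\mathcal G=\{t_0,\dots,t_n\}$ with $0=t_0<t_1<\dots<t_n=T$ (depending on $n$), $\Delta t_j=t_j-t_{j-1}$, and $\max_{1\le j\le n}\Delta t_j\to0$ as $n\to\infty$. The data are $Y_{t_j}=X_{t_j}+U_{t_j}$, $j=0,\dots,n$. The process $(X_t)_{t\in[0,T]}$ satisfies $dX_t=\mu_t\,dt+\sigma_t\,dB_t$, where $\mu_t$ is a locally bounded, progressively measurable process, $\sigma_t$ is a positive, locally bounded It\^o semimartingale, and $B_t$ is a standard Brownian motion. Assumption 1: the errors $U_{t_0},\dots,U_{t_n}$ are independent and identically distributed with unknown density $f_U$, and are independent of the process $(X_t)_{t\in[0,T]}$. Assumption 2: as $n\to\infty$, $\min_{1\le j\le n}\Delta t_j/\max_{1\le j\le n}\Delta t_j$ is uniformly bounded away from zero and infinity. Assumption 3: the characteristic function $f_U^{\mathrm{Ft}}(s)=\int e^{isx}f_U(x)\,dx$ is real-valued and does not vanish at any point of the real line. Moments. $U$ denotes a generic random variable with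 density $f_U$, and $M_{U,q}$ denotes its $q$th moment. Binomial coefficients are written $C_{2k}^{2j}=(2k)!/\{(2j)!(2k-2j)!\}$. Moment estimators. For $\xi>0$ let $S_j=\{t_\ell\in\mathcal G:|t_\ell-t_j|\le\xi,\ \ell\ne j\}$ for $j=0,\dots,n$, let $N_j$ be the number of points of $S_j$, and $N(\xi)=\sum_{j=0}^nN_j$. It is understood throughout that $\xi=\xi_n$ is such that $\max_{1\le j\le n}N_j\asymp\min_{1\le j\le n}N_j\asymp n\xi$, where $a_n\asymp b_n$ means $c_1\le a_n/b_n\le c_2$ for all $n\ge1$ for some positive constants $c_1,c_2$. For integers $k\ge1$ put $$\hat M_{\tilde U,2k}(\xi)=\frac1{N(\xi)}\sum_{j=0}^n\sum_{t_\ell\in S_j}(Y_{t_\ell}-Y_{t_j})^{2k}.$$ Define recursively $\hat M_{U,2}(\xi)=\hat M_{\tilde U,2}(\xi)/2$ and, for $k>1$, $$\hat M_{U,2k}(\xi)=\frac12\Big\{\hat M_{\tilde U,2k}(\xi)-\sum_{j=1}^{k-1}C_{2k}^{2j}\hat M_{U,2j}(\xi)\hat M_{U,2k-2j}(\xi)\Big\}.$$ *)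

(* Defs.v *)
(* A stochastic process on [0, T] is a function
   R -> Omega -> R of which only the times in [0, T] are ever used. *)
From HB Require Import structures.
From mathcomp Require Import all_boot all_order all_algebra.
From mathcomp Require Import all_classical all_reals all_analysis.
From mathcomp Require Import measurable_realfun complex.

Set Implicit Arguments.
Unset Strict Implicit.
Unset Printing Implicit Defensive.

Import Order.TTheory GRing.Theory Num.Theory.
Import numFieldNormedType.Exports.

Local Open Scope classical_set_scope.
Local Open Scope ring_scope.

Section Processes.
Context {R : realType} {d : measure_display} {Omega : measurableType d}.
Variables (P : probability Omega R) (T : R) (F : R -> set (set Omega)).

(* Neither completeness nor right-continuity is required. *)
Definition filtration : Prop :=
  [/\ forall t, 0 <= t <= T -> sigma_algebra [set: Omega] (F t),
      forall t, 0 <= t <= T -> F t `<=` measurable &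
      forall s t, 0 <= s -> s <= t -> t <= T -> F s `<=` F t].

Definition adapted (Z : R -> Omega -> R) : Prop :=
  forall t, 0 <= t <= T -> forall A, measurable A -> F t (Z t @^-1` A).

Definition progressively_measurable {dV} {V : measurableType dV}
    (Z : R -> Omega -> V) : Prop :=
  forall t, 0 <= t <= T ->
    measurable_fun (`[0, t] `*` setT : set (R * g_sigma_algebraType (F t)))
      (fun z => Z z.1 z.2).

(* Any value of tau beyond T stands for "not before the horizon". *)
Definition stopping_time (tau : Omega -> R) : Prop :=
  (forall w, 0 <= tau w) /\
  forall t, 0 <= t <= T -> F t [set w | tau w <= t].

Definition localizing (tau : nat -> Omega -> R) : Prop :=
  [/\ forall m, stopping_time (tau m),
      forall m w, tau m w <= tau m.+1 w &
      {ae P, forall w, \forall m \near \oo, T <= tau m w}].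

Definition locally_bounded (Z : R -> Omega -> R) : Prop :=
  exists tau : nat -> Omega -> R, exists K : nat -> R,
    localizing tau /\
    {ae P, forall w, forall m t,
       0 < t -> t <= T -> t <= tau m w -> `|Z t w| <= K m}.

Definition cadlag (x : R -> R) : Prop :=
  (forall t, 0 <= t < T -> x s @[s --> t^'+] --> x t) /\
  (forall t, 0 < t <= T -> cvg (x s @[s --> t^'-])).

Definition jump (x : R -> R) (t : R) : R := x t - lim (x s @[s --> t^'-]).

Definition martingale (M : R -> Omega -> R) : Prop :=
  [/\ adapted M,
      forall t, 0 <= t <= T -> P.-integrable setT (EFin \o M t) &
      forall s t A, 0 <= s -> s <= t -> t <= T -> F s A ->
        (\int[P]_(w in A) (M t w)%:E = \int[P]_(w in A) (M s w)%:E)%E].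

Definition local_martingale (M : R -> Omega -> R) : Prop :=
  [/\ adapted M,
      {ae P, forall w, cadlag (fun t => M t w)} &
      exists2 tau, localizing tau &
        forall m, martingale (fun t w => M (Num.min t (tau m w)) w - M 0 w)].

Definition continuous_local_martingale (M : R -> Omega -> R) : Prop :=
  local_martingale M /\
  {ae P, forall w, {within `[0, T], continuous (fun t => M t w)}}.

Definition purely_discontinuous (M : R -> Omega -> R) : Prop :=
  [/\ local_martingale M,
      {ae P, forall w, M 0 w = 0} &
      forall N, continuous_local_martingale N ->
        local_martingale (fun t w => M t w * N t w)].

(* Both sums run over finitely many times for a cadlag path x, when A is
   bounded away from 0. *)
Definition big_jumps (x : R -> R) (t : R) : R :=
  \sum_(s \in [set s | 0 < s <= t /\ 1 < `|jump x s|]) jump x s.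

Definition jump_count (x : R -> R) (A : set R) (t : R) : R :=
  \sum_(s \in [set s | 0 < s <= t /\ A (jump x s)]) (1 : R).

(* An Ito semimartingale is a semimartingale whose characteristics (relative to
   the truncation x 1_{|x| <= 1}) are absolutely continuous in time:
   (int_0^t b_s ds, int_0^t c_s ds, nu_s(dx) ds).  The continuous martingale
   part is Zc; what remains of Z once its initial value, its jumps larger than
   1, its drift and Zc are removed must be a purely discontinuous local
   martingale; and nu_s(A) ds must compensate the number of jumps in A. *)
Definition ito_semimartingale (Z : R -> Omega -> R) : Prop :=
  [/\ adapted Z, forall w, cadlag (fun t => Z t w) &
  exists (b c : R -> Omega -> R)
         (nu : R -> Omega -> {measure set R -> \bar R})
         (Zc : R -> Omega -> R),
    [/\ progressively_measurable b,
        progressively_measurable c,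
        forall A, measurable A ->
          progressively_measurable (fun s w => nu s w A) &
        forall s w, 0 <= s <= T -> 0 <= c s w /\ nu s w [set 0] = 0%E] /\
    {ae P, forall w,
      [/\ (\int[lebesgue_measure]_(s in `[0%R, T]) `|b s w|%:E < +oo)%E,
          (\int[lebesgue_measure]_(s in `[0%R, T]) (c s w)%:E < +oo)%E &
          (\int[lebesgue_measure]_(s in `[0%R, T])
             \int[nu s w]_x (Num.min 1 (x ^+ 2))%:E < +oo)%E]} /\
    [/\ continuous_local_martingale Zc,
        {ae P, forall w, Zc 0 w = 0},
        local_martingale (fun t w =>
          Zc t w ^+ 2 - \int[lebesgue_measure]_(s in `[0, t]) c s w),
        purely_discontinuous (fun t w =>
          Z t w - Z 0 w - big_jumps (fun s => Z s w) t
          - \int[lebesgue_measure]_(s in `[0, t]) b s w - Zc t w) &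
        forall (A : set R) (eps : R), measurable A -> 0 < eps ->
          A `<=` [set x | eps < `|x|] ->
          local_martingale (fun t w =>
            jump_count (fun s => Z s w) A t
            - fine (\int[lebesgue_measure]_(s in `[0%R, t]) nu s w A)%E)]].

(* The increments are taken over s < t only: normal_prob 0 0 is not the Dirac
   mass at 0. *)
Definition brownian_motion (B : R -> Omega -> R) : Prop :=
  [/\ adapted B,
      {ae P, forall w, B 0 w = 0},
      {ae P, forall w, {within `[0, T], continuous (fun t => B t w)}},
      forall s t A E, 0 <= s -> s < t -> t <= T -> measurable A -> F s E ->
        let D := [set w | A (B t w - B s w)] in
        (P (D `&` E) = P D * P E)%E &
      forall s t A, 0 <= s -> s < t -> t <= T -> measurable A ->
        P [set w | A (B t w - B s w)] = normal_prob 0 (Num.sqrt (t - s)) A].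

(* The process sum_(i < m) h_i 1_(]s_i, s_(i+1)]). *)
Record simple_integrand := SimpleIntegrand {
  si_size : nat;
  si_knot : nat -> R;
  si_coef : nat -> Omega -> R;
  si_knot_range : forall i, (i <= si_size)%N -> 0 <= si_knot i <= T;
  si_knot_mono : forall i, (i < si_size)%N -> si_knot i <= si_knot i.+1;
  si_coef_adapted : forall i, (i < si_size)%N ->
    forall A, measurable A -> F (si_knot i) (si_coef i @^-1` A);
  si_coef_bounded : forall i, (i < si_size)%N ->
    exists K : R, forall w, `|si_coef i w| <= K }.

Definition si_process (H : simple_integrand) (t : R) (w : Omega) : R :=
  \sum_(i < si_size H)
     si_coef H i w * \1_(`]si_knot H i, si_knot H i.+1] : set R) t.

Definition si_integral (H : simple_integrand) (B : R -> Omega -> R)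
    (t : R) (w : Omega) : R :=
  \sum_(i < si_size H) si_coef H i w *
     (B (Num.min (si_knot H i.+1) t) w - B (Num.min (si_knot H i) t) w).

Definition cvg_prob0 (Z : nat -> Omega -> \bar R) : Prop :=
  forall eps : R, 0 < eps ->
    P [set w | (eps%:E < `|Z n w|)%E] @[n --> \oo] --> 0%E.

(* I is (a version with continuous paths of) int_0^. sigma_s dB_s. *)
Definition is_ito_integral (B sigma I : R -> Omega -> R) : Prop :=
  [/\ forall t, 0 <= t <= T -> measurable_fun setT (I t),
      {ae P, forall w, {within `[0, T], continuous (fun t => I t w)}} &
      exists2 H : nat -> simple_integrand,
        cvg_prob0 (fun n w => \int[lebesgue_measure]_(s in `[0%R, T])
                     ((si_process (H n) s w - sigma s w) ^+ 2)%:E)%E &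
        forall t, 0 <= t <= T ->
          cvg_prob0 (fun n w => (si_integral (H n) B t w - I t w)%:E)].

(* dX_t = mu_t dt + sigma_t dB_t on [0, T]. *)
Definition ito_process (B mu sigma X : R -> Omega -> R) : Prop :=
  [/\ forall t, 0 <= t <= T -> measurable_fun setT (X t),
      forall A, measurable A -> F 0 (X 0 @^-1` A) &
      exists2 I, is_ito_integral B sigma I &
        {ae P, forall w, forall t, 0 <= t <= T ->
           X t w = X 0 w + \int[lebesgue_measure]_(s in `[0, t]) mu s w
                   + I t w}].

End Processes.

Section Errors.
Context {R : realType} {d : measure_display} {Omega : measurableType d}.
Variable P : probability Omega R.

Definition has_density (V : {RV P >-> R}) (f : R -> R) : Prop :=
  [/\ measurable_fun setT f, forall x, 0 <= f x &
      forall A, measurable A ->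
        distribution P V A = (\int[lebesgue_measure]_(x in A) (f x)%:E)%E].

(* Subfamilies are covered by taking some of the A_j to be the full line. *)
Definition mutually_independent (m : nat) (V : nat -> Omega -> R) : Prop :=
  forall A : nat -> set R, (forall j, measurable (A j)) ->
    P (\bigcap_(j in [set j | (j < m)%N]) (V j @^-1` A j))
    = (\prod_(j < m) P (V j @^-1` A j))%E.

Definition generated_sigma {J : Type} (D : set J) (V : J -> Omega -> R) :
    set (set Omega) :=
  <<s [set E | exists j, D j /\
                 exists A, measurable A /\ E = V j @^-1` A] >>.

Definition independent_families {J L : Type} (D : set J) (V : J -> Omega -> R)
    (D' : set L) (W : L -> Omega -> R) : Prop :=
  forall E G, generated_sigma D V E -> generated_sigma D' W G ->
    (P (E `&` G) = P E * P G)%E.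

Definition fourier (f : R -> R) (s : R) : R[i] :=
  ((\int[lebesgue_measure]_x (cos (s * x) * f x))
   +i* (\int[lebesgue_measure]_x (sin (s * x) * f x)))%C.

Definition Op (Z : nat -> Omega -> R) (a : nat -> R) : Prop :=
  forall eps : R, 0 < eps -> exists2 K : R, 0 < K &
    \forall n \near \oo, (P [set w | (K * a n < `|Z n w|)%R] <= eps%:E)%E.

End Errors.

Section Estimators.
Context {R : realType}.

Definition grid (T : R) (n : nat) (t : nat -> R) : Prop :=
  [/\ t 0 = 0, t n = T & forall j, (j < n)%N -> t j < t j.+1].

(* The default value of the maxima and minima below is their j = 1 term. *)
Definition mesh_max (n : nat) (t : nat -> R) : R :=
  \big[Num.max/t 1 - t 0]_(1 <= j < n.+1) (t j - t j.-1).

Definition mesh_min (n : nat) (t : nat -> R) : R :=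
  \big[Num.min/t 1 - t 0]_(1 <= j < n.+1) (t j - t j.-1).

Definition asymp (a b : nat -> R) : Prop :=
  exists c1 c2 : R, [/\ 0 < c1, 0 < c2 &
    forall n, (1 <= n)%N -> c1 <= a n / b n <= c2].

Section FixedGrid.
Variables (n : nat) (t : nat -> R) (xi : R).

Definition S_ (j : nat) : {set 'I_n.+1} :=
  finset (fun l : 'I_n.+1 => (`|t l - t j| <= xi) && (l != j :> nat)).

Definition N_ (j : nat) : nat := #|S_ j|.

Definition N_max : nat := \big[maxn/N_ 1]_(1 <= j < n.+1) N_ j.
Definition N_min : nat := \big[minn/N_ 1]_(1 <= j < n.+1) N_ j.
Definition N_total : nat := \sum_(j < n.+1) N_ j.

Definition M_tilde_hat (y : nat -> R) (k : nat) : R :=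
  (N_total%:R)^-1 *
  \sum_(j < n.+1) \sum_(l in S_ j) (y l - y j) ^+ (2 * k).

End FixedGrid.

(* [:: 0; m_1; ...; m_k], where m solves the recursion of moment_recE below;
   the entry of index 0 is a dummy. *)
Fixpoint moment_seq (a : nat -> R) (k : nat) : seq R :=
  if k is k'.+1 then
    let s := moment_seq a k' in
    rcons s (2^-1 * (a k - \sum_(1 <= j < k)
                       'C(2 * k, 2 * j)%:R * s`_j * s`_(k - j)))
  else [:: 0].

Definition moment_rec (a : nat -> R) (k : nat) : R := (moment_seq a k)`_k.

Lemma size_moment_seq a k : size (moment_seq a k) = k.+1.
Proof. by elim: k => //= k IH; rewrite size_rcons IH. Qed.

Lemma nth_moment_seq a k j : (j <= k)%N ->
  (moment_seq a k)`_j = moment_rec a j.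
Proof.
elim: k => [|k IH]; first by rewrite leqn0 => /eqP ->.
rewrite leq_eqVlt => /predU1P[-> //|jk].
by rewrite /= nth_rcons size_moment_seq jk IH.
Qed.

Lemma moment_recE a k : (0 < k)%N ->
  moment_rec a k = 2^-1 * (a k - \sum_(1 <= j < k)
    'C(2 * k, 2 * j)%:R * moment_rec a j * moment_rec a (k - j)).
Proof.
case: k => // k _; rewrite {1}/moment_rec [moment_seq a k.+1]/=.
rewrite nth_rcons size_moment_seq ltnn eqxx.
congr (_ * (_ - _)); apply: eq_big_nat => j /andP[j1 jk].
by rewrite !nth_moment_seq// -ltnS// ltn_subrL j1.
Qed.

Definition M_hat (n : nat) (t : nat -> R) (xi : R) (y : nat -> R) (k : nat) :
    R :=
  moment_rec (M_tilde_hat n t xi y) k.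

End Estimators.

(* Main.v *)
(* Only the quadratic size of the increments of X matters.  By local boundedness
   we may work on an event of probability close to 1 on which mu and sigma are
   bounded.  Approximating sigma by simple integrands, stopped once their energy
   exceeds a fixed bound, the Ito isometry gives for a pair (j, l) a mean square
   increment controlled by the energy spent between t_j and t_l; since each grid
   cell is straddled by O((n xi)^2) of the N(xi) ~ n^2 xi pairs, the average over
   all pairs of (X_l - X_j)^2 is O_p(xi), hence o_p(n^(-1/2)).  Expanding,
     (dX + dU)^(2k) = dU^(2k) + 2k dX dU^(2k-1) + O(dX^2 (1 + dU^(2k))).
   The pair average of the first term has variance O(1/n), because two pairs
   without a common index are independent and a pair meets O(n xi) others.  So
   does the second one given X, as E dU^(2k-1) = 0.  The estimators of the moments
   of U_1 - U_0 therefore converge at rate n^(-1/2), and so do the solutions of the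
   recursion, which is locally Lipschitz.  The limits solve the recursion for the
   true even moments because the odd moments of U vanish: a real characteristic
   function means E sin(sU) = 0 for all s, hence E (sin(sU)/s)^m = 0 for odd m, and
   s tends to 0. *)
Require Import Defs.
From HB Require Import structures.
From mathcomp Require Import all_boot all_order all_algebra.
From mathcomp Require Import all_classical all_reals all_analysis.
From mathcomp Require Import measurable_realfun complex ring lra zify.

Set Implicit Arguments.
Unset Strict Implicit.
Unset Printing Implicit Defensive.

Import Order.TTheory GRing.Theory Num.Theory.
Import numFieldNormedType.Exports.

Local Open Scope classical_set_scope.
Local Open Scope ring_scope.

(** * Expectations and independence *)

(** The obstacle is uniformity in [n]. [is_ito_integral] provides convergence in probability only,
    without a rate and without moment bounds on the approximants. Hence the order of choices in
    [ito_pair_avg_whp]: the energy bound [L] depends on the tolerance alone, and the approximant is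
    picked after the grid, when only finitely many values of the integral matter. Switching off at
    energy [L] keeps the integrand simple and adapted and alters no path whose energy is at most
    [L], so a second moment bound becomes available at no cost in probability.

    The rate is insensitive to constants, so the isometry appears as an inequality with factor 8,
    for which an upper bound on the normal second moment is enough.

    No conditional expectation given X is formed. The increments of X are multiplied by the
    indicator of an event that depends on X alone, on which X is bounded and its pair average small;
    these bounded weights are independent of the errors, so means of products factor.

    The bound p > 2 enters through 4k <= 2kp, the order of the error moments behind the variances,
    and the bandwidth through xi <= n^(-1/2), as p / (2 (p - 1)) >= 1/2. *)

Section Mean.
Context {R : realType} {d : measure_display} {Omega : measurableType d}.
Variable P : probability Omega R.
Implicit Types X Y Z : Omega -> R.

Definition integrable_rv X : Prop := P.-integrable setT (EFin \o X).

Definition mean X : R := \int[P]_w X w.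

Lemma integrable_rv_measurable X : integrable_rv X -> measurable_fun setT X.
Proof. by move/measurable_int/measurable_EFinP. Qed.

Lemma integrable_rv_le X Y : measurable_fun setT X ->
  (forall w, `|X w| <= Y w) -> integrable_rv Y -> integrable_rv X.
Proof.
move=> mX XY; apply: le_integrable => //; first exact/measurable_EFinP.
by move=> w _ /=; rewrite lee_fin (le_trans (XY w))// ler_norm.
Qed.

Lemma integrable_rv_cst a : integrable_rv (fun=> a).
Proof. exact: finite_measure_integrable_cst. Qed.

Lemma integrable_rv_bounded X K : measurable_fun setT X ->
  (forall w, `|X w| <= K) -> integrable_rv X.
Proof. by move=> mX XK; apply: (integrable_rv_le mX XK); exact: integrable_rv_cst. Qed.

Lemma integrable_rvD X Y : integrable_rv X -> integrable_rv Y ->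
  integrable_rv (fun w => X w + Y w).
Proof.
move=> iX iY; apply: eq_integrable (integrableD _ iX iY) => // w _.
Qed.

Lemma integrable_rvB X Y : integrable_rv X -> integrable_rv Y ->
  integrable_rv (fun w => X w - Y w).
Proof.
move=> iX iY; apply: eq_integrable (integrableB _ iX iY) => // w _.
Qed.

Lemma integrable_rvZ a X : integrable_rv X -> integrable_rv (fun w => a * X w).
Proof. by move=> iX; apply: eq_integrable (integrableZl _ a iX). Qed.

Lemma integrable_rv_sum I (s : seq I) (Q : pred I) (X : I -> Omega -> R) :
  (forall i, Q i -> integrable_rv (X i)) ->
  integrable_rv (fun w => \sum_(i <- s | Q i) X i w).
Proof.
move=> iX; have := @integrable_sum _ _ _ P setT measurableT _ s Q
  (fun i => EFin \o X i) iX.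
by apply: eq_integrable => // w _; rewrite /= sumEFin.
Qed.

Lemma integrable_rv_norm X : integrable_rv X -> integrable_rv (fun w => `|X w|).
Proof. by move=> iX; apply: integrable_norm. Qed.

Lemma mean_cst a : mean (fun=> a) = a.
Proof.
rewrite /mean Rintegral_cst//.
by rewrite -[fine _]/(fine (P setT)) probability_setT mulr1.
Qed.

Lemma meanD X Y : integrable_rv X -> integrable_rv Y ->
  mean (fun w => X w + Y w) = mean X + mean Y.
Proof. exact: RintegralD. Qed.

Lemma meanB X Y : integrable_rv X -> integrable_rv Y ->
  mean (fun w => X w - Y w) = mean X - mean Y.
Proof. exact: RintegralB. Qed.

Lemma meanZ a X : integrable_rv X -> mean (fun w => a * X w) = a * mean X.
Proof. exact: RintegralZl. Qed.

Lemma mean_sum I (s : seq I) (Q : pred I) (X : I -> Omega -> R) :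
  (forall i, Q i -> integrable_rv (X i)) ->
  mean (fun w => \sum_(i <- s | Q i) X i w) = \sum_(i <- s | Q i) mean (X i).
Proof.
move=> iX; elim: s => [|i s IH].
  by rewrite big_nil -[RHS](mean_cst 0); apply: eq_Rintegral => w _; rewrite big_nil.
rewrite big_cons -IH; case: ifPn => Qi.
  rewrite -meanD; [|exact: iX|exact: integrable_rv_sum].
  by apply: eq_Rintegral => w _; rewrite big_cons Qi.
by apply: eq_Rintegral => w _; rewrite big_cons (negbTE Qi).
Qed.

Lemma mean_le X Y : integrable_rv X -> integrable_rv Y ->
  (forall w, X w <= Y w) -> mean X <= mean Y.
Proof. by move=> iX iY XY; apply: le_Rintegral. Qed.

Lemma mean_ge0 X : (forall w, 0 <= X w) -> 0 <= mean X.
Proof. by move=> X0; apply: Rintegral_ge0. Qed.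

Lemma EFin_mean X : integrable_rv X -> (mean X)%:E = (\int[P]_w (X w)%:E)%E.
Proof. by move=> iX; rewrite /mean /Rintegral fineK//; exact: integrable_fin_num iX. Qed.

Lemma markov_mean X a : integrable_rv X -> (forall w, 0 <= X w) -> 0 < a ->
  (P [set w | a < X w]%R <= (mean X / a)%:E)%E.
Proof.
move=> iX X0 a0.
have mX := integrable_rv_measurable iX.
have mA : measurable [set w | a < X w].
  by rewrite -[X in measurable X]setTI; apply: (measurable_fun_ltr _ mX).
have iA : integrable_rv (fun w => a * \1_[set w | a < X w] w).
  apply: integrable_rvZ; exact: integrable_indic.
have : mean (fun w => a * \1_[set w | a < X w] w) <= mean X.
  apply: mean_le => // w; rewrite indicE; case: (boolP (w \in _)) => [/set_mem/ltW|_];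
    rewrite ?mulr1 ?mulr0//.
rewrite meanZ; last exact: integrable_indic.
rewrite mulrC -ler_pdivlMr// -lee_fin; apply: le_trans.
by rewrite EFin_mean ?integral_indic ?setIT//; exact: integrable_indic.
Qed.

End Mean.

Section Independence.
Context {R : realType} {d : measure_display} {Omega : measurableType d}.
Variable P : probability Omega R.

Definition indep_systems (G H : set (set Omega)) : Prop :=
  forall A B, G A -> H B -> (P (A `&` B) = P A * P B)%E.

Lemma indep_systemsC G H : indep_systems G H -> indep_systems H G.
Proof. by move=> GH A B HA GB; rewrite setIC GH// muleC. Qed.

(** For a fixed [B] in [H], the events independent of [B] form a lambda-system, so Dynkin's theorem
    applies to [G]. One side is extended at a time. *)
Lemma indep_systems_sigmal (G H : set (set Omega)) :
  setI_closed G -> G `<=` measurable -> H `<=` measurable ->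
  indep_systems G H -> indep_systems <<s G >> H.
Proof.
move=> GI Gm Hm GH A B sA HB.
have mB := Hm _ HB.
pose D := [set A | measurable A /\ (P (A `&` B) = P A * P B)%E].
suff : D A by case.
have fin (C : set Omega) : measurable C -> P C \is a fin_num.
  by move=> mC; exact: fin_num_measure.
apply: (lambda_system_subset GI) sA => //.
- apply/dynkin_lambda_system; split.
  + split; first exact: measurableT.
    by rewrite setTI probability_setT mul1e.
  + move=> C [mC CB]; split; first exact: measurableC.
    rewrite setIC -setDE.
    have -> : (P (B `\` C) = P B - P (B `&` C))%E.
      by apply: measureD => //; rewrite ltey_eq fin.
    by rewrite (setIC B) CB probability_setC// muleBl ?fin// ?mul1e//.
  + move=> F tF FD; split.
      by apply: bigcup_measurable => i _; have [] := FD i.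
    have mF i : measurable (F i) by have [] := FD i.
    rewrite setI_bigcupl measure_bigcup//; last 2 first.
      by move=> i _; exact: measurableI.
      exact: trivIset_setIr.
    rewrite measure_bigcup//.
    transitivity (\sum_(0 <= i <oo | i \in [set: nat]) (P B * P (F i)))%E.
      by apply: eq_eseriesr => i _; rewrite muleC; exact: (FD i).2.
    by rewrite -[P B]fineK ?fin// nneseriesZl// 1?muleC.
- by move=> C GC; split; [exact: Gm|exact: GH].
Qed.

Lemma indep_systems_sigma (G H : set (set Omega)) :
  setI_closed G -> setI_closed H -> G `<=` measurable -> H `<=` measurable ->
  indep_systems G H -> indep_systems <<s G >> <<s H >>.
Proof.
move=> GI HI Gm Hm GH; have sGm : <<s G >> `<=` measurable.
  apply: smallest_sub => //; exact: sigma_algebra_measurable.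
by apply/indep_systemsC/indep_systems_sigmal => //; apply/indep_systemsC/indep_systems_sigmal.
Qed.

End Independence.

Section IndependentProduct.
Context {R : realType} {d : measure_display} {Omega : measurableType d}.
Variable P : probability Omega R.
Implicit Types X Y Z : Omega -> R.

Lemma measurable_rv_preimage (G : set (set Omega)) Y (A : set R) :
  measurable_fun (setT : set (g_sigma_algebraType G)) Y -> measurable A ->
  <<s G >> (Y @^-1` A).
Proof. by move=> mY mA; have := mY measurableT A mA; rewrite setTI. Qed.

Lemma measurable_rv_sub (G : set (set Omega)) Y : G `<=` measurable ->
  measurable_fun (setT : set (g_sigma_algebraType G)) Y ->
  measurable_fun (setT : set Omega) Y.
Proof.
move=> Gm mY _ A mA; rewrite setTI.
have sGm : <<s G >> `<=` @measurable _ Omega.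
  by apply: smallest_sub => //; exact: sigma_algebra_measurable.
by apply: sGm; exact: measurable_rv_preimage.
Qed.

Let law Y (mY : measurable_fun setT Y) : {RV P >-> R} :=
  HB.pack Y (isMeasurableFun.Build _ _ _ _ Y mY).

(** The joint law agrees with the product of the laws on rectangles, hence everywhere; Tonelli then
    gives integrability of the product and Fubini the factorization. The generating systems [G] and
    [H] allow [Y] and [Z] to be arbitrary functionals of two independent families. *)
Lemma mean_indepM (G H : set (set Omega)) Y Z :
  indep_systems P <<s G >> <<s H >> -> G `<=` measurable -> H `<=` measurable ->
  measurable_fun (setT : set (g_sigma_algebraType G)) Y ->
  measurable_fun (setT : set (g_sigma_algebraType H)) Z ->
  integrable_rv P Y -> integrable_rv P Z ->
  integrable_rv P (fun w => Y w * Z w) /\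
  mean P (fun w => Y w * Z w) = mean P Y * mean P Z.
Proof.
move=> GH Gm Hm sY sZ iY iZ.
have mY := measurable_rv_sub Gm sY; have mZ := measurable_rv_sub Hm sZ.
pose YZ : Omega -> R * R := fun w => (Y w, Z w).
have mYZ : measurable_fun setT YZ by apply/measurable_fun_pair.
pose LY := distribution P (law mY); pose LZ := distribution P (law mZ).
pose mL := distribution P (HB.pack_for {mfun Omega >-> (R * R)%type} YZ
  (isMeasurableFun.Build _ _ _ _ YZ mYZ)).
have LE : forall D, measurable D -> (LY \x LZ)%E D = mL D.
  apply: product_measure_unique => A B mA mB.
  exact: GH (measurable_rv_preimage sY mA) (measurable_rv_preimage sZ mB).

have LEi (f : R * R -> \bar R) : measurable_fun setT f -> (forall z, 0 <= f z)%E ->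
    (\int[P]_w f (YZ w) = \int[LY]_y \int[LZ]_z f (y, z))%E.
  move=> mf f0; rewrite -fubini_tonelli1//.
  have -> : (\int[P]_w f (YZ w) = \int[mL]_z f z)%E by rewrite ge0_integral_distribution.
  by apply: eq_measure_integral => D mD _; exact/esym/LE.
have iYZ : integrable_rv P (fun w => Y w * Z w).
  apply/integrableP; split; first by apply/measurable_EFinP; exact: measurable_funM.
  have -> : (\int[P]_x `|(EFin \o (fun w => (Y w * Z w)%R)) x|
      = \int[LY]_y \int[LZ]_z `|(y * z)%:E|)%E.
    rewrite -(LEi (fun u => `|(u.1 * u.2)%:E|%E))//.
    by apply: measurableT_comp => //; apply/measurable_EFinP; apply: measurable_funM.
  under eq_integral do under eq_integral do rewrite EFinM abseM.
  under eq_integral => y _.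
    rewrite ge0_integralZl//; last by do 2 apply: measurableT_comp => //.
    over.
  rewrite ge0_integralZr//; last 2 first.
    by do 2 apply: measurableT_comp => //.
    exact: integral_ge0.
  rewrite !ge0_integral_distribution//; try by do 2 apply: measurableT_comp => //.
  have /integrableP[_ hY] := iY; have /integrableP[_ hZ] := iZ.
  have pos (X : Omega -> R) : (0 <= \int[P]_x `|(EFin \o X) x|)%E.
    by apply: integral_ge0 => w _; exact: abse_ge0.
  by apply: lte_mul_pinfty => //; [exact: pos|rewrite ge0_fin_numE//; exact: pos].
split=> //; apply: EFin_inj; rewrite EFinM !EFin_mean//.
have iL X (mX : measurable_fun setT X) : integrable_rv P X ->
    (distribution P (law mX)).-integrable setT (EFin : R -> \bar R).
  move=> /integrableP[_ hX]; apply/integrableP; split; first exact/measurable_EFinP.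
  by rewrite ge0_integral_distribution//; exact: measurableT_comp.
have mf : measurable_fun setT (fun u : R * R => (u.1 * u.2)%:E).
  by apply/measurable_EFinP; apply: measurable_funM.
have -> : (\int[P]_w (Y w * Z w)%:E = \int[mL]_z (z.1 * z.2)%:E)%E.
  by rewrite integral_distribution.
have -> : (\int[mL]_z (z.1 * z.2)%:E = \int[LY \x LZ]_z (z.1 * z.2)%:E)%E.
  by apply: eq_measure_integral => D mD _; exact/esym/LE.
rewrite -integral12_prod_meas1/=; last first.
  apply/integrable12ltyP => //=.
  have /integrableP[_] := iYZ.
  by rewrite (LEi (fun u => `|(u.1 * u.2)%:E|%E))//; exact: measurableT_comp.
transitivity (\int[LY]_y (y%:E * (mean P Z)%:E))%E.
  apply: eq_integral => y _; rewrite /fubini_F.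
  transitivity (\int[LZ]_z (y%:E * z%:E))%E; first exact: eq_integral.
  rewrite integralZl//; last exact: iL.
  by rewrite integral_distribution// EFin_mean.
rewrite integralZr//; last exact: iL.
by rewrite integral_distribution// EFin_mean.
Qed.
End IndependentProduct.

Section MutualIndependence.
Context {R : realType} {d : measure_display} {Omega : measurableType d}.
Variable P : probability Omega R.
Variables (m : nat) (V : nat -> Omega -> R).
Hypothesis mV : forall j, (j < m)%N -> measurable_fun setT (V j).
Hypothesis indV : mutually_independent P m V.

(** [mutually_independent] speaks of all [m] coordinates at once, so an event on the coordinates in
    [D] is written with every coordinate, the others being constrained to the full line. *)
Definition cylinders (D : set nat) : set (set Omega) :=
  [set E | exists A : nat -> set R, [/\ forall j, measurable (A j),
     forall j, ~ D j -> A j = setT &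
     E = \bigcap_(j in [set j | (j < m)%N]) (V j @^-1` A j)]].

Lemma cylinders_setI_closed D : setI_closed (cylinders D).
Proof.
move=> E E' [A [mA AD ->]] [A' [mA' AD' ->]].
exists (fun j => A j `&` A' j); split.
- by move=> j; exact: measurableI.
- by move=> j Dj; rewrite AD// AD'// setIT.
- rewrite eqEsubset; split=> w.
    by move=> [wA wA'] j jm; split; [exact: wA|exact: wA'].
  by move=> wAA'; split=> j jm; have [] := wAA' j jm.
Qed.

Lemma cylinders_measurable D : cylinders D `<=` measurable.
Proof.
move=> E [A [mA _ ->]]; apply: bigcap_measurableType => // j /= jm.
by rewrite -[X in measurable X]setTI; exact: mV.
Qed.

Lemma indep_cylinders (D D' : set nat) : D `&` D' = set0 ->
  indep_systems P <<s cylinders D >> <<s cylinders D' >>.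
Proof.
move=> DD'; apply: indep_systems_sigma; do ?exact: cylinders_setI_closed;
  do ?exact: cylinders_measurable.
move=> E E' [A [mA AD ->]] [A' [mA' AD' ->]].
have -> : \bigcap_(j in [set j | (j < m)%N]) V j @^-1` A j `&`
    \bigcap_(j in [set j | (j < m)%N]) V j @^-1` A' j =
    \bigcap_(j in [set j | (j < m)%N]) V j @^-1` (A j `&` A' j).
  rewrite eqEsubset; split=> w.
    by move=> [wA wA'] j jm; split; [exact: wA|exact: wA'].
  by move=> wAA'; split=> j jm; have [] := wAA' j jm.
rewrite !indV//; last by move=> j; exact: measurableI.
have fin (C : set Omega) : measurable C -> P C \is a fin_num.
  by move=> mC; exact: fin_num_measure.
(* Each coordinate is constrained by at most one of the two events, so in every factor one of the
   two probabilities is 1. *)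
rewrite -big_split/=; apply: eq_bigr => j _.
have [Dj|/AD ->] := pselect (D j); last first.
  by rewrite setTI preimage_setT probability_setT mul1e.
have /AD' -> : ~ D' j by move=> D'j; have : (D `&` D') j by []; rewrite DD'.
by rewrite setIT preimage_setT probability_setT mule1.
Qed.

Lemma measurable_cylinders (D : set nat) j : (j < m)%N -> D j ->
  measurable_fun (setT : set (g_sigma_algebraType (cylinders D))) (V j).
Proof.
move=> jm Dj _ A mA; rewrite setTI; apply: sub_gen_smallest.
exists (fun i => if i == j then A else setT); split.
- by move=> i; case: ifP.
- by move=> i Di; case: eqP => // ij; rewrite ij in Di.
- rewrite eqEsubset; split=> w /=.
    by move=> wA i _; case: eqP => // ->.
  by move=> /(_ j jm); rewrite /= eqxx.
Qed.

End MutualIndependence.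

Section IdenticallyDistributed.
Context {R : realType} {d : measure_display} {Omega : measurableType d}.
Variable P : probability Omega R.
Variables X Y : {RV P >-> R}.
Hypothesis XY : forall A, measurable A -> distribution P X A = distribution P Y A.

Lemma integrable_rv_eq_law (g : R -> R) : measurable_fun setT g ->
  integrable_rv P (fun w => g (X w)) -> integrable_rv P (fun w => g (Y w)).
Proof.
move=> mg /integrableP[_ hX]; apply/integrableP; split.
  by apply/measurable_EFinP; exact: (measurableT_comp mg).
have mag : measurable_fun setT (fun x => `|(g x)%:E|%E).
  by apply: measurableT_comp => //; exact/measurable_EFinP.
move: hX; rewrite -(ge0_integral_distribution X mag)// -(ge0_integral_distribution Y mag)//.
apply: le_lt_trans; rewrite le_eqVlt; apply/orP; left; apply/eqP.
by apply: eq_measure_integral => A mA _; exact/esym/XY.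
Qed.

Lemma mean_eq_law (g : R -> R) : measurable_fun setT g ->
  integrable_rv P (fun w => g (X w)) ->
  mean P (fun w => g (X w)) = mean P (fun w => g (Y w)).
Proof.
move=> mg iX; have iY := integrable_rv_eq_law mg iX.
apply: EFin_inj; rewrite !EFin_mean//.
have mg' : measurable_fun setT (fun x => (g x)%:E) by exact/measurable_EFinP.
rewrite -(integral_distribution mg' iX) -(integral_distribution mg' iY).
by apply: eq_measure_integral => A mA _; exact: XY.
Qed.

End IdenticallyDistributed.

(** * Integration against a density and moments of centred normal laws *)

Section Density.
Context {R : realType} {d : measure_display} {V : measurableType d}.
Variables (mu nu : {measure set V -> \bar R}) (g : V -> R).
Hypotheses (mg : measurable_fun setT g) (g0 : forall x, 0 <= g x).
Hypothesis nuE : forall A, measurable A -> nu A = (\int[mu]_(x in A) (g x)%:E)%E.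

Import HBNNSimple.

Let ge0_integral_density_nnsfun (h : {nnsfun V >-> R}) :
  (\int[nu]_x (h x)%:E = \int[mu]_x ((h x)%:E * (g x)%:E))%E.
Proof.
have mgE : measurable_fun setT (EFin \o g) by exact/measurable_EFinP.
under [LHS]eq_integral do rewrite fimfunE -fsumEFin//.
rewrite [LHS]ge0_integral_fsum//; last 2 first.
  - by move=> r; exact/measurable_EFinP/measurableT_comp.
  - by move=> n x _; rewrite EFinM nnfun_muleindic_ge0.
under [RHS]eq_integral.
  move=> x xD; rewrite fimfunE -fsumEFin// ge0_mule_fsuml; last first.
    by move=> r; rewrite EFinM nnfun_muleindic_ge0.
  over.
rewrite [RHS]ge0_integral_fsum//; last 2 first.
  - by move=> r; apply: emeasurable_funM => //; apply/measurable_EFinP/measurableT_comp.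
  - move=> n x _; apply: mule_ge0; last by rewrite lee_fin.
    by rewrite EFinM nnfun_muleindic_ge0.
apply: eq_fsbigr => r _.
have mr : measurable (h @^-1` [set r]) by [].
(* [ge0_integralZl] asks for a nonnegative level; a negative one has an empty level set. *)
have [r0|r0] := ltP r 0.
  have h0 : h @^-1` [set r] = set0.
    rewrite -subset0 => x /= hx; have : 0 <= h x by []; rewrite hx => /(lt_le_trans r0).
    by rewrite ltxx.
  rewrite h0; under eq_integral do rewrite indic0 mulr0.
  by rewrite integral0; under eq_integral do rewrite indic0 mulr0 mul0e; rewrite integral0.
under eq_integral do rewrite EFinM.
rewrite ge0_integralZl//; last exact/measurable_EFinP/measurable_indic.
under [RHS]eq_integral do rewrite EFinM -muleA.
rewrite ge0_integralZl//; last 2 first.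
  - by apply: emeasurable_funM => //; apply/measurable_EFinP/measurable_indic.
  - by move=> x _; rewrite mule_ge0 ?lee_fin.
congr (_ * _)%E; rewrite integral_indic//= setIT nuE// integral_mkcond/=.
by apply: eq_integral => x _; rewrite patchE indicE; case: ifP; rewrite ?mul1e ?mul0e.
Qed.

Lemma ge0_integral_density (f : V -> \bar R) :
  measurable_fun setT f -> (forall x, 0 <= f x)%E ->
  (\int[nu]_x f x = \int[mu]_x (f x * (g x)%:E))%E.
Proof.
move=> mf f0; pose h := nnsfun_approx measurableT mf.
have mgE : measurable_fun setT (EFin \o g) by exact/measurable_EFinP.
transitivity (lim (\int[nu]_x (h n x)%:E @[n --> \oo])%E).
  rewrite -monotone_convergence//=.
  - apply: eq_integral => ? /[!inE] xD; apply/esym/cvg_lim => //=.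
    exact: cvg_nnsfun_approx.
  - by move=> n; exact/measurable_EFinP/measurable_funTS.
  - by move=> n ? _; rewrite lee_fin.
  - by move=> ? _ ? ? mn; rewrite lee_fin; exact/lefP/nd_nnsfun_approx.
transitivity (lim (\int[mu]_x ((h n x)%:E * (g x)%:E) @[n --> \oo])%E).
  by apply: congr_lim; apply/funext => n /=; exact: ge0_integral_density_nnsfun.
rewrite -monotone_convergence//=.
- apply: eq_integral => x /[!inE] xD; apply/cvg_lim => //=.
  by apply: cvgeZr => //; exact: cvg_nnsfun_approx.
- by move=> n; apply: emeasurable_funM => //; exact/measurable_EFinP/measurable_funTS.
- by move=> n ? _; rewrite mule_ge0// lee_fin.
- move=> x _ ? ? mn; apply: lee_wpmul2r; rewrite lee_fin//.
  exact/lefP/nd_nnsfun_approx.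
Qed.

End Density.

Section DensityOnR.
Context {R : realType} {d : measure_display} {Omega : measurableType d}.
Variable P : probability Omega R.
Local Notation leb := (@lebesgue_measure R).

Lemma ge0_integral_rv_density (D : Omega -> R) (g f : R -> R) :
  measurable_fun setT D -> measurable_fun setT g -> (forall x, 0 <= g x) ->
  (forall A, measurable A -> P (D @^-1` A) = (\int[leb]_(x in A) (g x)%:E)%E) ->
  measurable_fun setT f -> (forall x, 0 <= f x) ->
  (\int[P]_w (f (D w))%:E = \int[leb]_x (f x * g x)%:E)%E.
Proof.
move=> mD mg g0 hD mf f0.
(* The retyping puts the law of [D] on the measurable space that carries [lebesgue_measure]. *)
pose D1 : Omega -> measurableTypeR R := D.
pose D2 : {mfun Omega >-> measurableTypeR R} :=
  HB.pack D1 (isMeasurableFun.Build _ _ _ (measurableTypeR R) D1 mD).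
have mfE : measurable_fun setT ((fun x => (f x)%:E) : measurableTypeR R -> \bar R).
  exact/measurable_EFinP.
transitivity (\int[distribution P D2]_x (f x)%:E)%E.
  by rewrite ge0_integral_distribution.
by rewrite (@ge0_integral_density _ _ _ leb (distribution P D2) g).
Qed.

End DensityOnR.

Section NormalMoments.
Context {R : realType}.
Implicit Types s x : R.
Local Notation leb := (@lebesgue_measure R).

(* [u <= exp u] with [u = 3x^2/(8s^2)] absorbs the factor [x^2] into a wider
   Gaussian, so no integration by parts is needed. *)
Lemma normal_pdf_sqr_le s x : 0 < s ->
  x ^+ 2 * normal_pdf 0 s x <= 8 * s ^+ 2 * normal_pdf 0 (2 * s) x.
Proof.
move=> s0.
have s20 : 2 * s != 0 by rewrite mulf_neq0// gt_eqF.
have sN0 : s != 0 by rewrite gt_eqF.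
rewrite !normal_pdfE//.
rewrite /normal_fun !subr0.
have -> : normal_peak (2 * s) = normal_peak s / 2.
  rewrite /normal_peak.
  have -> : (2 * s) ^+ 2 * pi *+ 2 = 2 ^+ 2 * (s ^+ 2 * pi *+ 2) by ring.
  by rewrite sqrtrM ?sqr_ge0// sqrtr_sqr ger0_norm// invfM mulrC.
set p := normal_peak s.
have p0 : 0 <= p by exact: normal_peak_ge0.
have -> : - x ^+ 2 / (s ^+ 2 *+ 2) =
    - x ^+ 2 / ((2 * s) ^+ 2 *+ 2) - 3 / 8 * (x ^+ 2 / s ^+ 2).
  by field; rewrite gt_eqF.
rewrite expRD; set e := expR (_ / _).
have e0 : 0 <= e by exact: expR_ge0.
set u := 3 / 8 * _.
have u0 : x ^+ 2 * expR (- u) <= 4 * s ^+ 2.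
  have -> : x ^+ 2 = 8 / 3 * s ^+ 2 * u by rewrite /u; field; rewrite gt_eqF.
  have : u * expR (- u) <= 1.
    rewrite expRN -ler_pdivlMr ?invr_gt0 ?expR_gt0// mul1r invrK.
    by apply: le_trans (expR_ge1Dx u); rewrite lerDr.
  have : 0 <= s ^+ 2 by exact: sqr_ge0.
  set v := expR (- u); nra.
have : 0 <= p * e by exact: mulr_ge0.
move: u0; set v := expR _; nra.
Qed.

Context {d : measure_display} {Omega : measurableType d}.
Variables (P : probability Omega R) (D : {RV P >-> R}) (s : R).
Hypotheses (s0 : 0 < s)
  (hD : forall A, measurable A -> distribution P D A = normal_prob 0 s A).

Let ge0_normal (f : R -> R) : measurable_fun setT f -> (forall x, 0 <= f x) ->
  (\int[P]_w (f (D w))%:E = \int[leb]_x (f x * normal_pdf 0 s x)%:E)%E.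
Proof.
move=> mf f0.
apply: ge0_integral_rv_density => //.
- exact: measurable_normal_pdf.
- by move=> x; exact: normal_pdf_ge0.
Qed.

Let normal_sqr_le : (\int[P]_w (D w ^+ 2)%:E <= (8 * s ^+ 2)%:E)%E.
Proof.
rewrite (ge0_normal (f := fun x => x ^+ 2))//; last by move=> x; exact: sqr_ge0.
apply: (@le_trans _ _ (\int[leb]_x ((8 * s ^+ 2)%:E * (normal_pdf 0 (2 * s) x)%:E))%E).
  apply: ge0_le_integral => //.
  - by move=> x _; rewrite lee_fin mulr_ge0 ?sqr_ge0 ?normal_pdf_ge0.
  - apply/measurable_EFinP; apply: measurable_funM => //; exact: measurable_normal_pdf.
  - apply: measurable_funeM; apply/measurable_EFinP; exact: measurable_normal_pdf.
  - by move=> x _; rewrite -EFinM lee_fin normal_pdf_sqr_le.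
rewrite integralZl//; last exact: integrable_normal_pdf.
by rewrite integral_normal_pdf mule1.
Qed.

Lemma integrable_rv_normal_sqr : integrable_rv P (fun w => D w ^+ 2).
Proof.
apply/integrableP; split; first by apply/measurable_EFinP; exact: measurable_funX.
under eq_integral do rewrite /= ger0_norm ?sqr_ge0//.
exact: le_lt_trans normal_sqr_le (ltry _).
Qed.

Lemma normal_mean_sqr_le : mean P (fun w => D w ^+ 2) <= 8 * s ^+ 2.
Proof. by rewrite -lee_fin EFin_mean//; exact: integrable_rv_normal_sqr. Qed.

Lemma integrable_rv_normal : integrable_rv P D.
Proof.
apply: (@integrable_rv_le _ _ _ P D (fun w => 1 + D w ^+ 2)) => //.
  move=> w; have := sqr_ge0 (`|D w| - 1); rewrite -[D w ^+ 2]real_normK ?num_real//.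
  have := normr_ge0 (D w); nra.
apply: integrable_rvD; [exact: integrable_rv_cst|exact: integrable_rv_normal_sqr].
Qed.

(** The density is even, so the positive and the negative part of [D] have equal means. Splitting
    into parts leaves nonnegative integrands, for which the transfer to the density and the
    substitution x -> -x are available. *)
Lemma normal_mean0 : mean P D = 0.
Proof.
pose hp x : R := Num.max x 0; pose hn x : R := Num.max (- x) 0.
have chp : continuous hp by move=> x; apply: continuous_max; [exact: cvg_id|exact: cvg_cst].
have mhp : measurable_fun setT hp by exact: measurable_funrpos.
have mhn : measurable_fun setT hn by exact: measurable_funrneg.
have hp0 x : 0 <= hp x by rewrite le_max lexx orbT.
have hn0 x : 0 <= hn x by rewrite le_max lexx orbT.
have ihp : integrable_rv P (fun w => hp (D w)).
  apply: (@integrable_rv_le _ _ _ P _ (fun w => `|D w|)).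
  - exact: measurableT_comp.
  - by move=> w; rewrite ger0_norm// ge_max normr_ge0 ler_norm.
  - exact/integrable_rv_norm/integrable_rv_normal.
have ihn : integrable_rv P (fun w => hn (D w)).
  apply: (@integrable_rv_le _ _ _ P _ (fun w => `|D w|)).
  - exact: measurableT_comp.
  - by move=> w; rewrite ger0_norm// ge_max normr_ge0 -normrN ler_norm.
  - exact/integrable_rv_norm/integrable_rv_normal.
have -> : mean P D = mean P (fun w => hp (D w)) - mean P (fun w => hn (D w)).
  rewrite -meanB//; apply: eq_Rintegral => w _; rewrite /hp /hn.
  by case: (leP (D w) 0) => h; case: (leP (- D w) 0) => h2; lra.
apply/eqP; rewrite subr_eq0; apply/eqP; apply: EFin_inj; rewrite !EFin_mean//.
rewrite !ge0_normal//.
have sym x : normal_pdf 0 s (- x) = normal_pdf 0 s x.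
  by rewrite !normal_pdfE ?gt_eqF//= /normal_fun !subr0 sqrrN.
have chn : continuous hn.
  by move=> x; apply: continuous_max; [exact: cvgN|exact: cvg_cst].
have cH : continuous (fun x => hn x * normal_pdf 0 s x).
  by move=> x; apply: cvgM; [exact: chn|apply: continuous_normal_pdf; rewrite gt_eqF].
transitivity (\int[leb]_(x in `[0%R, +oo[) (hp x * normal_pdf 0 s x)%:E)%E.
  rewrite [RHS]integral_mkcond; apply: eq_integral => x _; rewrite patchE.
  case: ifPn => //; rewrite notin_setE/= in_itv/= andbT => /negP; rewrite -ltNge => x0.
  by rewrite /hp max_r ?mul0r// ltW.
(* The negative part lives on the left half-line; the bound [- 0] is the shape that the substitution
   lemma produces at 0. *)
transitivity (\int[leb]_(x in `]-oo, (- 0)%R]) (hn x * normal_pdf 0 s x)%:E)%E.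
  apply/esym.
  apply: (etrans (@ge0_integration_by_substitutionNy _ (fun x => hn x * normal_pdf 0 s x) 0 _ _)).
  - exact: continuous_subspaceT.
  - by move=> x _; rewrite mulr_ge0 ?normal_pdf_ge0.
  - by apply: eq_integral => x _; rewrite /= sym /hn opprK.
rewrite [LHS]integral_mkcond; apply: eq_integral => x _; rewrite patchE.
case: ifPn => //; rewrite notin_setE/= in_itv/= oppr0 => /negP; rewrite -ltNge => x0.
by rewrite /hn max_r ?mul0r// oppr_le0 ltW.
Qed.

End NormalMoments.

(** * Increments of Brownian motion and simple integrals *)

Section Clamp.
Context {R : realType}.
Implicit Types a b x y : R.

Definition clamp a b x := Num.min (Num.max x a) b.

Lemma clamp_itv a b x : a <= b -> a <= clamp a b x <= b.
Proof. by move=> ab; rewrite le_min le_max lexx orbT ab ge_min lexx orbT. Qed.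

Lemma clamp_le a b x y : x <= y -> clamp a b x <= clamp a b y.
Proof. by move=> xy; rewrite /clamp/Num.min /Num.max; do ![case: ifPn]; rewrite -?leNgt; lra. Qed.

(** The left value is then below [b], so clamping can only have moved [x] upwards. This keeps the
    coefficient of a nondegenerate clamped interval known at its left end. *)
Lemma clamp_lt_ge a b x y : clamp a b x < clamp a b y -> x <= clamp a b x.
Proof. by rewrite /clamp/Num.min /Num.max; do ![case: ifPn]; rewrite -?leNgt; lra. Qed.

Lemma clamp_min (B : R -> R) a b x : a <= b ->
  B (Num.min x b) - B (Num.min x a) = B (clamp a b x) - B a.
Proof.
rewrite /clamp => ab; case: (leP x a) => xa.
  by rewrite !min_l// ?subrr// (le_trans xa).
by [].
Qed.

End Clamp.

Section BrownianIncrements.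
Context {R : realType} {d : measure_display} {Omega : measurableType d}.
Variables (P : probability Omega R) (T : R) (F : R -> set (set Omega)).
Hypothesis hF : filtration T F.

(** Adaptedness phrased as measurability for the sigma-algebra generated by [F t], which is [F t]
    itself by [sigma_filtration], so that the closure lemmas for measurable functions apply. *)
Definition known_at (t : R) (Y : Omega -> R) : Prop :=
  measurable_fun (setT : set (g_sigma_algebraType (F t))) Y.

Lemma sigma_filtration t : 0 <= t <= T -> <<s F t >> = F t.
Proof. by move=> tT; apply: sigma_algebra_id; case: hF => sF _ _; exact: sF. Qed.

Lemma known_at_preimage t Y : 0 <= t <= T ->
  (forall A, measurable A -> F t (Y @^-1` A)) -> known_at t Y.
Proof. by move=> tT FY _ A mA; rewrite setTI; apply: sub_gen_smallest; exact: FY. Qed.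

Lemma known_at_le s t Y : 0 <= s -> s <= t -> t <= T -> known_at s Y -> known_at t Y.
Proof.
move=> s0 st tT kY _ A mA; rewrite setTI.
have := measurable_rv_preimage kY mA; rewrite sigma_filtration ?s0 ?(le_trans st)//.
by case: hF => _ _ Fst Fs; apply: sub_gen_smallest; exact: (Fst s t).
Qed.

Lemma known_at_measurable t Y : 0 <= t <= T -> known_at t Y -> measurable_fun setT Y.
Proof. by move=> tT; apply: measurable_rv_sub; case: hF => _ Fm _; exact: Fm. Qed.

Variable B : R -> Omega -> R.
Hypothesis hB : brownian_motion P T F B.

Lemma known_at_brownian t : 0 <= t <= T -> known_at t (B t).
Proof. by move=> tT; apply: known_at_preimage => //; case: hB => aB _ _ _ _; exact: aB. Qed.

Section Increment.
Variables s t : R.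
Hypotheses (s0 : 0 <= s) (st : s < t) (tT : t <= T).
Let D w := B t w - B s w.
Let s0T : 0 <= s <= T. Proof. by rewrite s0 ltW// (lt_le_trans st). Qed.
Let t0T : 0 <= t <= T. Proof. by rewrite (le_trans s0 (ltW st)). Qed.

Let mD : measurable_fun setT D.
Proof.
by apply: measurable_funB; [exact: known_at_measurable (known_at_brownian t0T)|
  exact: known_at_measurable (known_at_brownian s0T)].
Qed.

Let D' : {RV P >-> R} := HB.pack D (isMeasurableFun.Build _ _ _ _ D mD).

Let lawD A : measurable A -> distribution P D' A = normal_prob 0 (Num.sqrt (t - s)) A.
Proof. by move=> mA; case: hB => _ _ _ _; exact. Qed.

Let sd_gt0 : 0 < Num.sqrt (t - s). Proof. by rewrite sqrtr_gt0 subr_gt0. Qed.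

Lemma integrable_increment : integrable_rv P (fun w => B t w - B s w).
Proof. exact: integrable_rv_normal sd_gt0 lawD. Qed.

Lemma integrable_increment_sqr : integrable_rv P (fun w => (B t w - B s w) ^+ 2).
Proof. exact: integrable_rv_normal_sqr sd_gt0 lawD. Qed.

Lemma mean_increment : mean P (fun w => B t w - B s w) = 0.
Proof. exact: normal_mean0 sd_gt0 lawD. Qed.

Lemma mean_increment_sqr_le : mean P (fun w => (B t w - B s w) ^+ 2) <= 8 * (t - s).
Proof.
have := normal_mean_sqr_le sd_gt0 lawD.
by rewrite sqr_sqrtr// subr_ge0 ltW.
Qed.

(** [brownian_motion] gives independence event by event; [F s] and the preimages under the increment
    are both stable under intersection, so it extends to sigma-algebras. Cross terms use [g] as the
    identity, diagonal terms as the square. *)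
Lemma mean_knownM Y (g : R -> R) : known_at s Y -> integrable_rv P Y ->
  measurable_fun setT g -> integrable_rv P (fun w => g (B t w - B s w)) ->
  integrable_rv P (fun w => Y w * g (B t w - B s w)) /\
  mean P (fun w => Y w * g (B t w - B s w)) =
  mean P Y * mean P (fun w => g (B t w - B s w)).
Proof.
move=> kY iY mg ig.
pose H := preimage_set_system setT D (@measurable _ R).
have [sF Fm _] := hF.
have HI : setI_closed H.
  move=> A C [A' mA' <-] [C' mC' <-]; exists (A' `&` C'); first exact: measurableI.
  by rewrite !setTI.
have Hm : H `<=` measurable by move=> A [A' mA' <-]; exact: mD.
apply: (mean_indepM (G := F s) (H := H)) => //.
- apply: indep_systems_sigma => //; [|exact: Fm|].
    by rewrite -sigma_filtration//; move=> A C hA hC;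
      apply: (@measurableI _ (g_sigma_algebraType (F s))).
  move=> A C FA [C' mC' <-]; rewrite setTI setIC muleC.
  by case: hB => _ _ _ indB _; exact: indB.
- exact: Fm.
- have mDH : measurable_fun (setT : set (g_sigma_algebraType H)) D.
    by move=> _ A mA; rewrite setTI; apply: sub_gen_smallest; exists A => //; rewrite setTI.
  exact: measurableT_comp mg mDH.
Qed.

End Increment.

(** Induction on the number of terms: the last increment is independent of everything before it, so
    the cross term has mean zero and the new square factors. [known_at] is asked on nondegenerate
    intervals only, since it may fail at clamped knots that coincide. The factor 8 is that of
    [mean_increment_sqr_le]. *)
Lemma ito_sum_sqr (m : nat) (c : nat -> R) (h : nat -> Omega -> R) :
  (forall i, (i <= m)%N -> 0 <= c i <= T) ->
  (forall i, (i < m)%N -> c i <= c i.+1) ->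
  (forall i, (i < m)%N -> measurable_fun setT (h i)) ->
  (forall i, (i < m)%N -> c i < c i.+1 -> known_at (c i) (h i)) ->
  (forall i, (i < m)%N -> exists K : R, forall w, `|h i w| <= K) ->
  let S w := \sum_(i < m) h i w * (B (c i.+1) w - B (c i) w) in
  [/\ known_at (c m) S, integrable_rv P (fun w => S w ^+ 2) &
    mean P (fun w => S w ^+ 2) <=
    8 * \sum_(i < m) mean P (fun w => h i w ^+ 2) * (c i.+1 - c i)].
Proof.
elim: m => [|m IH] hc cc mh kh bh /=.
  have S0 : (fun w => \sum_(i < 0) h i w * (B (c i.+1) w - B (c i) w)) = cst 0.
    by apply/funext => w; rewrite big_ord0.
  have S02 : (fun w => (\sum_(i < 0) h i w * (B (c i.+1) w - B (c i) w)) ^+ 2) = cst 0.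
    by apply/funext => w; rewrite big_ord0 expr0n.
  rewrite S0 S02 big_ord0 mulr0; split.
  - exact: measurable_cst.
  - exact: integrable_rv_cst.
  - by rewrite mean_cst.
have /= := IH (fun i im => hc i (leqW im)) (fun i im => cc i (leqW im))
  (fun i im => mh i (leqW im)) (fun i im => kh i (leqW im)) (fun i im => bh i (leqW im)).
set S := (fun w => \sum_(i < m) _); move=> [kS iS ES].
have cm : 0 <= c m <= T by exact: hc.
have cm1 : 0 <= c m.+1 <= T by exact: hc.
have /andP[cm0 cmT] := cm; have /andP[_ cm1T] := cm1.
have ccm := cc m (leqnn _).
have mhm := mh m (leqnn _).
have -> : (fun w => \sum_(i < m.+1) h i w * (B (c i.+1) w - B (c i) w)) =
    (fun w => S w + h m w * (B (c m.+1) w - B (c m) w)).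
  by apply/funext => w; rewrite big_ord_recr.
have -> : (fun w => (\sum_(i < m.+1) h i w * (B (c i.+1) w - B (c i) w)) ^+ 2) =
    (fun w => (S w + h m w * (B (c m.+1) w - B (c m) w)) ^+ 2).
  by apply/funext => w; rewrite big_ord_recr.
rewrite big_ord_recr/= mulrDr.
(* A degenerate interval contributes nothing; it is split off because the laws of the increments are
   given for [s < t]. *)
move: ccm; rewrite le_eqVlt => /predU1P[ccm|ccm].
  have SE w : S w + h m w * (B (c m.+1) w - B (c m) w) = S w.
    by rewrite ccm subrr mulr0 addr0.
  rewrite -[X in _ * (X - _)]ccm subrr mulr0 mulr0 addr0.
  under eq_fun do rewrite SE.
  under [X in mean P X]eq_fun do rewrite SE.
  under [X in integrable_rv P X]eq_fun do rewrite SE.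
  by rewrite -ccm.
have khm := kh m (leqnn _) ccm.
have [K hK] := bh m (leqnn _).
have mS := known_at_measurable cm kS.
have ihm2 : integrable_rv P (fun w => h m w ^+ 2).
  apply: (@integrable_rv_bounded _ _ _ P _ (K ^+ 2)); first exact: measurable_funX.
  by move=> w; rewrite normrX lerXn2r ?nnegrE// (le_trans _ (hK w)).
(* Of [S] only the square is known to be integrable, so the product is dominated by the sum of the
   two squares. *)
have iSh : integrable_rv P (fun w => S w * h m w).
  apply: (@integrable_rv_le _ _ _ P _ (fun w => S w ^+ 2 + h m w ^+ 2)).
  - exact: measurable_funM.
  - move=> w; rewrite ler_norml; apply/andP; split.
      by have := sqr_ge0 (S w + h m w); have := sqr_ge0 (S w); have := sqr_ge0 (h m w); nra.
    by have := sqr_ge0 (S w - h m w); have := sqr_ge0 (S w); have := sqr_ge0 (h m w); nra.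
  - exact: integrable_rvD.
have iD := integrable_increment cm0 ccm cm1T.
have iD2 := integrable_increment_sqr cm0 ccm cm1T.
have [iX EX] := mean_knownM cm0 ccm cm1T (g := id) (measurable_funM kS khm) iSh
  (@measurable_id _ _ _) iD.
have mexp : measurable_fun setT (fun x : R => x ^+ 2) by exact: measurable_funX.
have [iY EY] := mean_knownM cm0 ccm cm1T (g := fun x => x ^+ 2)
  (measurable_funX 2 khm) ihm2 mexp iD2.
have SE : (fun w => (S w + h m w * (B (c m.+1) w - B (c m) w)) ^+ 2) =
   (fun w => (S w ^+ 2 + 2 * (S w * h m w * (B (c m.+1) w - B (c m) w))) +
      h m w ^+ 2 * (B (c m.+1) w - B (c m) w) ^+ 2).
  by apply/funext => w; ring.
rewrite SE; have i2 := integrable_rvZ 2 iX; split.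
- apply: measurable_funD; first exact: (known_at_le cm0 (ltW ccm) cm1T kS).
  apply: measurable_funM; first exact: (known_at_le cm0 (ltW ccm) cm1T khm).
  apply: measurable_funB; first exact: known_at_brownian.
  exact: (known_at_le cm0 (ltW ccm) cm1T (known_at_brownian cm)).
- by apply: integrable_rvD => //; exact: integrable_rvD.
- rewrite meanD//; last exact: integrable_rvD.
  rewrite meanD// meanZ//.
  have -> : mean P (fun w => S w * h m w * (B (c m.+1) w - B (c m) w)) = 0.
    by rewrite EX mean_increment// mulr0.
  rewrite mulr0 addr0 lerD// EY mulrCA.
  apply: ler_wpM2l; first by apply: mean_ge0 => w; exact: sqr_ge0.
  exact: mean_increment_sqr_le.
Qed.
End BrownianIncrements.

Section SimpleIntegral.
Context {R : realType} {d : measure_display} {Omega : measurableType d}.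
Variables (P : probability Omega R) (T : R) (F : R -> set (set Omega)).
Hypothesis hF : filtration T F.
Variable B : R -> Omega -> R.
Hypothesis hB : brownian_motion P T F B.
Implicit Types H : simple_integrand T F.

Lemma known_at_coef H i : (i < si_size H)%N ->
  known_at F (si_knot H i) (si_coef H i).
Proof.
move=> iH; apply: (known_at_preimage (T := T)).
  by apply: (@si_knot_range _ _ _ _ _ H); exact: ltnW.
by move=> A mA; exact: si_coef_adapted.
Qed.

Lemma measurable_coef H i : (i < si_size H)%N -> measurable_fun setT (si_coef H i).
Proof.
move=> iH; apply: (known_at_measurable hF _ (known_at_coef iH)).
by apply: (@si_knot_range _ _ _ _ _ H); exact: ltnW.
Qed.

(** Restricting the integral to [a, b] amounts to clamping the knots: the values [B a] produced by
    [clamp_min] cancel between consecutive knots. *)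
Lemma si_integralB H a b w : a <= b ->
  si_integral H B b w - si_integral H B a w =
  \sum_(i < si_size H) si_coef H i w *
    (B (clamp a b (si_knot H i.+1)) w - B (clamp a b (si_knot H i)) w).
Proof.
move=> ab; rewrite /si_integral -sumrB; apply: eq_bigr => i _.
have := clamp_min (B^~ w) (si_knot H i.+1) ab.
have := clamp_min (B^~ w) (si_knot H i) ab.
by rewrite -mulrBr => e1 e2; congr (_ * _); lra.
Qed.

Lemma mean_si_integralB_sqr H a b : 0 <= a -> a <= b -> b <= T ->
  integrable_rv P (fun w => (si_integral H B b w - si_integral H B a w) ^+ 2) /\
  mean P (fun w => (si_integral H B b w - si_integral H B a w) ^+ 2) <=
  8 * \sum_(i < si_size H) mean P (fun w => si_coef H i w ^+ 2) *
    (clamp a b (si_knot H i.+1) - clamp a b (si_knot H i)).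
Proof.
move=> a0 ab bT; under eq_fun do rewrite si_integralB//.
have cT x : 0 <= clamp a b x <= T.
  by have /andP[h1 h2] := clamp_itv x ab; rewrite (le_trans a0)// (le_trans h2).
have [|||||_ iS ES] := @ito_sum_sqr _ _ _ P T F hF B hB (si_size H)
  (fun i => clamp a b (si_knot H i)) (si_coef H).
- by [].
- by move=> i iH; apply: clamp_le; exact: si_knot_mono.
- exact: measurable_coef.
- move=> i iH cl; have /andP[_ c2] := cT (si_knot H i).
  have /andP[k0 _] := si_knot_range (ltnW iH).
  by apply: (known_at_le hF k0 _ c2 (known_at_coef iH)); exact: clamp_lt_ge cl.
- by move=> i iH; exact: si_coef_bounded.
by split.
Qed.

(** The time integral of the squared integrand over its first [m] intervals;
    [integral_si_process_sqr] is the case of all of them. *)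
Definition si_energy H (m : nat) (w : Omega) : R :=
  \sum_(i < m) si_coef H i w ^+ 2 * (si_knot H i.+1 - si_knot H i).

(* The energy up to the right end of the i-th interval is known at its left end,
   so switching the integrand off once this energy exceeds L keeps it adapted. *)
Definition trunc_coef H (L : R) (i : nat) (w : Omega) : R :=
  si_coef H i w * \1_[set w | si_energy H i.+1 w <= L] w.

Lemma known_at_energy H m i : (i < si_size H)%N -> (m <= i.+1)%N ->
  known_at F (si_knot H i) (si_energy H m).
Proof.
move=> iH mi; rewrite /si_energy.
suff h j : (j < m)%N -> known_at F (si_knot H i)
    (fun w => si_coef H j w ^+ 2 * (si_knot H j.+1 - si_knot H j)).
  by apply: measurable_sum => j; exact: h.
move=> jm; have ji : (j <= i)%N by rewrite -ltnS (leq_trans jm).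
have kji : si_knot H j <= si_knot H i.
  elim: {+}i ji iH => [|k IH]; first by rewrite leqn0 => /eqP ->.
  rewrite leq_eqVlt => /predU1P[->//|jk] kH.
  by apply: le_trans (IH jk (ltnW kH)) _; exact: si_knot_mono (ltnW kH).
have jH := leq_ltn_trans ji iH.
have /andP[k0 _] := si_knot_range (ltnW jH).
have /andP[_ kT] := si_knot_range (ltnW iH).
have kc := known_at_le hF k0 kji kT (known_at_coef jH).
by apply: measurable_funM; [exact: measurable_funX|exact: measurable_cst].
Qed.

Lemma trunc_coef_adapted H L i : (i < si_size H)%N ->
  forall A, measurable A -> F (si_knot H i) (trunc_coef H L i @^-1` A).
Proof.
move=> iH A mA; rewrite -(sigma_filtration hF (si_knot_range (ltnW iH))).
apply: (measurable_rv_preimage _ mA); apply: measurable_funM.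
  exact: known_at_coef.
apply: measurable_indic.
rewrite -[X in measurable X]setTI.
by apply: (measurable_fun_ler (known_at_energy iH (leqnn _)) (measurable_cst L)).
Qed.

Lemma trunc_coef_bounded H L i : (i < si_size H)%N ->
  exists K : R, forall w, `|trunc_coef H L i w| <= K.
Proof.
move=> iH; have [K hK] := si_coef_bounded iH; exists K => w.
rewrite normrM (le_trans _ (hK w))// ler_piMr// indicE normr_nat.
by rewrite lern1 leq_b1.
Qed.

Definition si_trunc H L : simple_integrand T F :=
  @SimpleIntegrand _ _ _ T F (si_size H) (si_knot H) (trunc_coef H L)
    (@si_knot_range _ _ _ _ _ H) (@si_knot_mono _ _ _ _ _ H)
    (@trunc_coef_adapted H L) (@trunc_coef_bounded H L).

Lemma si_energy_le H m w : (m <= si_size H)%N -> si_energy H m w <= si_energy H (si_size H) w.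
Proof.
move=> mH; rewrite /si_energy -(subnKC mH).
rewrite big_split_ord/= lerDl sumr_ge0// => i _.
rewrite mulr_ge0 ?sqr_ge0// subr_ge0 si_knot_mono//.
by rewrite -ltn_subRL.
Qed.

Lemma si_trunc_id H L w t : si_energy H (si_size H) w <= L ->
  si_integral (si_trunc H L) B t w = si_integral H B t w.
Proof.
move=> HL; apply: eq_bigr => i _ /=; congr (_ * _).
rewrite /trunc_coef indicE mem_set ?mulr1//=.
by apply: le_trans HL; apply: si_energy_le; exact: ltn_ord.
Qed.

Lemma si_trunc_energy H L w : 0 <= L ->
  si_energy (si_trunc H L) (si_size H) w <= L.
Proof.
(* Two bounds are carried along. If the next coefficient is kept, the full energy including it is at
   most [L] and dominates the truncated one; if it is dropped, nothing is added. *)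
move=> L0; suff h m : (m <= si_size H)%N ->
    si_energy (si_trunc H L) m w <= si_energy H m w /\
    si_energy (si_trunc H L) m w <= L.
  by have [] := h _ (leqnn _).
elim: m => [_|m IH mH]; first by rewrite /si_energy !big_ord0.
have [IH1 IH2] := IH (ltnW mH).
have dk : 0 <= si_knot H m.+1 - si_knot H m by rewrite subr_ge0 si_knot_mono.
have eE : si_energy H m.+1 w =
    si_energy H m w + si_coef H m w ^+ 2 * (si_knot H m.+1 - si_knot H m).
  by rewrite {1}/si_energy big_ord_recr.
have q0 : 0 <= si_coef H m w ^+ 2 * (si_knot H m.+1 - si_knot H m).
  by rewrite mulr_ge0 ?sqr_ge0.
have -> : si_energy (si_trunc H L) m.+1 w = si_energy (si_trunc H L) m w +
    trunc_coef H L m w ^+ 2 * (si_knot H m.+1 - si_knot H m).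
  by rewrite {1}/si_energy big_ord_recr.
rewrite /trunc_coef indicE; have [hL|hL] := boolP (w \in _); last first.
  by rewrite mulr0 expr0n mul0r addr0; split=> //; lra.
by move: hL => /set_mem/=; rewrite mulr1; split; lra.
Qed.

End SimpleIntegral.

(** * Counting pairs of grid points *)

Section Grid.
Context {R : realType}.
Variables (T : R) (n : nat) (t : nat -> R) (xi : R).
Hypotheses (n1 : (1 <= n)%N) (tG : grid T n t).

Lemma grid_lt i j : (i < j)%N -> (j <= n)%N -> t i < t j.
Proof.
case: tG => _ _ tlt; elim: j => // j IH; rewrite ltnS leq_eqVlt => /predU1P[->|ij] jn.
  exact: tlt.
by apply: lt_trans (IH ij (ltnW jn)) _; exact: tlt.
Qed.

Lemma grid_le i j : (i <= j)%N -> (j <= n)%N -> t i <= t j.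
Proof. by rewrite leq_eqVlt => /predU1P[->//|ij] jn; apply: ltW; exact: grid_lt. Qed.

Lemma grid_itv i : (i <= n)%N -> 0 <= t i <= T.
Proof.
by move=> i_n; case: tG => <- <- _; rewrite !grid_le.
Qed.

Let leq_big_maxn (I : eqType) (s : seq I) (f : I -> nat) x i :
  i \in s -> (f i <= \big[maxn/x]_(j <- s) f j)%N.
Proof.
elim: s => // a s IH; rewrite inE big_cons leq_max => /predU1P[->|/IH ->].
  by rewrite leqnn.
by rewrite orbT.
Qed.

Let leq_big_minn (I : eqType) (s : seq I) (f : I -> nat) x i :
  i \in s -> (\big[minn/x]_(j <- s) f j <= f i)%N.
Proof.
elim: s => // a s IH; rewrite inE big_cons geq_min => /predU1P[->|/IH ->].
  by rewrite leqnn.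
by rewrite orbT.
Qed.

Lemma N_le_max j : (1 <= j <= n)%N -> (N_ n t xi j <= N_max n t xi)%N.
Proof. by move=> jn; apply: leq_big_maxn; rewrite mem_index_iota. Qed.

Lemma N_min_le j : (1 <= j <= n)%N -> (N_min n t xi <= N_ n t xi j)%N.
Proof. by move=> jn; apply: leq_big_minn; rewrite mem_index_iota. Qed.

Lemma N_total_ge : (n * N_min n t xi <= N_total n t xi)%N.
Proof.
rewrite /N_total big_ord_recl/= (leq_trans _ (leq_addl _ _))//.
rewrite -[n in (n * _)%N]card_ord -sum_nat_const; apply: leq_sum => i _.
by apply: N_min_le; rewrite /bump/= add1n ltn_ord.
Qed.

(** A neighbour of t_0 with index above 1 lies to the right of t_1, hence even closer to t_1. The
    extra unit counts the index 1 itself. *)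
Lemma N0_le : (N_ n t xi 0 <= (N_ n t xi 1).+1)%N.
Proof.
have o1 : (1 < n.+1)%N by [].
rewrite /N_ (cardsD1 (Ordinal o1) (S_ n t xi 0)) -[(#|S_ n t xi 1|).+1]addn1 addnC; apply: leq_add.
  apply: subset_leq_card; apply/fintype.subsetP => l.
  rewrite !inE => /andP[l1 /andP[lxi l0]].
  have l1' : (1 < l)%N.
    by move: l1 l0; rewrite -val_eqE/=; lia.
  have ln : (l <= n)%N by rewrite -ltnS ltn_ord.
  rewrite gt_eqF// andbT.
  have g1 : t 1 <= t l by apply: grid_le => //; exact: ltnW.
  have g0 : t 0 <= t 1 by exact: grid_le.
  by move: lxi; rewrite !ler_norml; lra.
by case: (_ \in _).
Qed.

(* N_max leaves out the index 0, whose neighbours are essentially those of 1. *)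
Lemma N_le_max3 j : (j <= n)%N -> (0 < N_max n t xi)%N ->
  ((N_ n t xi j).+1 <= 3 * N_max n t xi)%N.
Proof.
have h1 : (N_ n t xi 1 <= N_max n t xi)%N by apply: N_le_max.
case: j => [_|j jn] m0.
  have := N0_le; lia.
have : (N_ n t xi j.+1 <= N_max n t xi)%N by exact: N_le_max.
lia.
Qed.

Definition pair_clamp (j l : nat) (x : R) := clamp (t (minn j l)) (t (maxn j l)) x.

(** Both sides measure the part of [t_j, t_l] to the left of [x], the right one cell by cell. *)
Lemma clamp_telescope j l x : (j <= l)%N -> (l <= n)%N ->
  clamp (t j) (t l) x - t j =
  \sum_(i < n | (j <= i < l)%N) (clamp (t i) (t i.+1) x - t i).
Proof.
elim: l => [|l IH].
  rewrite leqn0 => /eqP -> _; rewrite big1 => [|i].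
    by rewrite /clamp; apply/eqP; rewrite subr_eq0 min_r// le_max lexx orbT.
  by rewrite ltn0 andbF.
rewrite leq_eqVlt => /predU1P[-> ln|jl ln].
  rewrite big1 => [|i].
    by rewrite /clamp; apply/eqP; rewrite subr_eq0 min_r// le_max lexx orbT.
  by move=> /andP[h1 h2]; exfalso; lia.
rewrite (bigD1 (Ordinal ln))/=; last by rewrite ltnSn andbT -ltnS.
rewrite (eq_bigl (fun i : 'I_n => (j <= i < l)%N)); last first.
  move=> i; rewrite -val_eqE/= ltnS [(i <= l)%N]leq_eqVlt.
  by case: ltngtP; rewrite ?andbT ?andbF//.
rewrite -IH//; last exact: ltnW.
have tjl : t j <= t l by apply: grid_le => //; exact: ltnW.
have tll : t l <= t l.+1 by apply: grid_le.
by rewrite /clamp/Num.min /Num.max; do ![case: ifPn]; rewrite -?leNgt; lra.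
Qed.

Lemma pair_clampB j l x y : (j <= n)%N -> (l <= n)%N ->
  pair_clamp j l y - pair_clamp j l x =
  \sum_(i < n | (minn j l <= i < maxn j l)%N)
    (clamp (t i) (t i.+1) y - clamp (t i) (t i.+1) x).
Proof.
move=> jn ln.
have h1 : (minn j l <= maxn j l)%N by rewrite geq_min !leq_max leqnn.
have h2 : (maxn j l <= n)%N by rewrite geq_max jn.
have e1 := clamp_telescope y h1 h2; have e2 := clamp_telescope x h1 h2.
rewrite (eq_bigr (fun i : 'I_n => (clamp (t i) (t i.+1) y - t i) - (clamp (t i) (t i.+1) x - t i))).
  by rewrite sumrB -e1 -e2 /pair_clamp; lra.
by move=> i _; lra.
Qed.

(* Both ends of a straddling pair are within xi of t_i. *)
Lemma card_straddling (M : nat) (i : 'I_n) :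
  (forall j, (j <= n)%N -> ((N_ n t xi j).+1 <= M)%N) ->
  (\sum_(j < n.+1) \sum_(l in S_ n t xi j) (minn j l <= i < maxn j l) <= M ^ 2)%N.
Proof.
move=> NM; have i1 : (i < n.+1)%N by rewrite ltnW// ltnS ltn_ord.
pose A : {set 'I_n.+1} := finset (fun j : 'I_n.+1 => `|t j - t i| <= xi).
have cA : (#|A| <= M)%N.
  apply: leq_trans (NM i (ltnW (ltn_ord i))).
  rewrite (cardsD1 (Ordinal i1)) /N_ -[(#|S_ n t xi i|).+1]addn1 addnC.
  apply: leq_add; last by case: (_ \in _).
  apply: subset_leq_card; apply/fintype.subsetP => l.
  by rewrite !inE -val_eqE/= => /andP[li ->].
apply: (@leq_trans (\sum_(j < n.+1) \sum_(l < n.+1) (j \in A) * (l \in A))%N).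
  apply: leq_sum => j _; rewrite big_mkcond/=; apply: leq_sum => l _.
  case: ifP => //; rewrite inE => /andP[jl _].
  case: (boolP (minn _ _ <= _ < _)%N) => // /andP[h1 h2].
  have jn : (j <= n)%N by rewrite -ltnS ltn_ord.
  have ln : (l <= n)%N by rewrite -ltnS ltn_ord.
  have i_n : (i <= n)%N by rewrite ltnW.
  suff : (j \in A) && (l \in A) by move=> /andP[-> ->].
  rewrite !inE; move: h1 h2; rewrite geq_min leq_max => /orP[h1|h1] /orP[h2|h2];
    try (by move: (leq_ltn_trans h1 h2); rewrite ltnn);
    have g1 := grid_le h1 i_n; have g2 := grid_le (ltnW h2) ltac:(by []).
  by move: jl; rewrite !ler_norml; lra.
  by move: jl; rewrite !ler_norml; lra.
have sA : (\sum_(j < n.+1) (j \in A) = #|A|)%N.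
  by rewrite -sum1_card [RHS]big_mkcond/=; apply: eq_bigr => l _; case: (_ \in _).
rewrite (eq_bigr (fun j : 'I_n.+1 => (j \in A) * #|A|)%N) => [|j _]; last first.
  by rewrite -big_distrr/= sA.
by rewrite -big_distrl/= sA expnS expn1 leq_mul.
Qed.

(* pair_clamp j l y - pair_clamp j l x is the length of the part of [x, y] between
   t_j and t_l. *)
Lemma sum_pair_clampB_le (M : nat) x y : 0 <= x -> x <= y -> y <= T ->
  (forall j, (j <= n)%N -> ((N_ n t xi j).+1 <= M)%N) ->
  \sum_(j < n.+1) \sum_(l in S_ n t xi j) (pair_clamp j l y - pair_clamp j l x)
  <= (M ^ 2)%:R * (y - x).
Proof.
move=> x0 xy yT NM.
pose dl (i : 'I_n) := clamp (t i) (t i.+1) y - clamp (t i) (t i.+1) x.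
have dl0 i : 0 <= dl i by rewrite subr_ge0; exact: clamp_le.
(* Double counting: the overlaps are cut along the grid cells, and each cell is then weighted by the
   number of pairs that straddle it. *)
have -> : \sum_(j < n.+1) \sum_(l in S_ n t xi j) (pair_clamp j l y - pair_clamp j l x) =
    \sum_(i < n) (\sum_(j < n.+1) \sum_(l in S_ n t xi j) (minn j l <= i < maxn j l))%N%:R * dl i.
  under [RHS]eq_bigr do rewrite natr_sum mulr_suml.
  rewrite exchange_big/=; apply: eq_bigr => j _.
  under [RHS]eq_bigr do rewrite natr_sum mulr_suml.
  rewrite exchange_big/=; apply: eq_bigr => l _.
  rewrite pair_clampB -1?ltnS ?ltn_ord// big_mkcond/=; apply: eq_bigr => i _.
  by case: ifP; rewrite ?mul1r ?mul0r.
(* The pair (0, n) spans [0, T], where clamping changes neither [x] nor [y]. *)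
have -> : y - x = \sum_(i < n) dl i.
  have [t0 tn _] := tG.
  have := @pair_clampB 0 n x y (leq0n _) (leqnn _).
  rewrite /pair_clamp min0n max0n t0 tn /clamp !max_l// ?(le_trans x0)// !min_l// ?(le_trans xy)//.
  by move=> ->; apply: eq_bigl => i; rewrite leq0n ltn_ord.
rewrite mulr_sumr; apply: ler_sum => i _; apply: ler_wpM2r => //.
by rewrite ler_nat; exact: card_straddling.
Qed.

End Grid.

Section GridAsymptotics.
Context {R : realType}.
Variables (t : nat -> nat -> R) (xi : nat -> R).
Hypothesis hN_max_min : asymp (fun n => (N_max n (t n) (xi n))%:R : R)
                      (fun n => (N_min n (t n) (xi n))%:R : R).
Hypothesis hN_min_nxi : asymp (fun n => (N_min n (t n) (xi n))%:R : R)
                      (fun n => n%:R * xi n).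
Hypothesis hxi_pos : forall n, (1 <= n)%N -> 0 < xi n.

(** With N the total count, n N_min <= N, N_max <= c2 N_min and N_min <= e2 n xi give N_max / N <=
    c2 / n and N_max^2 / N <= c2^2 e2 xi. The sum of the two constants serves both bounds. *)
Lemma N_asymp : exists2 C : R, 0 < C & forall n, (1 <= n)%N ->
  [/\ (0 < N_max n (t n) (xi n))%N, (0 < N_total n (t n) (xi n))%N,
      (N_max n (t n) (xi n))%:R / (N_total n (t n) (xi n))%:R <= C / n%:R &
      (N_max n (t n) (xi n) ^ 2)%:R / (N_total n (t n) (xi n))%:R <= C * xi n].
Proof.
have [c1 [c2 [c10 c20 hc]]] := hN_max_min; have [e1 [e2 [e10 e20 he]]] := hN_min_nxi.
have C0 : 0 < c2 + c2 ^+ 2 * e2 by rewrite addr_gt0// mulr_gt0// exprn_gt0.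
exists (c2 + c2 ^+ 2 * e2) => // n n1.
have /andP[h1 h2] := hc _ n1; have /andP[h3 h4] := he _ n1.
have x0 := hxi_pos n1.
have n0 : 0 < n%:R :> R by rewrite ltr0n.
move: h1 h2 h3 h4; set A := N_max _ _ _; set a := N_min _ _ _; set S := N_total _ _ _.
move=> h1 h2 h3 h4.
(* A vanishing count would make the quotient 0, division by 0 being 0, against the positive lower
   bound [c1]. *)
have aA : (0 < a)%N && (0 < A)%N.
  move: (lt_le_trans c10 h1); case: (a) => [|b]; first by rewrite invr0 mulr0 ltxx.
  by case: (A) => [|//]; rewrite mul0r ltxx.
have /andP[a0 A0] := aA.
have aR0 : 0 < a%:R :> R by rewrite ltr0n.
have AR0 : 0 < A%:R :> R by rewrite ltr0n.
have Sge : n%:R * a%:R <= S%:R :> R by rewrite -natrM ler_nat; exact: N_total_ge.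
have S0 : 0 < S%:R :> R by apply: lt_le_trans Sge; exact: mulr_gt0.
have Aa : A%:R <= c2 * a%:R by rewrite -ler_pdivrMr.
have ax : a%:R <= e2 * (n%:R * xi n) by rewrite -ler_pdivrMr// mulr_gt0.
split=> //; first by rewrite -(ltr0n R).
  rewrite ler_pdivrMr// mulrAC ler_pdivlMr//.
  apply: (@le_trans _ _ (c2 * S%:R)); last first.
    apply: ler_wpM2r; first exact: ltW.
    by rewrite lerDl mulr_ge0 ?sqr_ge0// ltW.
  apply: (@le_trans _ _ (c2 * a%:R * n%:R)); first by rewrite ler_wpM2r// ltW.
  by rewrite -mulrA; apply: ler_wpM2l; [exact: ltW|rewrite mulrC].
rewrite natrX ler_pdivrMr//.
apply: (@le_trans _ _ (c2 ^+ 2 * e2 * xi n * S%:R)); last first.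
  apply: ler_wpM2r; first exact: ltW.
  apply: ler_wpM2r; first exact: ltW.
  by rewrite lerDr ltW.
apply: (@le_trans _ _ ((c2 * a%:R) ^+ 2)).
  by rewrite lerXn2r// nnegrE ltW// (lt_le_trans AR0).
apply: (@le_trans _ _ (c2 ^+ 2 * e2 * xi n * (n%:R * a%:R))); last first.
  by rewrite ler_wpM2l// ltW// !mulr_gt0// exprn_gt0.
have -> : (c2 * a%:R) ^+ 2 = c2 ^+ 2 * a%:R * a%:R by ring.
have -> : c2 ^+ 2 * e2 * xi n * (n%:R * a%:R) =
    c2 ^+ 2 * a%:R * (e2 * (n%:R * xi n)) by ring.
by apply: ler_wpM2l => //; rewrite mulr_ge0 ?sqr_ge0// ltW.
Qed.

End GridAsymptotics.

(** * Increments of Ito processes *)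

Section CadlagMeasurable.
Context {R : realType} {d : measure_display} {Omega : measurableType d}.
Variables (T : R) (Z : R -> Omega -> R).
Hypotheses (T0 : 0 <= T) (cZ : forall w, cadlag T (fun t => Z t w)).
Hypothesis mZ : forall t, 0 <= t <= T -> measurable_fun setT (Z t).

(** The right end of cell [k], capped at [T]. Sampling to the right makes right-continuity enough
    for convergence; the cap keeps the time where [Z] is measurable. *)
Let ceil_grid (n k : nat) : R := Num.min T (k.+1%:R / n.+1%:R).

Let ceil_gridT n k : 0 <= ceil_grid n k <= T.
Proof. by rewrite /ceil_grid le_min T0/= divr_ge0// ge_min lexx. Qed.

Let approx (n : nat) (z : R * Omega) : R :=
  \sum_(k < (Num.truncn (T * n.+1%:R)).+1)
    \1_(`[k%:R / n.+1%:R, k.+1%:R / n.+1%:R[ : set R) z.1 * Z (ceil_grid n k) z.2.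

Let approxE n s w : 0 <= s <= T ->
  approx n (s, w) = Z (ceil_grid n (Num.truncn (s * n.+1%:R))) w.
Proof.
move=> /andP[s0 sT]; rewrite /approx /=.
have n0 : 0 < n.+1%:R :> R by rewrite ltr0n.
have /andP[k1 k2] : (Num.truncn (s * n.+1%:R))%:R <= s * n.+1%:R < (Num.truncn (s * n.+1%:R)).+1%:R.
  by apply: truncn_itv; rewrite mulr_ge0.
set k0 := Num.truncn _ in k1 k2 *.
have kT : (k0 < (Num.truncn (T * n.+1%:R)).+1)%N.
  rewrite -(ltr_nat R); apply: (le_lt_trans k1).
  apply: le_lt_trans (truncnS_gt _); exact: ler_wpM2r.
rewrite (bigD1 (Ordinal kT))//= big1 ?addr0.
  by rewrite indicE mem_set ?mul1r//= in_itv/= ler_pdivrMr// k1 ltr_pdivlMr.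
move=> k kk0; rewrite indicE memNset ?mul0r//= in_itv/= ler_pdivrMr// ltr_pdivlMr//.
move=> /andP[h1 h2]; move/negP: kk0; apply; rewrite -val_eqE/= eqn_leq.
apply/andP; split; rewrite -ltnS -(ltr_nat R).
  exact: le_lt_trans h1 k2.
exact: le_lt_trans k1 h2.
Qed.

Let measurable_approx n : measurable_fun setT (approx n).
Proof.
apply: measurable_sum => k; apply: measurable_funM.
  by apply: measurableT_comp => //; exact: measurable_indic.
by apply: measurableT_comp => //; exact: mZ.
Qed.

Lemma cadlag_measurable : measurable_fun (`[0, T] `*` setT) (fun z : R * Omega => Z z.1 z.2).
Proof.
apply: (@measurable_fun_cvg _ _ _ _ (fun n => approx n)) => [n|[s w] [/= sT _]].
  exact: measurable_funTS.
have sT' : 0 <= s <= T by rewrite in_itv/= in sT.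
under eq_fun do rewrite approxE//.
(* At [s = T] there is no time to the right, but the cap makes every approximation equal to the
   value at [T]. *)
have /andP[s0 + ] := sT'; rewrite le_eqVlt => /predU1P[sE|slt].
  apply: (@cvg_trans _ ((fun=> Z s w) @ \oo)); last exact: cvg_cst.
  apply: near_eq_cvg; near=> n; congr (Z _ w).
  rewrite /ceil_grid -sE min_l// ler_pdivlMr ?ltr0n//.
  by apply/ltW/truncnS_gt.
have [cZr _] := cZ w; have := cZr s; rewrite s0 slt => /(_ isT) /cvg_at_rightP.
apply; split.
  move=> n; rewrite /ceil_grid lt_min slt/= ltr_pdivlMr ?ltr0n//.
  exact: truncnS_gt.
apply: (@squeeze_cvgr _ _ _ _ (fun=> s) (fun n => s + n.+1%:R^-1)).
- near=> n; rewrite /ceil_grid; apply/andP; split.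
    rewrite le_min (ltW slt)/= ler_pdivlMr ?ltr0n//.
    by apply/ltW/truncnS_gt.
  rewrite ge_min; apply/orP; right.
  rewrite ler_pdivrMr ?ltr0n// mulrDl mulVf// -natr1 lerD2r truncn_le.
  by rewrite mulr_ge0.
- exact: cvg_cst.
- rewrite -[X in _ --> X]addr0; apply: cvgD; first exact: cvg_cst.
  exact: cvg_harmonic.
Unshelve. all: by end_near. Qed.

End CadlagMeasurable.

Lemma lebesgue_measure_oc {R : realType} (a b : R) : a <= b ->
  (@lebesgue_measure R : {measure set (measurableTypeR R) -> \bar R})
    (`]a, b]%classic : set R) = (b - a)%:E.
Proof.
move=> ab; apply: (etrans (lebesgue_measure_itv _)); rewrite /= lte_fin.
case: ltP => // ba; have -> : b = a by apply/eqP; rewrite eq_le ab ba.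
by rewrite subrr.
Qed.

Section SimpleEnergy.
Context {R : realType} {d : measure_display} {Omega : measurableType d}.
Variables (T : R) (F : R -> set (set Omega)).
Hypothesis hF : filtration T F.
Variable H : simple_integrand T F.

Lemma si_knot_le i j : (i <= j)%N -> (j <= si_size H)%N -> si_knot H i <= si_knot H j.
Proof.
elim: j => [|j IH]; first by rewrite leqn0 => /eqP ->.
rewrite leq_eqVlt => /predU1P[->//|ij] jH.
by apply: le_trans (IH ij (ltnW jH)) _; exact: si_knot_mono.
Qed.

(** The intervals of the integrand are disjoint, so at most one term is nonzero and squaring acts
    term by term. *)
Lemma si_process_sqr s w : si_process H s w ^+ 2 =
  \sum_(i < si_size H) si_coef H i w ^+ 2 *
     \1_(`]si_knot H i, si_knot H i.+1] : set R) s.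
Proof.
rewrite /si_process.
have [/existsP[i0 hi0]|] :=
  boolP [exists i : 'I_(si_size H), s \in `]si_knot H i, si_knot H i.+1] ].
  have h i : i != i0 -> \1_(`]si_knot H i, si_knot H i.+1] : set R) s = 0 :> R.
    move=> ii0; rewrite indicE memNset//= in_itv/= => /andP[h1 h2].
    move: hi0; rewrite in_itv/= => /andP[h3 h4].
    move: ii0; rewrite -val_eqE neq_ltn/= => /orP[ii0|ii0].
      have := si_knot_le ii0 (ltnW (ltn_ord i0)); lra.
    have := si_knot_le ii0 (ltnW (ltn_ord i)); lra.
  rewrite (bigD1 i0)//= [RHS](bigD1 i0)//= !big1 => [||i /h ->]; rewrite ?mulr0//.
    by rewrite !addr0 exprMn indicE mem_set ?expr1n.
  by move=> i /h ->; rewrite mulr0.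
rewrite negb_exists => /forallP h.
rewrite !big1 ?expr0n// => i _; rewrite indicE memNset ?mulr0//=; exact/negP/h.
Qed.

Lemma integral_si_process_sqr w :
  (\int[lebesgue_measure]_(s in `[0%R, T]) ((si_process H s w) ^+ 2)%:E =
   (si_energy H (si_size H) w)%:E)%E.
Proof.
under eq_integral do rewrite si_process_sqr -sumEFin.
rewrite ge0_integral_sum//; last 2 first.
- move=> i; apply/measurable_EFinP; apply: measurable_funM => //.
- by move=> i s _; rewrite lee_fin mulr_ge0 ?sqr_ge0.
rewrite /si_energy -sumEFin; apply: eq_bigr => i _.
under eq_integral do rewrite EFinM.
rewrite ge0_integralZl//; last 2 first.
- by apply/measurable_EFinP; apply: measurable_indic.
- by rewrite lee_fin sqr_ge0.
rewrite integral_indic// setIidl.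
  by rewrite lebesgue_measure_oc ?EFinM// si_knot_mono.
move=> s/=; rewrite !in_itv/= => /andP[s1 s2].
have /andP[k0 _] := si_knot_range (ltnW (ltn_ord i)).
have /andP[_ kT] := si_knot_range (ltn_ord i).
by rewrite (le_trans k0 (ltW s1)) (le_trans s2).
Qed.

Lemma measurable_si_process :
  measurable_fun setT (fun z : R * Omega => si_process H z.1 z.2).
Proof.
apply: measurable_sum => i; apply: measurable_funM.
  by apply: measurableT_comp => //; exact: measurable_coef.
by apply: measurableT_comp => //; exact: measurable_indic.
Qed.

Variable sigma : R -> Omega -> R.
Hypothesis msigma : measurable_fun (`[0, T] `*` setT) (fun z : R * Omega => sigma z.1 z.2).

Let mdiff : measurable_fun (`[0, T] `*` setT)
  (fun z : R * Omega => (si_process H z.1 z.2 - sigma z.1 z.2) ^+ 2).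
Proof.
apply: measurable_funX; apply: measurable_funB => //.
by apply: measurable_funTS; exact: measurable_si_process.
Qed.

(** Makes the set of badly approximated paths an event. It is Tonelli for the square extended by 0
    outside [0, T]. *)
Lemma measurable_integral_diff_sqr : measurable_fun setT (fun w =>
  \int[lebesgue_measure]_(s in `[0%R, T]) ((si_process H s w - sigma s w) ^+ 2)%:E)%E.
Proof.
pose f : measurableTypeR R * Omega -> \bar R :=
  (fun z => ((si_process H z.1 z.2 - sigma z.1 z.2) ^+ 2)%:E) \_ (`[0, T] `*` setT).
have mf : measurable_fun setT f.
  apply/(measurable_restrictT _ _).1; first exact: measurableX.
  apply/measurable_EFinP.
  exact: mdiff.
have f0 z : (0 <= f z)%E.
  by rewrite /f patchE; case: ifP => // _; rewrite lee_fin sqr_ge0.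
have : measurable_fun setT (fubini_G lebesgue_measure f).
  exact: measurable_fun_fubini_tonelli_G.
apply: eq_measurable_fun => w _; rewrite /fubini_G [RHS]integral_mkcond.
by apply: eq_integral => s _; rewrite /f !patchE/= in_setX in_setT andbT.
Qed.

Lemma measurable_path w : measurable_fun `[0, T] (fun s => sigma s w).
Proof.
have mi : measurable (`[0, T] `*` setT : set (R * Omega)) by exact: measurableX.
apply: (@measurable_comp _ _ _ _ _ _ (`[0, T] `*` setT) (fun z : R * Omega => sigma z.1 z.2)
  _ (fun s : R => (s, w))) => //.
  by move=> _ [s/= sT <-].
by apply: measurable_funTS; apply: measurable_fun_pair.
Qed.

(** Integrates h^2 <= 2 (h - sigma)^2 + 2 sigma^2, which amounts to (h - 2 sigma)^2 >= 0. *)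
Lemma si_energy_bound w (A D : R) :
  (forall s, 0 < s <= T -> `|sigma s w| <= A) ->
  (\int[lebesgue_measure]_(s in `[0%R, T]) ((si_process H s w - sigma s w) ^+ 2)%:E <= D%:E)%E ->
  0 <= T -> si_energy H (si_size H) w <= 2 * D + 2 * (A ^+ 2 * T).
Proof.
move=> hA hD T0; rewrite -lee_fin -integral_si_process_sqr.
have mp : measurable_fun `[0, T] (fun s => si_process H s w).
  apply: measurable_funTS.
  apply: measurable_sum => i; apply: measurable_funM => //; exact: measurable_indic.
have mps : measurable_fun `[0, T] (fun s => (si_process H s w - sigma s w) ^+ 2).
  by apply: measurable_funX; apply: measurable_funB => //; exact: measurable_path.
have sub : `]0, T] `<=` `[0, T].
  by move=> s /=; rewrite !in_itv/= => /andP[/ltW -> ->].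
have mo : measurable (`]0, T] : set R) by [].
(* The bound on [sigma] holds for positive times, as in [locally_bounded], so the endpoint 0 is
   removed from the integrals. *)
have toO (g : R -> R) : measurable_fun `[0, T] g ->
    (\int[lebesgue_measure]_(s in `[0%R, T]) (g s)%:E =
     \int[lebesgue_measure]_(s in `]0%R, T]) (g s)%:E)%E.
  move=> mg; apply/esym; apply: integral_itv_obnd_cbnd.
  by apply/measurable_EFinP; exact: measurable_funS mg.
rewrite toO; last exact: measurable_funX.
rewrite (le_trans (_ : _ <= \int[lebesgue_measure]_(s in `]0%R, T])
    ((2%:E * ((si_process H s w - sigma s w) ^+ 2)%:E) + (2 * A ^+ 2)%:E))%E)//.
  apply: ge0_le_integral => //.
  - by move=> s _; rewrite lee_fin sqr_ge0.
  - by apply/measurable_EFinP; apply: measurable_funX; exact: measurable_funS mp.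
  - apply: emeasurable_funD => //; apply: measurable_funeM.
    by apply/measurable_EFinP; exact: measurable_funS mps.
  - move=> s /=; rewrite in_itv/= => sT; rewrite -EFinM -EFinD lee_fin.
    have := hA _ sT; rewrite ler_norml => /andP[h1 h2].
    have : sigma s w ^+ 2 <= A ^+ 2 by nra.
    have := sqr_ge0 (si_process H s w - 2 * sigma s w); nra.
rewrite ge0_integralD//; last 3 first.
- by move=> s _; rewrite mule_ge0// lee_fin sqr_ge0.
- apply: measurable_funeM.
  by apply/measurable_EFinP; exact: measurable_funS mps.
- by move=> s _; rewrite lee_fin mulr_ge0 ?sqr_ge0.
rewrite ge0_integralZl//; last 2 first.
- by apply/measurable_EFinP; exact: measurable_funS mps.
- by move=> s _; rewrite lee_fin sqr_ge0.
rewrite -toO// integral_cst// EFinD lebesgue_measure_oc// subr0 -EFinM mulrA.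
rewrite [leRHS]EFinD; apply: leeD => //; rewrite [leRHS]EFinM.
by apply: lee_wpmul2l => //; rewrite lee_fin.
Qed.

End SimpleEnergy.

(** * Bounds outside events of small probability *)

Section SmallEvents.
Context {R : realType} {d : measure_display} {Omega : measurableType d}.
Variable P : probability Omega R.

(** Continuity from above. A bound that almost every path satisfies from some path-dependent [m] on
    thereby holds for one fixed [m] with probability close to 1. *)
Lemma decreasing_events_small (E : nat -> set Omega) :
  (forall m, measurable (E m)) -> (forall m, E m.+1 `<=` E m) ->
  {ae P, forall w, exists m, ~ E m w} ->
  forall eps : R, 0 < eps -> exists m, (P (E m) <= eps%:E)%E.
Proof.
move=> mE dE [N [mN PN hN]] eps eps0.
have niE : nonincreasing_seq E.
  by apply/nonincreasing_seqP => m; apply/subsetPset; exact: dE.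
have mcap : measurable (\bigcap_m E m) by exact: bigcap_measurableType.
have : P (E m) @[m --> \oo] --> P (\bigcap_m E m).
  apply: nonincreasing_cvg_mu => //.
  by rewrite (le_lt_trans (probability_le1 P (mE 0%N)))// ltry.
have -> : P (\bigcap_m E m) = 0%E.
  apply/eqP; rewrite eq_le measure_ge0 andbT -PN; apply: le_measure; rewrite ?inE//.
  by move=> w wE; apply: hN => /= -[m]; apply; exact: wE.
move=> /fine_cvgP[_] /cvgrPdist_le /(_ _ eps0) [m _ /(_ m (leqnn m))].
move=> h; exists m; move: h; rewrite sub0r normrN ger0_norm ?fine_ge0//=.
by rewrite -lee_fin fineK// fin_num_measure.
Qed.

Lemma ae_null_set (Q : Omega -> Prop) : {ae P, forall w, Q w} ->
  exists N, [/\ measurable N, P N = 0%E & forall w, ~ N w -> Q w].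
Proof.
move=> [N [mN PN hN]]; exists N; split => // w Nw.
by apply: contrapT => Qw; apply: Nw; exact: hN.
Qed.

Lemma prob_le_setU (A B C : set Omega) (a b : R) :
  measurable A -> measurable B -> measurable C -> A `<=` B `|` C ->
  (P B <= a%:E)%E -> (P C <= b%:E)%E -> (P A <= (a + b)%:E)%E.
Proof.
move=> mA mB mC ABC Pa Pb; apply: (@le_trans _ _ (P B + P C)%E).
  apply: (@le_trans _ _ (P (B `|` C))); last exact: measureU2.
  by apply: le_measure; rewrite ?inE//; exact: measurableU.
by rewrite EFinD leeD.
Qed.

Lemma prob_bigsetU_le m (E : nat -> set Omega) (c : R) :
  (forall j, (j < m)%N -> measurable (E j)) ->
  (forall j, (j < m)%N -> (P (E j) <= c%:E)%E) ->
  measurable (\big[setU/set0]_(j < m) E j) /\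
  (P (\big[setU/set0]_(j < m) E j) <= (m%:R * c)%:E)%E.
Proof.
move=> mE PE; have mU k : (k <= m)%N -> measurable (\big[setU/set0]_(j < k) E j).
  move=> km; apply: bigsetU_measurable => j _; apply: mE.
  exact: leq_trans (ltn_ord j) km.
split; first exact: mU.
elim: m mE PE mU => [|m IH] mE PE mU; first by rewrite big_ord0 measure0 mul0r.
rewrite -natr1 mulrDl mul1r; apply: (prob_le_setU (B := \big[setU/set0]_(j < m) E j) (C := E m)).
- exact: mU.
- exact: mU.
- exact: mE.
- by rewrite big_ord_recr.
- by apply: IH => [j jm|j jm|j jm]; [apply: mE|apply: PE|apply: mU]; exact: leqW.
- exact: PE.
Qed.

Variables (T : R) (F : R -> set (set Omega)).
Hypotheses (T0 : 0 < T) (hF : filtration T F).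

Lemma measurable_stopping_lt (tau : Omega -> R) : stopping_time T F tau ->
  measurable [set w | tau w < T].
Proof.
move=> [tau0 tauF].
(* The stopping property is available at times of [0, T], hence the first condition; it is met for
   large [k] on the event, because [tau w < T] and [tau] is nonnegative. *)
have -> : [set w | tau w < T] =
    \bigcup_k [set w | 0 <= T - k.+1%:R^-1 /\ tau w <= T - k.+1%:R^-1].
  rewrite eqEsubset; split => [w /= wT|w [k _] /= [_ h]]; last first.
    by apply: le_lt_trans h _; rewrite ltrBlDr ltrDl invr_gt0.
  have d0 : 0 < T - tau w by rewrite subr_gt0.
  exists (Num.truncn (T - tau w)^-1) => //=.
  have h : (Num.truncn (T - tau w)^-1).+1%:R^-1 <= T - tau w.
    rewrite -[leRHS]invrK lef_pV2 ?posrE ?invr_gt0//; apply/ltW/truncnS_gt.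
  by move: h (tau0 w); set v := _^-1 => h1 h2; split; lra.
apply: bigcup_measurable => k _.
have [k0|k0] := leP 0 (T - k.+1%:R^-1); last first.
  rewrite (_ : [set w | _] = set0)//; rewrite -subset0 => w /= [h _]; lra.
have kT : 0 <= T - k.+1%:R^-1 <= T by rewrite k0 gerBl invr_ge0 ler0n.
case: hF => _ Fm _; apply: (Fm _ kT).
rewrite (_ : [set w | _] = [set w | tau w <= T - k.+1%:R^-1]); last first.
  by rewrite eqEsubset; split=> w //= [].
exact: tauF.
Qed.

Lemma locally_bounded_whp (Z : R -> Omega -> R) : locally_bounded P T F Z ->
  forall eps : R, 0 < eps -> exists A : R, exists E : set Omega,
  [/\ 0 <= A, measurable E, (P E <= eps%:E)%E &
   forall w, ~ E w -> forall s, 0 < s <= T -> `|Z s w| <= A].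
Proof.
move=> [tau [K [[st mono cv] bd]]] eps eps0.
(* Outside [E m] the localizing time has reached the horizon, so the single constant [K m] bounds
   the path at all positive times. *)
pose E m := [set w | tau m w < T].
have mE m : measurable (E m) by exact: measurable_stopping_lt.
have dE m : E m.+1 `<=` E m by move=> w /=; exact: le_lt_trans (mono m w).
have aeE : {ae P, forall w, exists m, ~ E m w}.
  apply: filterS cv => w [m _ /(_ m (leqnn m)) /= h]; exists m.
  by rewrite /E /= => /(le_lt_trans h); rewrite ltxx.
have [m Pm] := decreasing_events_small mE dE aeE eps0.
have [N [mN PN hN]] := ae_null_set bd.
exists `|K m|, (E m `|` N); split.
- exact: normr_ge0.
- exact: measurableU.
- apply: (@le_trans _ _ (P (E m) + P N)%E); first exact: measureU2.
  by rewrite [P N]PN adde0.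
- move=> w /not_orP[Ew Nw] s /andP[s0 sT]; apply: le_trans (ler_norm _).
  apply: hN => //; rewrite (le_trans sT)// leNgt; exact/negP.
Qed.

End SmallEvents.

(** * Averages over neighbouring pairs of grid points *)

Section PairAverage.
Context {R : realType}.
Variables (n : nat) (t : nat -> R) (xi : R).
Implicit Types f g : nat -> nat -> R.

(** [M_tilde_hat] is convertible to the case of the powers of observed increments, and later proofs
    pass between the two by conversion. *)
Definition pair_avg f : R :=
  (N_total n t xi)%:R^-1 * \sum_(j < n.+1) \sum_(l in S_ n t xi j) f j l.

Lemma eq_pair_avg f g : (forall j l, (j <= n)%N -> (l <= n)%N -> `|t l - t j| <= xi ->
  l != j -> f j l = g j l) ->
  pair_avg f = pair_avg g.
Proof.
move=> fg; congr (_ * _); apply: eq_bigr => j _; apply: eq_bigr => l.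
by rewrite inE => /andP[h1 h2]; apply: fg; rewrite // -ltnS ltn_ord.
Qed.

Lemma le_pair_avg f g : (forall j l, (j <= n)%N -> (l <= n)%N -> `|t l - t j| <= xi ->
  l != j -> f j l <= g j l) ->
  pair_avg f <= pair_avg g.
Proof.
move=> fg; apply: ler_wpM2l => //; apply: ler_sum => j _; apply: ler_sum => l.
by rewrite inE => /andP[h1 h2]; apply: fg; rewrite // -ltnS ltn_ord.
Qed.

Lemma pair_avg_ge0 f : (forall j l, (j <= n)%N -> (l <= n)%N -> 0 <= f j l) -> 0 <= pair_avg f.
Proof.
move=> f0; apply: mulr_ge0 => //; apply: sumr_ge0 => j _; apply: sumr_ge0 => l _.
by apply: f0; rewrite // -ltnS ltn_ord.
Qed.

Lemma pair_avgD f g : pair_avg (fun j l => f j l + g j l) = pair_avg f + pair_avg g.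
Proof.
by rewrite /pair_avg -mulrDr -big_split; congr (_ * _); apply: eq_bigr => j _; rewrite -big_split.
Qed.

Lemma pair_avgZ a f : pair_avg (fun j l => a * f j l) = a * pair_avg f.
Proof.
rewrite /pair_avg [RHS]mulrCA; congr (_ * _); rewrite mulr_sumr; apply: eq_bigr => j _.
by rewrite mulr_sumr.
Qed.

Lemma pair_avg_sum I (s : seq I) (f : I -> nat -> nat -> R) :
  pair_avg (fun j l => \sum_(i <- s) f i j l) = \sum_(i <- s) pair_avg (f i).
Proof.
elim: s => [|i s IH].
  rewrite big_nil /pair_avg big1 ?mulr0// => j _; rewrite big1// => l _.
  by rewrite big_nil.
rewrite big_cons -IH -pair_avgD; apply: eq_pair_avg => j l _ _ _ _.
by rewrite big_cons.
Qed.

Lemma pair_avg_cst a : (0 < N_total n t xi)%N -> pair_avg (fun _ _ => a) = a.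
Proof.
move=> N0; rewrite /pair_avg.
rewrite (eq_bigr (fun j : 'I_n.+1 => (N_ n t xi j)%:R * a)) => [|j _].
  rewrite -mulr_suml -natr_sum mulrA mulVf ?mul1r//.
  by rewrite pnatr_eq0 -lt0n.
by rewrite sumr_const mulr_natl.
Qed.

Lemma norm_pair_avg f : `|pair_avg f| <= pair_avg (fun j l => `|f j l|).
Proof.
rewrite /pair_avg normrM ger0_norm//; apply: ler_wpM2l => //.
apply: le_trans (ler_norm_sum _ _ _) _; apply: ler_sum => j _.
exact: ler_norm_sum.
Qed.

Context {d : measure_display} {Omega : measurableType d}.
Variable P : probability Omega R.

Lemma measurable_pair_avg {d'} {V : measurableType d'} (f : nat -> nat -> V -> R) :
  (forall j l, (j <= n)%N -> (l <= n)%N -> measurable_fun setT (f j l)) ->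
  measurable_fun setT (fun w => pair_avg (fun j l => f j l w)).
Proof.
move=> mf; apply: measurable_funM; first exact: measurable_cst.
apply: measurable_sum => j; under eq_fun do rewrite big_mkcond/=.
have h (l : 'I_n.+1) : measurable_fun setT
    (fun x => if l \in S_ n t xi j then f j l x else 0).
  by case: (l \in S_ n t xi j) => //; apply: mf; rewrite -ltnS ltn_ord.
exact: measurable_sum.
Qed.

Lemma integrable_pair_avg (f : nat -> nat -> Omega -> R) :
  (forall j l, (j <= n)%N -> (l <= n)%N -> integrable_rv P (f j l)) ->
  integrable_rv P (fun w => pair_avg (fun j l => f j l w)).
Proof.
move=> mf; apply: integrable_rvZ.
apply: integrable_rv_sum => j _; apply: integrable_rv_sum => l _.
by apply: mf; rewrite -ltnS ltn_ord.
Qed.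

Lemma mean_pair_avg (f : nat -> nat -> Omega -> R) :
  (forall j l, (j <= n)%N -> (l <= n)%N -> integrable_rv P (f j l)) ->
  mean P (fun w => pair_avg (fun j l => f j l w)) = pair_avg (fun j l => mean P (f j l)).
Proof.
move=> mf; have im (j l : 'I_n.+1) : integrable_rv P (f j l).
  by apply: mf; rewrite -ltnS ltn_ord.
rewrite /pair_avg meanZ; last by apply: integrable_rv_sum => j _; exact: integrable_rv_sum.
congr (_ * _); rewrite mean_sum; last by move=> j _; exact: integrable_rv_sum.
by apply: eq_bigr => j _; rewrite mean_sum.
Qed.

End PairAverage.

Section ItoPairAverage.
Context {R : realType} {d : measure_display} {Omega : measurableType d}.
Variables (P : probability Omega R) (T : R) (F : R -> set (set Omega)).
Hypotheses (T0 : 0 < T) (hF : filtration T F).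
Variable B : R -> Omega -> R.
Hypothesis hB : brownian_motion P T F B.

Section FixedGrid.
Variables (n : nat) (t : nat -> R) (xi : R) (M : nat).
Hypotheses (n1 : (1 <= n)%N) (tG : grid T n t).
Hypothesis NM : forall j, (j <= n)%N -> ((N_ n t xi j).+1 <= M)%N.
Let avg := pair_avg n t xi.

(** For one pair, an interval of the integrand contributes its mean squared coefficient times the
    length shared with the pair. Averaging replaces the shared length by the full one times M^2 / N,
    and what remains is the mean energy, at most [L] by truncation. *)
Lemma mean_pair_avg_trunc (H : simple_integrand T F) (L : R) : 0 <= L ->
  let J := si_integral (si_trunc hF H L) B in
  integrable_rv P (fun w => avg (fun j l => (J (t l) w - J (t j) w) ^+ 2)) /\
  mean P (fun w => avg (fun j l => (J (t l) w - J (t j) w) ^+ 2)) <=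
  8 * ((M ^ 2)%:R / (N_total n t xi)%:R) * L.
Proof.
move=> L0 J; set G := si_trunc hF H L.
have key j l : (j <= n)%N -> (l <= n)%N ->
    integrable_rv P (fun w => (J (t l) w - J (t j) w) ^+ 2) /\
    mean P (fun w => (J (t l) w - J (t j) w) ^+ 2) <=
    8 * \sum_(i < si_size G) mean P (fun w => si_coef G i w ^+ 2) *
    (pair_clamp t j l (si_knot G i.+1) - pair_clamp t j l (si_knot G i)).
  move=> jn ln.
  (* The square ignores the order of the pair, whereas the bound for integrals needs an ordered
     interval. *)
  have -> : (fun w => (J (t l) w - J (t j) w) ^+ 2) =
     (fun w => (J (t (maxn j l)) w - J (t (minn j l)) w) ^+ 2).
    apply/funext => w; have [jl|lj] := leqP j l.
      by rewrite ?(maxn_idPr jl) ?(minn_idPl jl).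
    by rewrite ?(maxn_idPl (ltnW lj)) ?(minn_idPr (ltnW lj)) -sqrrN opprB.
  have h1 : (minn j l <= maxn j l)%N by rewrite geq_min !leq_max leqnn.
  have h2 : (maxn j l <= n)%N by rewrite geq_max jn.
  have /andP[a0 _] := grid_itv tG (leq_trans h1 h2).
  have /andP[_ bT] := grid_itv tG h2.
  exact: (mean_si_integralB_sqr hF hB G a0 (grid_le tG h1 h2) bT).
split.
  by apply: integrable_pair_avg => j l jn ln; have [] := key j l jn ln.
rewrite /avg mean_pair_avg; last by move=> j l jn ln; have [] := key j l jn ln.
apply: (@le_trans _ _ (pair_avg n t xi (fun j l => 8 * \sum_(i < si_size G)
    mean P (fun w => si_coef G i w ^+ 2) *
    (pair_clamp t j l (si_knot G i.+1) - pair_clamp t j l (si_knot G i))))).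
  by apply: le_pair_avg => j l jn ln _ _; have [] := key j l jn ln.
rewrite pair_avgZ -mulrA; apply: ler_wpM2l => //.
rewrite (pair_avg_sum _ _ _ (index_enum _) (fun i : 'I_(si_size G) => fun j l =>
  mean P (fun w => si_coef G i w ^+ 2) *
    (pair_clamp t j l (si_knot G i.+1) - pair_clamp t j l (si_knot G i)))).
have ic (i : 'I_(si_size G)) : integrable_rv P (fun w => si_coef G i w ^+ 2).
  have [K hK] := si_coef_bounded (ltn_ord i).
  apply: (@integrable_rv_bounded _ _ _ P _ (K ^+ 2)).
    by apply: measurable_funX; exact: measurable_coef.
  by move=> w; rewrite normrX lerXn2r ?nnegrE// (le_trans _ (hK w)).
apply: (@le_trans _ _ (\sum_(i < si_size G) (M ^ 2)%:R / (N_total n t xi)%:R *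
    (mean P (fun w => si_coef G i w ^+ 2) * (si_knot G i.+1 - si_knot G i)))).
  apply: ler_sum => i _; rewrite pair_avgZ [leRHS]mulrCA.
  apply: ler_wpM2l; first by apply: mean_ge0 => w; exact: sqr_ge0.
  rewrite [X in _ <= X * _]mulrC -mulrA; apply: ler_wpM2l.
    by rewrite invr_ge0.
  have /andP[k0 _] := si_knot_range (ltnW (ltn_ord i)).
  have /andP[_ kT] := si_knot_range (ltn_ord i).
  apply: (sum_pair_clampB_le n1 tG k0 _ kT) => //.
  exact: (si_knot_mono (ltn_ord i)).
rewrite -mulr_sumr; apply: ler_wpM2l; first by rewrite divr_ge0.
have -> : \sum_(i < si_size G) mean P (fun w => si_coef G i w ^+ 2) *
      (si_knot G i.+1 - si_knot G i) =
   mean P (fun w => si_energy G (si_size H) w).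
  rewrite /si_energy mean_sum => [|i _].
    apply: eq_bigr => i _; rewrite mulrC -meanZ//.
    by apply: eq_Rintegral => w _; rewrite mulrC.
  under eq_fun do rewrite mulrC.
  by apply: integrable_rvZ; exact: ic.
rewrite -[leRHS](mean_cst P); apply: mean_le; last by move=> w; exact: si_trunc_energy.
  rewrite /si_energy; apply: integrable_rv_sum => i _.
  under eq_fun do rewrite mulrC.
  by apply: integrable_rvZ; exact: ic.
exact: integrable_rv_cst.
Qed.

End FixedGrid.

Lemma measurable_si_integral (H : simple_integrand T F) s : 0 <= s <= T ->
  measurable_fun setT (si_integral H B s).
Proof.
move=> /andP[s0 sT].
have mB r : 0 <= r -> measurable_fun setT (B (Num.min r s)).
  move=> r0; apply: (known_at_measurable hF (t := Num.min r s)).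
    by rewrite le_min r0 s0/= ge_min sT orbT.
  by apply: (known_at_brownian hB); rewrite le_min r0 s0/= ge_min sT orbT.
apply: measurable_sum => i; apply: measurable_funM; first exact: measurable_coef.
have /andP[k0 _] := si_knot_range (ltnW (ltn_ord i)).
have /andP[k1 _] := si_knot_range (ltn_ord i).
by apply: measurable_funB; exact: mB.
Qed.

Lemma ge0_cvge0_near (f : nat -> \bar R) (c : R) : (forall n, 0 <= f n)%E ->
  f n @[n --> \oo] --> 0%E -> 0 < c -> \forall n \near \oo, (f n <= c%:E)%E.
Proof.
move=> f0 /fine_cvgP[ff /cvgrPdist_le fc] c0; have := fc _ c0.
move=> h; near=> n; have fn : f n \is a fin_num by near: n.
have : `|0 - fine (f n)| <= c by near: n.
by rewrite sub0r normrN ger0_norm ?fine_ge0// -lee_fin fineK.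
Unshelve. all: by end_near. Qed.

Variables (sigma I : R -> Omega -> R).
Hypotheses (csigma : forall w, cadlag T (fun s => sigma s w))
  (asigma : adapted T F sigma) (bsigma : locally_bounded P T F sigma)
  (hI : is_ito_integral P T F B sigma I).

Let msigma : measurable_fun (`[0, T] `*` setT) (fun z : R * Omega => sigma z.1 z.2).
Proof.
apply: cadlag_measurable => //; first exact: ltW.
move=> s sT; apply: (known_at_measurable hF sT).
by apply: (known_at_preimage (T := T)) => // A mA; exact: asigma.
Qed.

Let mI s : 0 <= s <= T -> measurable_fun setT (I s).
Proof. by case: hI => h _ _; exact: h. Qed.

Lemma ito_pair_avg_whp (eps : R) : 0 < eps -> exists2 L : R, 0 <= L &
  forall n (t : nat -> R) xi M a, (1 <= n)%N -> grid T n t ->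
   (forall j, (j <= n)%N -> ((N_ n t xi j).+1 <= M)%N) ->
   (0 < N_total n t xi)%N -> 0 < a ->
   (P [set w | 4 * a < pair_avg n t xi (fun j l => (I (t l) w - I (t j) w) ^+ 2)]%R
    <= (eps + 8 * ((M ^ 2)%:R / (N_total n t xi)%:R) * L / a)%:E)%E.
Proof.
move=> eps0; have e30 : 0 < eps / 3 by rewrite divr_gt0.
have [A [E [A0 mE PE hE]]] := locally_bounded_whp hF bsigma e30.
have [_ _ [H Hsigma HI]] := hI.
(* The bound of [si_energy_bound] for an approximation error at most 1 and [sigma] at most [A]. It
   does not involve the grid. *)
pose L := 2 * 1 + 2 * (A ^+ 2 * T).
have L0 : 0 <= L by rewrite addr_ge0// !mulr_ge0// ?sqr_ge0// ltW.
exists L => // n t xi M a n1 tG NM N0 a0.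
(* An error [eta] at both ends changes an increment by at most 2 eta, and 4 eta^2 <= a is wanted. *)
pose eta := Num.min 1 (a / 4).
have eta0 : 0 < eta by rewrite lt_min ltr01 divr_gt0.
have eta2 : 4 * eta ^+ 2 <= a.
  have h1 : eta <= 1 by rewrite ge_min lexx.
  have h2 : eta <= a / 4 by rewrite ge_min lexx orbT.
  by nra.
pose D r w := (\int[lebesgue_measure]_(s in `[0%R, T])
  ((si_process (H r) s w - sigma s w) ^+ 2)%:E)%E.
pose E1 r := [set w | (1%:E < `|D r w|)%E].
pose E2 r j := [set w | (eta%:E < `|(si_integral (H r) B (t j) w - I (t j) w)%:E|)%E].
have n30 : 0 < eps / 3 / n.+1%:R by rewrite divr_gt0.
have near1 : \forall r \near \oo, (P (E1 r) <= (eps / 3)%:E)%E.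
  by apply: ge0_cvge0_near => //; exact: Hsigma.
(* The grid is fixed by now, so one approximant serves its [n.+1] points, and a union bound over
   them costs eps / 3. *)
have near2 : \forall r \near \oo, forall j : 'I_n.+1, (P (E2 r j) <= (eps / 3 / n.+1%:R)%:E)%E.
  apply: filter_forall => j; apply: ge0_cvge0_near => //.
  have jT : 0 <= t j <= T by apply: (grid_itv tG); rewrite -ltnS ltn_ord.
  exact: (HI _ jT).
have [r [Pr1 Pr2]] : exists r, (P (E1 r) <= (eps / 3)%:E)%E /\
    forall j : 'I_n.+1, (P (E2 r j) <= (eps / 3 / n.+1%:R)%:E)%E.
  have := filterI near1 near2; move=> [m _ /(_ m (leqnn m))] [h1 h2].
  by exists m.
pose J := si_integral (si_trunc hF (H r) L) B.
have [iJ EJ] := mean_pair_avg_trunc n1 tG NM (H r) L0.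
pose E3 := [set w | a < pair_avg n t xi (fun j l => (J (t l) w - J (t j) w) ^+ 2)].
have PE3 : (P E3 <= (8 * ((M ^ 2)%:R / (N_total n t xi)%:R) * L / a)%:E)%E.
  apply: le_trans (markov_mean iJ _ a0) _.
    by move=> w; apply: pair_avg_ge0 => j l _ _; exact: sqr_ge0.
  by rewrite lee_fin ler_wpM2r ?invr_ge0 ?(ltW a0).
have mD : measurable_fun setT (D r).
  exact: measurable_integral_diff_sqr.
have mE1 : measurable (E1 r).
  rewrite -[X in measurable X]setTI; apply: emeasurable_fun_o_infty => //.
  exact: measurableT_comp.
have tT j : (j <= n)%N -> 0 <= t j <= T by exact: grid_itv.
have mE2 (j : 'I_n.+1) : measurable (E2 r j).
  rewrite -[X in measurable X]setTI; apply: emeasurable_fun_o_infty => //.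
  apply: measurableT_comp => //; apply/measurable_EFinP.
  by apply: measurable_funB; [apply: measurable_si_integral|apply: mI];
    apply: tT; rewrite -ltnS ltn_ord.
have mE3 : measurable E3.
  rewrite -[X in measurable X]setTI; apply: measurable_fun_ltr => //.
  exact: integrable_rv_measurable iJ.
have mS : measurable [set w | 4 * a < pair_avg n t xi (fun j l => (I (t l) w - I (t j) w) ^+ 2)].
  rewrite -[X in measurable X]setTI; apply: measurable_fun_ltr => //.
  apply: measurable_pair_avg => j l jn ln.
  by apply: measurable_funX; apply: measurable_funB; apply: mI; exact: tT.
have [mU2 PU2] : measurable (\big[setU/set0]_(j < n.+1) E2 r j) /\
    (P (\big[setU/set0]_(j < n.+1) E2 r j) <= (n.+1%:R * (eps / 3 / n.+1%:R))%:E)%E.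
  apply: prob_bigsetU_le => j jn; first exact: (mE2 (Ordinal jn)).
  exact: (Pr2 (Ordinal jn)).
have eU : n.+1%:R * (eps / 3 / n.+1%:R) = eps / 3.
  by rewrite mulrC divfK.
rewrite eU in PU2.
apply: (@le_trans _ _ ((eps / 3 + (eps / 3 + eps / 3)) +
  8 * ((M ^ 2)%:R / (N_total n t xi)%:R) * L / a)%:E).
  apply: (prob_le_setU (B := E `|` (E1 r `|` \big[setU/set0]_(j < n.+1) E2 r j)) (C := E3)) => //.
  - by apply: measurableU => //; exact: measurableU.
  - move=> w; rewrite /= => Iw; apply: contrapT => /not_orP[/not_orP[Ew /not_orP[E1w E2w]] E3w].
    have : si_energy (H r) (si_size (H r)) w <= L.
      apply: (si_energy_bound msigma) => //; [exact: hE| |exact: ltW].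
      by apply: le_trans (lee_abs _) _; rewrite leNgt; exact/negP.
    move=> HL; move: Iw; apply/negP; rewrite -leNgt.
    have E3w' : pair_avg n t xi (fun j l => (J (t l) w - J (t j) w) ^+ 2) <= a.
      by rewrite leNgt; exact/negP.
    (* With x the increment of the integral and y that of its approximant, x^2 <= 2 y^2 + 2 (x -
       y)^2 and (x - y)^2 <= 4 eta^2 <= a. Both halves are at most 2a. *)
    apply: (@le_trans _ _ (2 * pair_avg n t xi (fun j l => (J (t l) w - J (t j) w) ^+ 2) + 2 * a));
      last by move: E3w'; lra.
    rewrite -pair_avgZ -[2 * a](pair_avg_cst (n := n) (t := t) (xi := xi))// -pair_avgD.
    apply: le_pair_avg => j l jn ln _ _.
    have cl i : (i <= n)%N -> `|J (t i) w - I (t i) w| <= eta.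
      move=> i_n; rewrite /J si_trunc_id//; rewrite leNgt; apply/negP => h; apply: E2w.
      rewrite -bigcup_mkord; exists i => //=; rewrite ?ltnS//.
    move: (cl j jn) (cl l ln); rewrite !ler_norml => /andP[h1 h2] /andP[h3 h4].
    have h5 : ((I (t l) w - I (t j) w) - (J (t l) w - J (t j) w)) ^+ 2 <= 4 * eta ^+ 2 by nra.
    set x := I (t l) w - _ in h5 *; set y := J (t l) w - _ in h5 *.
    have := sqr_ge0 (x - 2 * y); nra.
  - have mEU : measurable (E1 r `|` \big[setU/set0]_(j < n.+1) E2 r j) by exact: measurableU.
    apply: (prob_le_setU (B := E) (C := E1 r `|` \big[setU/set0]_(j < n.+1) E2 r j)) => //.
      exact: measurableU.
    exact: (prob_le_setU (B := E1 r) (C := \big[setU/set0]_(j < n.+1) E2 r j)).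
by rewrite lee_fin; lra.
Qed.

End ItoPairAverage.

Section Drift.
Context {R : realType}.
Implicit Types x : R -> R.

Lemma bounded_path_integrable x (T A a : R) : measurable_fun `[0, T] x ->
  (forall s, 0 < s <= T -> `|x s| <= A) -> 0 <= a <= T ->
  (@lebesgue_measure R).-integrable `[0, a] (EFin \o x).
Proof.
move=> mx xA /andP[a0 aT]; apply: measurable_bounded_integrable => //.
- by have := lebesgue_measure_itv `[0, a]%R; rewrite /= => ->; case: ifP => _; rewrite ?ltry.
- by apply: measurable_funS mx => // s/=; rewrite !in_itv/= => /andP[-> /le_trans]; exact.
(* [A] bounds the path at positive times only, so the value at 0 enters separately. *)
- exists (Num.max A `|x 0|); split; first exact: num_real.
  move=> M hM s/=; rewrite in_itv/= => /andP[s0 sa]; apply: le_trans (ltW hM).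
  move: s0; rewrite le_eqVlt => /predU1P[<-|s0]; first by rewrite le_max lexx orbT.
  by rewrite le_max xA// s0 (le_trans sa).
Qed.

Lemma bounded_path_integral_lipschitz x (T A a b : R) : measurable_fun `[0, T] x ->
  (forall s, 0 < s <= T -> `|x s| <= A) -> 0 <= a -> a <= b -> b <= T ->
  `|\int[lebesgue_measure]_(s in `[0, b]) x s - \int[lebesgue_measure]_(s in `[0, a]) x s|
  <= A * (b - a).
Proof.
move=> mx xA a0 ab bT.
have b0 := le_trans a0 ab.
have ib : (@lebesgue_measure R).-integrable `[0, b] (EFin \o x).
  by apply: bounded_path_integrable mx xA _; rewrite b0.
rewrite (@Rintegral_itvB _ _ (BLeft 0) (BRight b) a)//.
have sub : `]a, b] `<=` `[0, b].
  by move=> s/=; rewrite !in_itv/= => /andP[/ltW as_ ->]; rewrite (le_trans a0).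
have iab : (@lebesgue_measure R).-integrable `]a, b] (EFin \o x) by exact: integrableS ib.
apply: le_trans (le_normr_Rintegral _ iab) _ => //.
have -> : A * (b - a) = \int[lebesgue_measure]_(s in `]a, b]) A.
  by rewrite Rintegral_cst//= lebesgue_measure_oc.
apply: le_Rintegral => //.
- exact: integrable_norm.
- apply: measurable_bounded_integrable => //.
    by rewrite /= lebesgue_measure_oc// ltry.
  exists `|A|; split; first exact: num_real.
  by move=> M hM s _; exact: ltW.
- move=> s/=; rewrite in_itv/= => /andP[as_ sb]; apply: xA.
  by rewrite (le_lt_trans a0)// (le_trans sb).
Qed.

End Drift.

Section ItoProcess.
Context {R : realType} {d : measure_display} {Omega : measurableType d}.
Variables (P : probability Omega R) (T : R) (F : R -> set (set Omega)).
Hypotheses (T0 : 0 < T) (hF : filtration T F).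
Variable B : R -> Omega -> R.
Hypothesis hB : brownian_motion P T F B.
Variables mu sigma X : R -> Omega -> R.
Hypotheses (pmu : progressively_measurable T F mu) (bmu : locally_bounded P T F mu)
  (csigma : forall w, cadlag T (fun s => sigma s w))
  (asigma : adapted T F sigma) (bsigma : locally_bounded P T F sigma)
  (hX : ito_process P T F B mu sigma X).

Let mX s : 0 <= s <= T -> measurable_fun setT (X s).
Proof. by case: hX => h _ _; exact: h. Qed.

Let mmu w : measurable_fun `[0, T] (fun s => mu s w).
Proof.
have T0T : 0 <= T <= T by rewrite (ltW T0) lexx.
exact: (@measurable_path _ _ (g_sigma_algebraType (F T)) T mu (pmu T0T) w).
Qed.

Let drift w s := \int[lebesgue_measure]_(r in `[0, s]) mu r w.

Lemma ito_process_pair_avg_whp (c eps : R) : 0 < c -> 0 < eps ->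
  exists2 K : R, 0 < K &
  forall n (t : nat -> R) xi M, (1 <= n)%N -> grid T n t ->
   (forall j, (j <= n)%N -> ((N_ n t xi j).+1 <= M)%N) ->
   (0 < N_total n t xi)%N -> 0 < xi <= 1 ->
   (M ^ 2)%:R / (N_total n t xi)%:R <= c * xi ->
   (P [set w | K * xi < pair_avg n t xi (fun j l => (X (t l) w - X (t j) w) ^+ 2)]%R
    <= eps%:E)%E.
Proof.
move=> c0 eps0; have [_ _ [I hI eX]] := hX.
have e40 : 0 < eps / 4 by rewrite divr_gt0.
have [A [E [A0 mE PE hE]]] := locally_bounded_whp hF bmu e40.
have [L L0 hL] := ito_pair_avg_whp T0 hF hB csigma asigma bsigma hI e40.
have [N [mN PN hN]] := ae_null_set eX.
(* Makes the Markov term 8 (c xi) L / (a0 xi) at most eps / 4; the summand 1 keeps [a0] positive. *)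
pose a0 := 32 * c * L / eps + 1.
have a00 : 0 < a0 by rewrite ltr_wpDl// divr_ge0 ?mulr_ge0// ltW.
(* From (x + y)^2 <= 2 x^2 + 2 y^2: the drift part is at most A^2 xi^2 <= A^2 xi as xi <= 1, and the
   average for the stochastic integral is at most 4 a0 xi. *)
pose K := 2 * A ^+ 2 + 8 * a0.
have K0 : 0 < K by rewrite ltr_wpDl ?mulr_gt0// mulr_ge0 ?sqr_ge0.
exists K => // n t xi M n1 tG NM NT /andP[xi0 xi1] MN.
have axi : 0 < a0 * xi by exact: mulr_gt0.
have mI s : 0 <= s <= T -> measurable_fun setT (I s) by case: hI => h _ _; exact: h.
have tT j : (j <= n)%N -> 0 <= t j <= T by exact: (grid_itv tG).
have := hL n t xi M (a0 * xi) n1 tG NM NT axi.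
set EI := [set w | _]; move=> PEI.
have PEI2 : (P EI <= (eps / 2)%:E)%E.
  apply: le_trans PEI _; rewrite lee_fin.
  have h : 8 * ((M ^ 2)%:R / (N_total n t xi)%:R) * L / (a0 * xi) <= eps / 4.
    rewrite ler_pdivrMr//; apply: (@le_trans _ _ (8 * (c * xi) * L)).
      by rewrite ler_wpM2r// ler_wpM2l.
    have -> : eps / 4 * (a0 * xi) = 8 * (c * xi) * L + eps / 4 * xi.
      by rewrite /a0; field; rewrite gt_eqF.
    by rewrite lerDl mulr_ge0// ltW.
  by lra.
have mEI : measurable EI.
  rewrite -[X in measurable X]setTI; apply: measurable_fun_ltr => //.
  apply: measurable_pair_avg => j l jn ln.
  by apply: measurable_funX; apply: measurable_funB; apply: mI; exact: tT.
apply: (@le_trans _ _ ((eps / 4 + 0) + eps / 2)%:E); last by rewrite lee_fin; lra.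
have mEN : measurable (E `|` N) by exact: measurableU.
apply: (prob_le_setU (B := E `|` N) (C := EI)) => //.
- rewrite -[X in measurable X]setTI; apply: measurable_fun_ltr => //.
  apply: measurable_pair_avg => j l jn ln.
  by apply: measurable_funX; apply: measurable_funB; apply: mX; exact: tT.
- move=> w /= Xw; apply: contrapT => /not_orP[/not_orP[Ew Nw] EIw].
  move: Xw; apply/negP; rewrite -leNgt.
  have EIw' : pair_avg n t xi (fun j l => (I (t l) w - I (t j) w) ^+ 2) <= 4 * (a0 * xi).
    by rewrite leNgt; exact/negP.
  apply: (@le_trans _ _ (2 * pair_avg n t xi (fun j l => (I (t l) w - I (t j) w) ^+ 2) +
      2 * A ^+ 2 * xi));
    last by rewrite /K; lra.
  rewrite -pair_avgZ -[2 * A ^+ 2 * xi](pair_avg_cst (n := n) (t := t) (xi := xi))// -pair_avgD.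
  apply: le_pair_avg => j l jn ln tjl _.
  have lip : `|drift w (t l) - drift w (t j)| <= A * xi.
    have [jT lT] := (tT _ jn, tT _ ln); move: jT lT => /andP[j0 jT] /andP[l0 lT].
    have [tjl'|tjl'] := leP (t j) (t l).
      apply: le_trans (bounded_path_integral_lipschitz (mmu w) (hE w Ew) j0 tjl' lT) _.
      by apply: ler_wpM2l => //; apply: le_trans tjl; rewrite ler_norm.
    rewrite distrC.
    apply: le_trans (bounded_path_integral_lipschitz (mmu w) (hE w Ew) l0 (ltW tjl') jT) _.
    by apply: ler_wpM2l => //; apply: le_trans tjl; rewrite distrC ler_norm.
  have -> : X (t l) w - X (t j) w = (drift w (t l) - drift w (t j)) + (I (t l) w - I (t j) w).
    by rewrite (hN w Nw _ (tT _ jn)) (hN w Nw _ (tT _ ln)) /drift; lra.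
  set x := drift w (t l) - _ in lip *; set y := I (t l) w - _.
  have x2 : x ^+ 2 <= A ^+ 2 * xi.
    rewrite -real_normK ?num_real// (le_trans (_ : _ <= (A * xi) ^+ 2))//.
      by rewrite lerXn2r// nnegrE mulr_ge0// ltW.
    by rewrite exprMn ler_wpM2l ?sqr_ge0// expr2 ler_piMl// ltW.
  have := sqr_ge0 (x - y); lra.
- by apply: (prob_le_setU (B := E) (C := N)) => //; rewrite [P N]PN.
Qed.

(** Almost every path is bounded: a starting value, a bounded drift integral and a continuous
    function on a compact interval. One [A] thus serves all grids, and restricting to the countably
    many grid points keeps the events measurable. *)
Lemma ito_process_sup_whp (t : nat -> nat -> R) :
  (forall n, (1 <= n)%N -> grid T n (t n)) ->
  forall eps : R, 0 < eps -> exists A : R, exists E : set Omega,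
  [/\ 0 <= A, measurable E, (P E <= eps%:E)%E &
   forall w, ~ E w -> forall n j, (1 <= n)%N -> (j <= n)%N -> `|X (t n j) w| <= A].
Proof.
move=> tG eps eps0; have [_ _ [I hI eX]] := hX; have [_ cI _] := hI.
have tT n j : (1 <= n)%N -> (j <= n)%N -> 0 <= t n j <= T by move=> n1; exact: (grid_itv (tG n n1)).
pose E (m : nat) := \bigcup_n \bigcup_j
  [set w | [/\ (1 <= n)%N, (j <= n)%N & m%:R < `|X (t n j) w|]].
have mE m : measurable (E m).
  apply: bigcup_measurable => n _; apply: bigcup_measurable => j _.
  have [n1|n1] := boolP (1 <= n)%N; last first.
    by rewrite (_ : [set w | _] = set0)// -subset0 => w [].
  have [jn|jn] := boolP (j <= n)%N; last first.
    by rewrite (_ : [set w | _] = set0)// -subset0 => w [].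
  rewrite (_ : [set w | _] = [set w | m%:R < `|X (t n j) w|]); last first.
    by rewrite eqEsubset; split=> w //= [].
  rewrite -[X in measurable X]setTI; apply: measurable_fun_ltr => //.
  by apply: measurableT_comp => //; apply: mX; exact: tT.
have dE m : E m.+1 `<=` E m.
  move=> w [n _ [j _ [n1 jn h]]]; exists n => //; exists j => //; split => //.
  by apply: le_lt_trans h; rewrite ler_nat.
have aeE : {ae P, forall w, exists m, ~ E m w}.
  have [tau [K [[_ _ cv] bd]]] := bmu.
  apply: filterS3 eX cI (filterI cv bd) => w Xw Iw [[m _ /(_ m (leqnn m)) /= taum] bdw].
  have muK s : 0 < s <= T -> `|mu s w| <= K m.
    by move=> /andP[s0 sT]; apply: bdw => //; exact: le_trans taum.
  have [C hC] : exists C : R, forall s, 0 <= s <= T -> `|I s w| <= C.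
    have [M [_ hM]] := compact_bounded (continuous_compact Iw (@segment_compact R 0 T)).
    exists (M + 1) => s sT; apply: (hM (M + 1)); first by rewrite ltrDl.
    by exists s => //=; rewrite in_itv.
  exists (Num.truncn (`|X 0 w| + `|K m| * T + C)).+1 => -[n _ [j _ [n1 jn]]].
  apply/negP; rewrite -leNgt; have tnj := tT n j n1 jn.
  have /andP[j0 jT] := tnj.
  apply: le_trans (ltW (truncnS_gt _)).
  rewrite Xw//; apply: le_trans (ler_normD _ _) _; apply: lerD; last exact: hC.
  apply: le_trans (ler_normD _ _) _; apply: lerD => //.
  have := bounded_path_integral_lipschitz (mmu w) muK (lexx 0) j0 jT.
  rewrite set_itv1 Rintegral_set1 !subr0 => h; apply: le_trans h _.
  apply: le_trans (ler_norm _) _; rewrite normrM; apply: ler_pM => //.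
  by rewrite ger0_norm.
have [m Pm] := decreasing_events_small mE dE aeE eps0.
exists m%:R, (E m); split => // w Ew n j n1 jn.
rewrite leNgt; apply/negP => h; apply: Ew; exists n => //; exists j => //.
Qed.

End ItoProcess.

(** * Odd moments *)

Section SinBounds.
Context {R : realType}.
Implicit Types x : R.

Lemma sin_le_self x : 0 <= x -> `|sin x| <= x.
Proof.
move=> x0; have [c _] := @MVT_segment R sin cos 0 x x0 (fun y _ => is_derive_sin y)
  (continuous_subspaceT (@continuous_sin R)).
rewrite sin0 !subr0 => ->; rewrite normrM [`|x|]ger0_norm//.
by rewrite ler_piMl// cos_max.
Qed.

Lemma norm_sin_le x : `|sin x| <= `|x|.
Proof.
have [x0|x0] := leP 0 x; first by rewrite [leRHS]ger0_norm// sin_le_self.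
have nx0 : 0 <= - x by rewrite oppr_ge0 ltW.
by have := sin_le_self nx0; rewrite sinN normrN => /le_trans; apply; rewrite -normrN ler_norm.
Qed.

Lemma cos_half x : 1 - cos (2 * x) = 2 * sin x ^+ 2.
Proof. by rewrite mulrDl mul1r cosD -!expr2 cos2sin2; ring. Qed.

(** The mean value theorem gives sin x = x cos c with c between 0 and x, and 1 - cos c = 2
    sin(c/2)^2 is at most x^2. *)
Lemma sin_approx_ge0 x : 0 <= x -> `|x - sin x| <= `|x| ^+ 3.
Proof.
move=> x0; have [c cx] := @MVT_segment R sin cos 0 x x0 (fun y _ => is_derive_sin y)
  (continuous_subspaceT (@continuous_sin R)).
rewrite sin0 !subr0 => ->; move: cx; rewrite in_itv/= => /andP[c0 cx].
have -> : x - cos c * x = (1 - cos (2 * (c / 2))) * x.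
  by rewrite [2 * _]mulrC divfK// mulrBl mul1r.
rewrite cos_half normrM [leRHS]exprSr; apply: ler_wpM2r => //.
rewrite normrM normrX ger0_norm//.
have h2 : `|sin (c / 2)| <= x / 2.
  apply: le_trans (norm_sin_le _) _; rewrite ger0_norm ?divr_ge0//; lra.
by rewrite (ger0_norm x0); have := normr_ge0 (sin (c / 2)); nra.
Qed.

Lemma sin_approx x : `|x - sin x| <= `|x| ^+ 3.
Proof.
have [x0|x0] := leP 0 x; first exact: sin_approx_ge0.
have nx0 : 0 <= - x by rewrite oppr_ge0 ltW.
have := sin_approx_ge0 nx0.
have -> : - x - sin (- x) = - (x - sin x) by rewrite sinN; ring.
by rewrite !normrN.
Qed.

Lemma exprB_le (a b : R) i : `|b| <= `|a| ->
  `|a ^+ i.+1 - b ^+ i.+1| <= i.+1%:R * `|a - b| * `|a| ^+ i.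
Proof.
move=> ba; elim: i => [|i IH]; first by rewrite !expr1 expr0 mulr1 mul1r.
have -> : a ^+ i.+2 - b ^+ i.+2 = a * (a ^+ i.+1 - b ^+ i.+1) + (a - b) * b ^+ i.+1.
  by rewrite (exprS a i.+1) (exprS b i.+1); ring.
apply: le_trans (ler_normD _ _) _; rewrite !normrM normrX.
have h1 : `|a| * `|a ^+ i.+1 - b ^+ i.+1| <= i.+1%:R * `|a - b| * `|a| ^+ i.+1.
  have -> : i.+1%:R * `|a - b| * `|a| ^+ i.+1 = `|a| * (i.+1%:R * `|a - b| * `|a| ^+ i).
    by rewrite exprS; ring.
  exact: ler_wpM2l.
have h2 : `|a - b| * `|b| ^+ i.+1 <= `|a - b| * `|a| ^+ i.+1.
  by apply: ler_wpM2l => //; rewrite lerXn2r// nnegrE.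
by rewrite -natr1; lra.
Qed.

End SinBounds.

Section ErrorMoments.
Context {R : realType} {d : measure_display} {Omega : measurableType d}.
Variables (P : probability Omega R) (f : R -> R) (U : {RV P >-> R}).
Hypothesis hU : has_density U f.

Let mU : measurable_fun setT (U : Omega -> R). Proof. exact: measurable_funP. Qed.

Let density (g : R -> R) : measurable_fun setT g -> (forall x, 0 <= g x) ->
  (\int[P]_w (g (U w))%:E = \int[lebesgue_measure]_x (g x * f x)%:E)%E.
Proof.
by case: hU => mf f0 hA mg g0; apply: ge0_integral_rv_density.
Qed.

Lemma integral_density1 : (\int[lebesgue_measure]_x (f x)%:E = 1)%E.
Proof.
transitivity (\int[lebesgue_measure]_x (1 * f x)%:E)%E.
  by apply: eq_integral => x _; rewrite mul1r.
rewrite -(density (g := fun=> 1))//.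
by rewrite integral_cst// mul1e; exact: probability_setT.
Qed.

(** The transfer to the density is stated for nonnegative functions. Adding 1 to [g] produces one,
    and the total mass 1 removes the shift. *)
Lemma mean_bounded_density (g : R -> R) : measurable_fun setT g ->
  (forall x, `|g x| <= 1) ->
  mean P (fun w => g (U w)) = \int[lebesgue_measure]_x (g x * f x).
Proof.
move=> mg g1; have [mf f0 _] := hU.
have g1' x : -1 <= g x <= 1 by rewrite -ler_norml.
have if1 : (@lebesgue_measure R).-integrable setT (EFin \o f).
  apply/integrableP; split; first exact/measurable_EFinP.
  by under eq_integral do rewrite /= ger0_norm//; rewrite integral_density1 ltry.
have igf : (@lebesgue_measure R).-integrable setT (EFin \o (fun x => g x * f x)).
  apply: le_integrable if1 => //; first by apply/measurable_EFinP; exact: measurable_funM.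
  by move=> x _; rewrite /= lee_fin normrM ler_piMl.
have ig : integrable_rv P (fun w => g (U w)).
  by apply: (@integrable_rv_bounded _ _ _ P _ 1) => //; exact: measurableT_comp.
have e : mean P (fun w => g (U w) + 1) = \int[lebesgue_measure]_x (g x * f x + f x).
  rewrite /mean /Rintegral (density (g := fun x => g x + 1))//.
  - by congr fine; apply: eq_integral => x _; rewrite mulrDl mul1r.
  - exact: measurable_funD.
  - by move=> x; have := g1' x; lra.
rewrite meanD// in e; last exact: integrable_rv_cst.
rewrite mean_cst RintegralD// {2}/Rintegral integral_density1/= in e.
exact: addIr e.
Qed.

Hypothesis hreal : forall s : R, fourier f s \is Num.real.

Lemma mean_sin0 (a : R) : mean P (fun w => sin (a * U w)) = 0.
Proof.
have msin : measurable_fun setT (fun x : R => sin (a * x)).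
  apply: measurableT_comp; last exact: measurable_funM.
  by apply: continuous_measurable_fun; exact: continuous_sin.
rewrite (mean_bounded_density msin) => [|x]; last exact: sin_max.
(* Being real means being comparable with 0, and the order on complex numbers compares only numbers
   with equal imaginary parts. *)
have := hreal a; rewrite realE /fourier !lecE /=.
by move=> /orP[]/andP[/eqP <-].
Qed.

Let bounded_trig (a s : R) m :
  integrable_rv P (fun w => sin (a * U w) * (1 - cos (2 * (s * U w))) ^+ m).
Proof.
apply: (@integrable_rv_bounded _ _ _ P _ (2 ^+ m)).
  apply: measurable_funM.
    apply: measurableT_comp; last exact: measurable_funM.
    by apply: continuous_measurable_fun; exact: continuous_sin.
  apply: measurable_funX; apply: measurable_funB => //; apply: measurableT_comp.
    by apply: continuous_measurable_fun; exact: continuous_cos.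
  by do 2 apply: measurable_funM => //.
move=> w; rewrite normrM -[leRHS]mul1r; apply: ler_pM => //; first exact: sin_max.
rewrite normrX lerXn2r ?nnegrE// ger0_norm.
  by have := cos_geN1 (2 * (s * U w)); lra.
by have := cos_le1 (2 * (s * U w)); lra.
Qed.

(** The frequency [a] stays general in the induction because multiplying by cos(2sU) shifts it to a
    + 2s and a - 2s. *)
Lemma mean_sin_cos0 m : forall a s : R,
  mean P (fun w => sin (a * U w) * (1 - cos (2 * (s * U w))) ^+ m) = 0.
Proof.
elim: m => [|m IH] a s.
  by under [X in mean P X]eq_fun do rewrite expr0 mulr1; exact: mean_sin0.
have e w : sin (a * U w) * (1 - cos (2 * (s * U w))) ^+ m.+1 =
  sin (a * U w) * (1 - cos (2 * (s * U w))) ^+ m -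
  (2^-1 * (sin ((a + 2 * s) * U w) * (1 - cos (2 * (s * U w))) ^+ m) +
   2^-1 * (sin ((a - 2 * s) * U w) * (1 - cos (2 * (s * U w))) ^+ m)).
  rewrite exprS (mulrDl a) (mulrBl _ a) -(mulrA 2) sinD sinB; lra.
under [X in mean P X]eq_fun do rewrite e.
have iT a1 := integrable_rvZ 2^-1 (bounded_trig a1 s m).
rewrite meanB//; last exact: integrable_rvD (iT _) (iT _).
rewrite meanD; [|exact: iT|exact: iT].
by rewrite !meanZ// !IH mulr0 addr0 subr0.
Qed.

(* sin^(2m+1) is a linear combination of sines, by 2 sin^2 x = 1 - cos(2x) and
   2 sin a cos b = sin(a + b) + sin(a - b). *)
Lemma mean_sin_odd0 m (s : R) : mean P (fun w => sin (s * U w) ^+ m.*2.+1) = 0.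
Proof.
have e w : sin (s * U w) ^+ m.*2.+1 =
    (2 ^+ m)^-1 * (sin (s * U w) * (1 - cos (2 * (s * U w))) ^+ m).
  have c0 : (2 : R) ^+ m != 0 by rewrite expf_neq0.
  by rewrite cos_half exprMn -exprM mul2n exprS; field.
under [X in mean P X]eq_fun do rewrite e.
by rewrite meanZ// mean_sin_cos0 mulr0.
Qed.

(* E (sin(sU)/s)^(2m+1) = 0 differs from the moment by O(s^2 E |U|^(2m+3)). *)
Lemma odd_moment0 m : integrable_rv P (fun w => `|U w| ^+ m.*2.+3) ->
  integrable_rv P (fun w => U w ^+ m.*2.+1) ->
  mean P (fun w => U w ^+ m.*2.+1) = 0.
Proof.
move=> i3 i1; set M := mean P _.
pose C := m.*2.+1%:R * mean P (fun w => `|U w| ^+ m.*2.+3).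
have C0 : 0 <= C by apply: mulr_ge0 => //; apply: mean_ge0 => w; rewrite exprn_ge0.
have key (s : R) : 0 < s -> `|M| <= C * s ^+ 2.
  move=> s0; have sN0 : s != 0 by rewrite gt_eqF.
  pose b w := sin (s * U w) / s.
  have mb : measurable_fun setT b.
    apply: measurable_funM => //; apply: measurableT_comp; last exact: measurable_funM.
    by apply: continuous_measurable_fun; exact: continuous_sin.
  have bU w : `|b w| <= `|U w|.
    rewrite normrM normfV ler_pdivrMr ?normr_gt0// mulrC -normrM; exact: norm_sin_le.
  have ib : integrable_rv P (fun w => b w ^+ m.*2.+1).
    apply: (integrable_rv_le (Y := fun w => `|U w ^+ m.*2.+1|)).
    - exact: measurable_funX.
    - by move=> w; rewrite !normrX lerXn2r ?nnegrE.
    - exact: integrable_rv_norm.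
  have Eb : mean P (fun w => b w ^+ m.*2.+1) = 0.
    have e w : b w ^+ m.*2.+1 = (s ^+ m.*2.+1)^-1 * sin (s * U w) ^+ m.*2.+1.
      by rewrite /b exprMn exprVn mulrC.
    under [X in mean P X]eq_fun do rewrite e.
    rewrite meanZ ?mean_sin_odd0 ?mulr0//.
    apply: (@integrable_rv_bounded _ _ _ P _ 1).
      apply: measurable_funX; apply: measurableT_comp; last exact: measurable_funM.
      by apply: continuous_measurable_fun; exact: continuous_sin.
    by move=> w; rewrite normrX exprn_ile1// sin_max.
  have -> : M = mean P (fun w => U w ^+ m.*2.+1 - b w ^+ m.*2.+1).
    by rewrite meanB// Eb subr0.
  have iD : integrable_rv P (fun w => U w ^+ m.*2.+1 - b w ^+ m.*2.+1) by exact: integrable_rvB.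
  apply: le_trans (le_normr_Rintegral _ iD) _ => //.
  rewrite /C mulrAC -meanZ//; apply: mean_le.
  - exact: integrable_rv_norm.
  - exact: integrable_rvZ.
  - move=> w; apply: le_trans (exprB_le _ (bU w)) _.
    have h : `|U w - b w| <= s ^+ 2 * `|U w| ^+ 3.
      have := sin_approx (s * U w).
      have -> : U w - b w = (s * U w - sin (s * U w)) / s by rewrite /b; field.
      rewrite [`|_ / s|]normrM normfV (gtr0_norm s0) ler_pdivrMr// => h.
      apply: le_trans h _; rewrite normrM (gtr0_norm s0) exprMn.
      by rewrite (_ : s ^+ 3 * _ = s ^+ 2 * `|U w| ^+ 3 * s) //; ring.
    have -> : m.*2.+1%:R * s ^+ 2 * `|U w| ^+ m.*2.+3 =
       m.*2.+1%:R * (s ^+ 2 * `|U w| ^+ 3) * `|U w| ^+ m.*2.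
      by rewrite -[m.*2.+3]add3n exprD; ring.
    by apply: ler_wpM2r; [exact: exprn_ge0|apply: ler_wpM2l].
apply/eqP; rewrite -normr_le0 leNgt; apply/negP => M0.
(* Then C s^2 <= C s <= |M| / 2, which contradicts [key] when M is nonzero. *)
pose s := Num.min 1 (`|M| / (2 * (C + 1))).
have s0 : 0 < s by rewrite lt_min ltr01 divr_gt0// mulr_gt0// ltr_wpDl.
have s1 : s <= 1 by rewrite ge_min lexx.
have s2 : s * (2 * (C + 1)) <= `|M|.
  by rewrite -ler_pdivlMr ?mulr_gt0 ?ltr_wpDl// ge_min lexx orbT.
have := key s s0; nra.
Qed.

End ErrorMoments.

(** * Averages of noisy increments *)

Section WeightedPairAverage.
Context {R : realType} {d : measure_display} {Omega : measurableType d}.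
Variable P : probability Omega R.
Variables (GX GU : set (set Omega)).
Hypotheses (indXU : indep_systems P <<s GX >> <<s GU >>)
  (mGX : GX `<=` measurable) (mGU : GU `<=` measurable).
Variables (n : nat) (t : nat -> R) (xi : R) (M : nat).
Hypothesis NM : forall j, (j <= n)%N -> (N_ n t xi j <= M)%N.
Variables (W G : nat -> nat -> Omega -> R) (C : R).
Hypothesis C0 : 0 <= C.
Hypothesis mW : forall j l, (j <= n)%N -> (l <= n)%N ->
  measurable_fun (setT : set (g_sigma_algebraType GX)) (W j l).
Hypothesis bW : forall j l, (j <= n)%N -> (l <= n)%N ->
  exists K : R, forall w, `|W j l w| <= K.
Hypothesis mG : forall j l, (j <= n)%N -> (l <= n)%N ->
  measurable_fun (setT : set (g_sigma_algebraType GU)) (G j l).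
Hypothesis iG : forall j l, (j <= n)%N -> (l <= n)%N -> l != j ->
  integrable_rv P (fun w => G j l w ^+ 2) /\ mean P (fun w => G j l w ^+ 2) <= C.
Hypothesis covG : forall j l j' l', (j <= n)%N -> (l <= n)%N -> (j' <= n)%N -> (l' <= n)%N ->
  l != j -> l' != j' -> j != j' -> j != l' -> l != j' -> l != l' ->
  mean P (fun w => G j l w * G j' l' w) = 0.

Local Notation pr := ('I_n.+1 * 'I_n.+1)%type.
Let Q (p : pr) := p.2 \in S_ n t xi p.1.
Let Wp (p : pr) := W p.1 p.2.
Let Gp (p : pr) := G p.1 p.2.
Let linked (p q : pr) := [|| q.1 == p.1, q.1 == p.2, q.2 == p.1 | q.2 == p.2].

Let leP (i : 'I_n.+1) : (i <= n)%N. Proof. by rewrite -ltnS ltn_ord. Qed.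

Let Q_neq p : Q p -> (p.2 != p.1 :> nat).
Proof. by rewrite /Q inE => /andP[]. Qed.

Let mWp p : measurable_fun setT (Wp p).
Proof. by apply: measurable_rv_sub (mW _ _). Qed.

Let mGp p : measurable_fun setT (Gp p).
Proof. by apply: measurable_rv_sub (mG _ _). Qed.

Let iWW p q : integrable_rv P (fun w => Wp p w * Wp q w).
Proof.
have [K hK] := bW (leP p.1) (leP p.2); have [L hL] := bW (leP q.1) (leP q.2).
apply: (@integrable_rv_bounded _ _ _ P _ (K * L)); first exact: measurable_funM.
by move=> w; rewrite normrM; apply: ler_pM; rewrite ?normr_ge0 ?hK ?hL.
Qed.

Let prod_le_sqr (a b : R) : `|a * b| <= 2^-1 * a ^+ 2 + 2^-1 * b ^+ 2.
Proof.
by rewrite ler_norml; apply/andP; split; [have := sqr_ge0 (a + b)|have := sqr_ge0 (a - b)]; lra.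
Qed.

Let iGG p q : Q p -> Q q -> integrable_rv P (fun w => Gp p w * Gp q w).
Proof.
move=> /Q_neq Qp /Q_neq Qq.
have [ip _] := iG (leP p.1) (leP p.2) Qp; have [iq _] := iG (leP q.1) (leP q.2) Qq.
apply: (integrable_rv_le (Y := fun w => 2^-1 * Gp p w ^+ 2 + 2^-1 * Gp q w ^+ 2)).
- exact: measurable_funM.
- by move=> w; exact: prod_le_sqr.
- by apply: integrable_rvD; exact: integrable_rvZ.
Qed.

Let term p q w := (Wp p w * Wp q w) * (Gp p w * Gp q w).

(** Weights and noise are independent, so the mean factors. For pairs without a common index the
    noise factor vanishes by [covG]; otherwise |ab| <= (a^2 + b^2) / 2 is applied to both factors,
    the one for the noise being at most [C]. *)
Let mean_term p q : Q p -> Q q -> integrable_rv P (term p q) /\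
  mean P (term p q) <= (linked p q)%:R * (C * (2^-1 * mean P (fun w => Wp p w ^+ 2) +
     2^-1 * mean P (fun w => Wp q w ^+ 2))).
Proof.
move=> Qp Qq.
have mWW : measurable_fun (setT : set (g_sigma_algebraType GX)) (fun w => Wp p w * Wp q w).
  by apply: measurable_funM; exact: mW.
have mGG : measurable_fun (setT : set (g_sigma_algebraType GU)) (fun w => Gp p w * Gp q w).
  by apply: measurable_funM; exact: mG.
have [iT ET] := mean_indepM indXU mGX mGU mWW mGG (iWW p q) (iGG Qp Qq).
split => //; rewrite /term ET.
have iW2 r : integrable_rv P (fun w => Wp r w ^+ 2) by exact: (iWW r r).
have [nlk|lk] := boolP (~~ linked p q).
  rewrite (negbTE nlk) mul0r; move: nlk; rewrite /linked !negb_or => /and4P[h1 h2 h3 h4].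
  by rewrite covG ?mulr0//; do ?[exact: Q_neq]; rewrite eq_sym.
rewrite negbK in lk; rewrite lk mul1r mulrC.
have [ip Ep] := iG (leP p.1) (leP p.2) (Q_neq Qp).
have [iq Eq] := iG (leP q.1) (leP q.2) (Q_neq Qq).
apply: le_trans (ler_norm _) _; rewrite normrM; apply: ler_pM => //.
  apply: le_trans (le_normr_Rintegral _ (iGG Qp Qq)) _ => //.
  apply: (@le_trans _ _ (mean P (fun w => 2^-1 * Gp p w ^+ 2 + 2^-1 * Gp q w ^+ 2))).
    apply: mean_le => //.
    - exact: integrable_rv_norm (iGG Qp Qq).
    - by apply: integrable_rvD; exact: integrable_rvZ.
  rewrite meanD; [|exact: integrable_rvZ|exact: integrable_rvZ].
  rewrite !meanZ//.
  have -> : C = 2^-1 * C + 2^-1 * C by lra.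
  by apply: lerD; apply: ler_wpM2l.
apply: le_trans (le_normr_Rintegral _ (iWW p q)) _ => //.
rewrite -!meanZ// -meanD; [|exact: integrable_rvZ|exact: integrable_rvZ].
apply: mean_le.
- exact: integrable_rv_norm (iWW p q).
- by apply: integrable_rvD; exact: integrable_rvZ.
- by move=> w; exact: prod_le_sqr.
Qed.

Let S_sym (i j : 'I_n.+1) : (i \in S_ n t xi j) = (j \in S_ n t xi i).
Proof. by rewrite !inE distrC eq_sym. Qed.

(** Exactly [N_ i] pairs have [i] in first position and, neighbourhood being symmetric, as many in
    second position. The two indices of [p] give four such families. *)
Let card_linked p : \sum_(q | Q q) (linked p q)%:R <= (4 * M)%:R :> R.
Proof.
rewrite -natr_sum ler_nat.
have row (i : 'I_n.+1) : (\sum_(q | Q q) (q.1 == i) = N_ n t xi i)%N.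
  rewrite -(pair_big_dep xpredT (fun j l : 'I_n.+1 => l \in S_ n t xi j)
    (fun j l : 'I_n.+1 => nat_of_bool (j == i)))/=.
  rewrite (bigD1 i)//= eqxx sum1_card big1 ?addn0// => j /negbTE ->.
  by rewrite big1.
have col (i : 'I_n.+1) : (\sum_(q | Q q) (q.2 == i) = N_ n t xi i)%N.
  rewrite -row (reindex_inj (h := fun q : pr => (q.2, q.1)))/=;
    last by move=> [a b] [a' b'] [-> ->].
  by apply: eq_bigl => q; rewrite /Q/= S_sym.
apply: (@leq_trans (\sum_(q | Q q) (((q.1 == p.1) + (q.1 == p.2)) +
    ((q.2 == p.1) + (q.2 == p.2))))%N).
  by apply: leq_sum => q _; rewrite /linked; do 4 case: (_ == _).
rewrite !big_split/= !row !col.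
have := NM (leP p.1); have := NM (leP p.2); lia.
Qed.

(* By AM-GM on the weights, only linked pairs contribute, and each pair is linked
   to at most 4M others. *)
Lemma mean_weighted_pair_avg_sqr :
  integrable_rv P (fun w => pair_avg n t xi (fun j l => W j l w * G j l w) ^+ 2) /\
  mean P (fun w => pair_avg n t xi (fun j l => W j l w * G j l w) ^+ 2) <=
  C * (4 * M)%:R / (N_total n t xi)%:R *
    pair_avg n t xi (fun j l => mean P (fun w => W j l w ^+ 2)).
Proof.
pose N : R := (N_total n t xi)%:R.
have avgE f : pair_avg n t xi f = N^-1 * \sum_(p | Q p) f p.1 p.2.
  by rewrite /pair_avg (pair_big_dep xpredT (fun j l : 'I_n.+1 => l \in S_ n t xi j) (fun j l : 'I_n.+1 => f j l)).
have sqE w : pair_avg n t xi (fun j l => W j l w * G j l w) ^+ 2 =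
    N^-1 ^+ 2 * \sum_(p | Q p) \sum_(q | Q q) term p q w.
  rewrite avgE exprMn; congr (_ * _); rewrite expr2 mulr_suml.
  apply: eq_bigr => p _; rewrite mulr_sumr; apply: eq_bigr => q _.
  by rewrite /term /Wp /Gp; ring.
have iS : integrable_rv P (fun w => \sum_(p | Q p) \sum_(q | Q q) term p q w).
  apply: integrable_rv_sum => p Qp; apply: integrable_rv_sum => q Qq.
  by have [] := mean_term Qp Qq.
under eq_fun do rewrite sqE; split; first exact: integrable_rvZ.
rewrite meanZ// mean_sum; last first.
  by move=> p Qp; apply: integrable_rv_sum => q Qq; have [] := mean_term Qp Qq.
pose v p := mean P (fun w => Wp p w ^+ 2).
have v0 p : 0 <= v p by apply: mean_ge0 => w; exact: sqr_ge0.
have -> : C * (4 * M)%:R / (N_total n t xi)%:R *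
    pair_avg n t xi (fun j l => mean P (fun w => W j l w ^+ 2))
    = N^-1 ^+ 2 * (C * (4 * M)%:R * \sum_(p | Q p) v p).
  by rewrite avgE -/N /v /Wp; ring.
apply: ler_wpM2l; first exact: sqr_ge0.
have symL p q : linked p q = linked q p.
  rewrite /linked ![q.1 == _]eq_sym ![q.2 == _]eq_sym.
  by do 4 case: (_ == _).
apply: (@le_trans _ _ (\sum_(p | Q p) \sum_(q | Q q)
   (linked p q)%:R * (C * (2^-1 * v p + 2^-1 * v q)))).
  apply: ler_sum => p Qp; rewrite mean_sum; last by move=> q Qq; have [] := mean_term Qp Qq.
  by apply: ler_sum => q Qq; have [] := mean_term Qp Qq.
(* Exchanging the roles of [p] and [q] shows that the two halves agree, so each [v p] is counted
   once for every pair linked to [p]. *)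
have -> : \sum_(p | Q p) \sum_(q | Q q) (linked p q)%:R * (C * (2^-1 * v p + 2^-1 * v q)) =
   \sum_(p | Q p) C * v p * \sum_(q | Q q) (linked p q)%:R.
  have e1 : \sum_(p | Q p) \sum_(q | Q q) (linked p q)%:R * (C * (2^-1 * v p + 2^-1 * v q)) =
     \sum_(p | Q p) \sum_(q | Q q) (linked p q)%:R * (C * 2^-1 * v p) +
     \sum_(p | Q p) \sum_(q | Q q) (linked p q)%:R * (C * 2^-1 * v q).
    rewrite -big_split; apply: eq_bigr => p _; rewrite -big_split; apply: eq_bigr => q _ /=.
    by ring.
  have e2 : \sum_(p | Q p) \sum_(q | Q q) (linked p q)%:R * (C * 2^-1 * v q) =
     \sum_(p | Q p) \sum_(q | Q q) (linked p q)%:R * (C * 2^-1 * v p).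
    rewrite exchange_big/=; apply: eq_bigr => p _; apply: eq_bigr => q _.
    by rewrite symL.
  rewrite e1 e2 -big_split; apply: eq_bigr => p _ /=.
  rewrite -mulr_suml; set s := \sum_(q | Q q) _; lra.
rewrite mulr_sumr; apply: ler_sum => p _.
rewrite [leRHS]mulrAC; apply: ler_wpM2l; last exact: card_linked.
exact: mulr_ge0.
Qed.

End WeightedPairAverage.

(** * The moment recursion and the moments of error differences *)

Section MomentRecursion.
Context {R : realType}.
Implicit Types a b : nat -> R.

(** With [dlt] at most 1, products of two errors are again of order [dlt]. The constant depends on
    the limit [b] and not on [a], which is random in the application. *)
Lemma moment_rec_lipschitz b (K : R) k : 0 <= K -> exists2 C : R, 0 <= C &
  forall a (dlt : R), 0 <= dlt <= 1 ->
  (forall j, (1 <= j <= k)%N -> `|a j - b j| <= K * dlt) ->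
  forall j, (1 <= j <= k)%N -> `|moment_rec a j - moment_rec b j| <= C * dlt.
Proof.
move=> K0; elim: k => [|k [C C0 IH]].
  by exists 0 => // a dlt _ _ j /andP[j1]; rewrite leqn0 => /eqP j0; rewrite j0 in j1.
(* Read off from x y - x0 y0 = (x - x0) (y0 + (y - y0)) + x0 (y - y0), where both errors are at most
   C dlt and, inside the bracket, at most C. *)
pose D := \sum_(1 <= j < k.+1) 'C(2 * k.+1, 2 * j)%:R *
  (C * (`|moment_rec b (k.+1 - j)| + C) + `|moment_rec b j| * C).
have D0 : 0 <= D.
  apply: sumr_ge0 => j _; apply: mulr_ge0 => //.
  by apply: addr_ge0; apply: mulr_ge0 => //; exact: addr_ge0.
exists (C + (K + D)); first by rewrite !addr_ge0.
move=> a dlt /andP[d0 d1] ab.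
have d01 : 0 <= dlt <= 1 by rewrite d0.
have abk j : (1 <= j <= k)%N -> `|a j - b j| <= K * dlt.
  by move=> /andP[j1 jk]; apply: ab; rewrite j1 leqW.
have {}IH := IH a dlt d01 abk.
move=> j /andP[j1]; rewrite leq_eqVlt => /predU1P[->|jk]; last first.
  apply: le_trans (IH j _) _; first by rewrite j1.
  by apply: ler_wpM2r => //; rewrite lerDl addr_ge0.
rewrite !moment_recE//.
set Sa := \sum_(1 <= _ < _) _; set Sb := \sum_(1 <= _ < _) _.
have SD : `|Sa - Sb| <= D * dlt.
  rewrite /Sa /Sb -sumrB /D mulr_suml; apply: le_trans (ler_norm_sum _ _ _) _.
  rewrite !big_nat; apply: ler_sum => i /andP[i1 ik].
  rewrite -!mulrA -mulrBr normrM ger0_norm//; apply: ler_wpM2l => //.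
  have hx := IH i; have hy := IH (k.+1 - i)%N.
  have {}hx : `|moment_rec a i - moment_rec b i| <= C * dlt by apply: hx; rewrite i1 -ltnS.
  have {}hy : `|moment_rec a (k.+1 - i) - moment_rec b (k.+1 - i)| <= C * dlt.
    by apply: hy; lia.
  set x := moment_rec a i in hx *; set x0 := moment_rec b i in hx *.
  set y := moment_rec a (k.+1 - i) in hy *; set y0 := moment_rec b (k.+1 - i) in hy *.
  have -> : x * y - x0 * y0 = (x - x0) * (y0 + (y - y0)) + x0 * (y - y0) by ring.
  apply: le_trans (ler_normD _ _) _; rewrite !normrM mulrDl; apply: lerD; last first.
    by rewrite -mulrA; apply: ler_wpM2l.
  rewrite -mulrA [(_ + C) * _]mulrC mulrA; apply: ler_pM => //.
  apply: le_trans (ler_normD _ _) _; apply: lerD => //.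
  apply: le_trans hy _; exact: ler_piMr.
have -> : 2^-1 * (a k.+1 - Sa) - 2^-1 * (b k.+1 - Sb) =
  2^-1 * ((a k.+1 - b k.+1) - (Sa - Sb)) by ring.
have h1 : `|a k.+1 - b k.+1| <= K * dlt by apply: ab; rewrite ltnS leqnn.
rewrite normrM ger0_norm//.
have h2 := ler_normB (a k.+1 - b k.+1) (Sa - Sb).
have h3 : 0 <= C * dlt by exact: mulr_ge0.
have := normr_ge0 (a k.+1 - b k.+1); have := normr_ge0 (Sa - Sb).
rewrite !mulrDl; lra.
Qed.

Lemma moment_rec_solution a (m : nat -> R) k :
  (forall j, (1 <= j <= k)%N -> a j = 2 * m j +
    \sum_(1 <= i < j) 'C(2 * j, 2 * i)%:R * m i * m (j - i)%N) ->
  forall j, (1 <= j <= k)%N -> moment_rec a j = m j.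
Proof.
move=> am; elim/ltn_ind => j IH /andP[j1 jk].
rewrite moment_recE// am ?j1//.
rewrite [X in _ - X](_ : _ = \sum_(1 <= i < j) 'C(2 * j, 2 * i)%:R * m i * m (j - i)%N).
  by rewrite addrK mulrA mulVf ?mul1r.
apply: eq_big_nat => i /andP[i1 ij]; rewrite IH; [|lia|lia].
by rewrite IH //; lia.
Qed.

End MomentRecursion.

Section ErrorDifferences.
Context {R : realType} {d : measure_display} {Omega : measurableType d}.
Variable P : probability Omega R.
Variables (U0 : {RV P >-> R}) (n : nat) (V : nat -> {RV P >-> R}) (q : nat).
Hypothesis indV : mutually_independent P n.+1 (fun j => V j : Omega -> R).
Hypothesis lawV : forall j, (j <= n)%N -> forall A, measurable A ->
  distribution P U0 A = distribution P (V j) A.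
Hypothesis iU : forall a, (a <= q)%N -> integrable_rv P (fun w => `|U0 w| ^+ a).

Definition moment (a : nat) : R := mean P (fun w => U0 w ^+ a).

(** The moment of order [a] of the difference of two independent copies of [U0], expanded binomially
    so that no second copy has to be introduced. *)
Definition difference_moment (a : nat) : R :=
  \sum_(i < a.+1) ((-1) ^+ i * moment (a - i) * moment i) *+ 'C(a, i).

Let mV j : (j < n.+1)%N -> measurable_fun setT (V j : Omega -> R).
Proof. by move=> _; exact: measurable_funP. Qed.

Let mX (a : nat) : measurable_fun setT (fun x : R => x ^+ a).
Proof. exact: measurable_funX. Qed.

Lemma integrable_moment a : (a <= q)%N -> integrable_rv P (fun w => U0 w ^+ a).
Proof.
move=> aq; apply: integrable_rv_le (iU aq); first exact: measurable_funX.
by move=> w; rewrite normrX.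
Qed.

Let iV j a : (j <= n)%N -> (a <= q)%N -> integrable_rv P (fun w => V j w ^+ a).
Proof. by move=> jn aq; exact: (integrable_rv_eq_law (lawV jn) (mX a) (integrable_moment aq)). Qed.

Let EV j a : (j <= n)%N -> (a <= q)%N -> mean P (fun w => V j w ^+ a) = moment a.
Proof.
by move=> jn aq; apply/esym; exact: (mean_eq_law (lawV jn) (mX a) (integrable_moment aq)). Qed.

Lemma mean_pow_mul j l a b : (j <= n)%N -> (l <= n)%N -> l != j -> (a <= q)%N -> (b <= q)%N ->
  integrable_rv P (fun w => V l w ^+ a * V j w ^+ b) /\
  mean P (fun w => V l w ^+ a * V j w ^+ b) = moment a * moment b.
Proof.
move=> jn ln lj aq bq; rewrite -(EV ln aq) -(EV jn bq).
have disj : [set l] `&` [set j] = set0 :> set nat.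
  by rewrite -subset0 => i [/= -> lj']; move: lj; rewrite lj' eqxx.
apply: (mean_indepM (indep_cylinders mV indV disj)).
- exact: cylinders_measurable.
- exact: cylinders_measurable.
- by apply: measurable_funX; apply: measurable_cylinders; rewrite ?ltnS.
- by apply: measurable_funX; apply: measurable_cylinders; rewrite ?ltnS.
- exact: iV.
- exact: iV.
Qed.

Lemma mean_difference_pow j l a : (j <= n)%N -> (l <= n)%N -> l != j -> (a <= q)%N ->
  integrable_rv P (fun w => (V l w - V j w) ^+ a) /\
  mean P (fun w => (V l w - V j w) ^+ a) = difference_moment a.
Proof.
move=> jn ln lj aq.
have e w : (V l w - V j w) ^+ a =
    \sum_(i < a.+1) ((-1) ^+ i *+ 'C(a, i)) * (V l w ^+ (a - i) * V j w ^+ i).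
  by rewrite exprBn; apply: eq_bigr => i _; rewrite mulrnAl mulrA.
have h (i : 'I_a.+1) : integrable_rv P (fun w => V l w ^+ (a - i) * V j w ^+ i) /\
  mean P (fun w => V l w ^+ (a - i) * V j w ^+ i) = moment (a - i) * moment i.
  apply: mean_pow_mul => //; first by rewrite (leq_trans (leq_subr _ _)).
  by rewrite (leq_trans _ aq)// -ltnS.
under eq_fun do rewrite e; split.
  by apply: integrable_rv_sum => i _; apply: integrable_rvZ; have [] := h i.
rewrite mean_sum => [|i _]; last by apply: integrable_rvZ; have [] := h i.
apply: eq_bigr => i _; have [hi Ei] := h i.
by rewrite meanZ// Ei mulrnAl mulrA.
Qed.

Lemma mean_difference_indep (g : R -> R) j l j' l' :
  (j <= n)%N -> (l <= n)%N -> (j' <= n)%N -> (l' <= n)%N ->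
  j != j' -> j != l' -> l != j' -> l != l' -> measurable_fun setT g ->
  integrable_rv P (fun w => g (V l w - V j w)) ->
  integrable_rv P (fun w => g (V l' w - V j' w)) ->
  mean P (fun w => g (V l w - V j w) * g (V l' w - V j' w)) =
  mean P (fun w => g (V l w - V j w)) * mean P (fun w => g (V l' w - V j' w)).
Proof.
move=> jn ln jn' ln' h1 h2 h3 h4 mg i1 i2.
have disj : [set j; l] `&` [set j'; l'] = set0 :> set nat.
  rewrite -subset0 => i [/= [->|->] [e|e]];
  by [move: h1; rewrite e eqxx|move: h2; rewrite e eqxx|
      move: h3; rewrite e eqxx|move: h4; rewrite e eqxx].
have mc D a b : (a <= n)%N -> (b <= n)%N -> D a -> D b ->
    measurable_fun (setT : set (g_sigma_algebraType (cylinders n.+1 (fun j => V j : Omega -> R) D)))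
      (fun w => g (V b w - V a w)).
  move=> an bn Da Db; apply: measurableT_comp mg _.
  by apply: measurable_funB; apply: measurable_cylinders; rewrite ?ltnS.
have m1 := mc [set j; l] j l jn ln (or_introl erefl) (or_intror erefl).
have m2 := mc [set j'; l'] j' l' jn' ln' (or_introl erefl) (or_intror erefl).
have cm (D : set nat) : cylinders n.+1 (fun j => V j : Omega -> R) D `<=` measurable.
  exact: cylinders_measurable.
by have [] := mean_indepM (indep_cylinders mV indV disj) (cm _) (cm _) m1 m2 i1 i2.
Qed.

Lemma moment0 : moment 0 = 1.
Proof.
by rewrite /moment -[RHS](mean_cst P); apply: eq_Rintegral => w _; rewrite expr0.
Qed.

(** In each binomial term one of the exponents [i] and [a - i] is odd. *)
Lemma difference_moment_odd a : odd a ->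
  (forall i, odd i -> (i <= a)%N -> moment i = 0) -> difference_moment a = 0.
Proof.
move=> oa m0; apply: big1 => i _; have ia : (i <= a)%N by rewrite -ltnS ltn_ord.
have [oi|ei] := boolP (odd i); first by rewrite (m0 i)// mulr0 mul0rn.
rewrite (m0 (a - i)%N) ?leq_subr//; first by rewrite mulr0 mul0r mul0rn.
by rewrite oddB// oa (negbTE ei).
Qed.

(** The terms of odd index vanish, and the two extreme ones give the factor 2 since the moment of
    order 0 is 1. This is the relation that [moment_rec] inverts. *)
Lemma difference_moment_even j : (1 <= j)%N ->
  (forall i, odd i -> (i <= 2 * j)%N -> moment i = 0) ->
  difference_moment (2 * j) = 2 * moment (2 * j) +
    \sum_(1 <= i < j) 'C(2 * j, 2 * i)%:R * moment (2 * i) * moment (2 * (j - i)).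
Proof.
move=> j1 m0.
have evens (f : nat -> R) m : (forall i, odd i -> (i <= 2 * m)%N -> f i = 0) ->
    \sum_(i < (2 * m).+1) f i = \sum_(i < m.+1) f (2 * i)%N.
  elim: m => [|m IH] f0; first by rewrite !big_ord_recl !big_ord0.
  have -> : (2 * m.+1).+1 = (2 * m).+3 by lia.
  rewrite 2!big_ord_recr [RHS]big_ord_recr /= IH => [|i oi im]; last by apply: f0 => //; lia.
  rewrite (f0 (2 * m).+1) ?addr0; [|by rewrite /= oddM|by lia].
  by congr (_ + f _); lia.
pose f i := ((-1) ^+ i * moment (2 * j - i) * moment i) *+ 'C(2 * j, i).
rewrite /difference_moment (evens f) => [|i oi ij]; last first.
  by rewrite /f (m0 i)// mulr0 mul0rn.
have fE i : f (2 * i)%N = 'C(2 * j, 2 * i)%:R * moment (2 * i) * moment (2 * (j - i)).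
  by rewrite /f exprM sqrrN !expr1n mul1r mulnBr -mulr_natl; ring.
rewrite -(big_mkord xpredT (fun i => f (2 * i)%N)) big_nat_recr//= big_ltn//.
rewrite muln0 fE subnn muln0 moment0 binn mulr1 mul1r.
rewrite (_ : f 0 = moment (2 * j)); last first.
  by rewrite /f expr0 mul1r subn0 moment0 mulr1 bin0.
rewrite addrAC mulrDl !mul1r; congr (_ + _).
by apply: eq_bigr => i _; rewrite fE.
Qed.

End ErrorDifferences.

Section NoisyPowers.
Context {R : realType}.
Implicit Types a b : R.

(** A Taylor bound quadratic in [a], by induction on [m]. The base 1 + |a| + |b| dominates [b] and
    [a + b], and being at least 1 it absorbs lower powers; the constant closes through m^2 + m <= (m
    + 1)^2. At [m = 0] the factor [m%:R] kills the linear term. *)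
Lemma exprD_remainder a b m :
  `|(a + b) ^+ m - b ^+ m - m%:R * a * b ^+ m.-1| <=
  m%:R ^+ 2 * a ^+ 2 * (1 + `|a| + `|b|) ^+ m.
Proof.
set c := 1 + _ + _.
have c1 : 1 <= c by rewrite /c -addrA lerDl addr_ge0.
have c0 : 0 <= c by exact: le_trans c1.
have abc : `|a + b| <= c.
  by apply: le_trans (ler_normD _ _) _; rewrite /c -addrA lerDr.
have bc : `|b| <= c by rewrite /c lerDr addr_ge0.
elim: m => [|m IH]; first by rewrite !expr0 !mul0r subrr subr0 normr0 expr0n mul0r.
have -> : (a + b) ^+ m.+1 - b ^+ m.+1 - m.+1%:R * a * b ^+ m.+1.-1 =
    (a + b) * ((a + b) ^+ m - b ^+ m - m%:R * a * b ^+ m.-1) + m%:R * a ^+ 2 * b ^+ m.-1.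
  case: m {IH} => [|m]; first by rewrite !expr0 !expr1 /=; ring.
  by rewrite /= -[m.+2%:R]natr1 !exprS; ring.
apply: le_trans (ler_normD _ _) _; rewrite [`|(a + b) * _|]normrM.
have h1 : `|a + b| * `|(a + b) ^+ m - b ^+ m - m%:R * a * b ^+ m.-1| <=
    m%:R ^+ 2 * a ^+ 2 * c ^+ m.+1.
  rewrite [c ^+ m.+1]exprS mulrCA; apply: ler_pM => //.
have h2 : `|m%:R * a ^+ 2 * b ^+ m.-1| <= m%:R * a ^+ 2 * c ^+ m.+1.
  rewrite normrM [`|m%:R * _|]normrM normr_nat [`|a ^+ 2|]ger0_norm ?sqr_ge0// normrX.
  apply: ler_wpM2l; first by rewrite mulr_ge0 ?sqr_ge0.
  apply: (@le_trans _ _ (c ^+ m.-1)); first by rewrite lerXn2r// nnegrE.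
  by apply: ler_weXn2l => //; lia.
have h3 : 0 <= a ^+ 2 * c ^+ m.+1 by rewrite mulr_ge0 ?sqr_ge0 ?exprn_ge0.
have h4 : 0 <= m%:R :> R by [].
apply: le_trans (lerD h1 h2) _.
have -> : m%:R ^+ 2 * a ^+ 2 * c ^+ m.+1 + m%:R * a ^+ 2 * c ^+ m.+1 =
  (m%:R ^+ 2 + m%:R) * (a ^+ 2 * c ^+ m.+1) by ring.
rewrite -[leRHS]mulrA; apply: ler_wpM2r => //.
by rewrite -natr1; nra.
Qed.

Lemma exprD_le a b m : 0 <= a -> 0 <= b -> (a + b) ^+ m <= 2 ^+ m * (a ^+ m + b ^+ m).
Proof.
move=> a0 b0; have [ab|ba] := leP a b.
  apply: (@le_trans _ _ ((2 * b) ^+ m)); first by rewrite lerXn2r ?nnegrE ?addr_ge0 ?mulr_ge0//; lra.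
  by rewrite exprMn ler_wpM2l ?exprn_ge0// lerDr exprn_ge0.
apply: (@le_trans _ _ ((2 * a) ^+ m)); first by rewrite lerXn2r ?nnegrE ?addr_ge0 ?mulr_ge0//; lra.
by rewrite exprMn ler_wpM2l ?exprn_ge0// lerDl exprn_ge0.
Qed.

End NoisyPowers.

Section NoisyPairAverage.
Context {R : realType} {d : measure_display} {Omega : measurableType d}.
Variable P : probability Omega R.
Variables (GX GU : set (set Omega)).
Hypotheses (indXU : indep_systems P <<s GX >> <<s GU >>)
  (mGX : GX `<=` measurable) (mGU : GU `<=` measurable).
Variables (n : nat) (t : nat -> R) (xi : R) (M : nat).
Hypotheses (NM : forall j, (j <= n)%N -> (N_ n t xi j <= M)%N) (N0 : (0 < N_total n t xi)%N).
Variables (U0 : {RV P >-> R}) (V : nat -> {RV P >-> R}) (k : nat).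
Hypothesis indV : mutually_independent P n.+1 (fun j => V j : Omega -> R).
Hypothesis lawV : forall j, (j <= n)%N -> forall A, measurable A ->
  distribution P U0 A = distribution P (V j) A.
Hypothesis iU : forall a, (a <= 4 * k)%N -> integrable_rv P (fun w => `|U0 w| ^+ a).
Hypothesis oddU : forall i, odd i -> (i <= 2 * k)%N -> moment U0 i = 0.
Hypothesis mV : forall j, (j <= n)%N ->
  measurable_fun (setT : set (g_sigma_algebraType GU)) (V j : Omega -> R).
Variable x : nat -> Omega -> R.
Hypothesis mx : forall j, (j <= n)%N ->
  measurable_fun (setT : set (g_sigma_algebraType GX)) (x j).
Variables (A kappa : R).
Hypotheses (A0 : 0 <= A) (kappa0 : 0 <= kappa).
Variable k' : nat.
Hypotheses (k1 : (1 <= k')%N) (kk : (k' <= k)%N).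

Let m := (2 * k')%N.
Let dm := difference_moment U0.
Let avg := pair_avg n t xi.
Let N : R := (N_total n t xi)%:R.
(** An event determined by [x] alone. Cutting the increments off outside it makes the weights [W]
    bounded with a small mean square, and leaves them independent of the errors. *)
Let good := [set w | avg (fun j l => (x l w - x j w) ^+ 2) <= kappa] `&`
  \bigcap_(j in [set j | (j <= n)%N]) [set w | `|x j w| <= A].
Let W j l w := (x l w - x j w) * \1_good w.

Let mgood : measurable (good : set (g_sigma_algebraType GX)).
Proof.
apply: measurableI.
  rewrite -[X in measurable X]setTI; apply: measurable_fun_ler => //.
  apply: measurable_pair_avg => j l jn ln.
  by apply: measurable_funX; apply: measurable_funB; exact: mx.
apply: bigcap_measurableType => j /= jn.
rewrite -[X in measurable X]setTI; apply: measurable_fun_ler => //.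
by apply: measurableT_comp => //; exact: mx.
Qed.

Let mW j l : (j <= n)%N -> (l <= n)%N ->
  measurable_fun (setT : set (g_sigma_algebraType GX)) (W j l).
Proof.
move=> jn ln; apply: measurable_funM; last exact: measurable_indic.
by apply: measurable_funB; exact: mx.
Qed.

Let W_le j l w : (j <= n)%N -> (l <= n)%N -> `|W j l w| <= 2 * A.
Proof.
move=> jn ln; rewrite /W indicE; have [/set_mem [_ gw]|_] := boolP (w \in good); last first.
  by rewrite mulr0 normr0 mulr_ge0.
rewrite mulr1; apply: le_trans (ler_normB _ _) _.
have := gw j jn; have := gw l ln => /=; lra.
Qed.

Let iW2 j l : (j <= n)%N -> (l <= n)%N -> integrable_rv P (fun w => W j l w ^+ 2).
Proof.
move=> jn ln; apply: (@integrable_rv_bounded _ _ _ P _ ((2 * A) ^+ 2)).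
  apply: measurable_funX; exact: measurable_rv_sub (mW jn ln).
by move=> w; rewrite normrX lerXn2r ?nnegrE ?W_le// mulr_ge0.
Qed.

Let avgW2 : avg (fun j l => mean P (fun w => W j l w ^+ 2)) <= kappa.
Proof.
rewrite /avg -mean_pair_avg// -[leRHS](mean_cst P); apply: mean_le.
- exact: integrable_pair_avg.
- exact: integrable_rv_cst.
- move=> w; rewrite /W indicE; have [/set_mem [gw _]|_] := boolP (w \in good).
    by under eq_pair_avg => j l _ _ _ _ do rewrite mulr1; exact: gw.
  rewrite (@eq_pair_avg _ _ _ _ _ (fun _ _ => 0)) ?pair_avg_cst//.
  by move=> j l _ _ _ _; rewrite mulr0 expr0n.
Qed.

Let iD a j l : (j <= n)%N -> (l <= n)%N -> l != j -> (a <= 4 * k)%N ->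
  integrable_rv P (fun w => (V l w - V j w) ^+ a) /\
  mean P (fun w => (V l w - V j w) ^+ a) = dm a.
Proof. exact: mean_difference_pow. Qed.

Let mD a j l : (j <= n)%N -> (l <= n)%N ->
  measurable_fun (setT : set (g_sigma_algebraType GU)) (fun w => (V l w - V j w) ^+ a).
Proof.
by move=> jn ln; apply: measurable_funX; apply: measurable_funB; exact: mV.
Qed.

(** The weights are constantly 1, and the constant is the variance of the [m]-th power of an error
    difference; the absolute value makes its sign evident. *)
Lemma noise_average :
  let S w := avg (fun j l => (V l w - V j w) ^+ m - dm m) in
  integrable_rv P (fun w => S w ^+ 2) /\
  mean P (fun w => S w ^+ 2) <= `|dm (m + m) - dm m ^+ 2| * (4 * M)%:R / N.
Proof.
move=> S.
pose G j l w := (V l w - V j w) ^+ m - dm m.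
have mk : (m + m <= 4 * k)%N by rewrite /m; lia.
have mk' : (m <= 4 * k)%N by rewrite /m; lia.
have hG j l : (j <= n)%N -> (l <= n)%N -> l != j ->
    integrable_rv P (G j l) /\ mean P (G j l) = 0.
  move=> jn ln lj; have [h e] := iD jn ln lj mk'; split.
    by apply: integrable_rvB => //; exact: integrable_rv_cst.
  by rewrite meanB ?mean_cst ?e ?subrr//; exact: integrable_rv_cst.
have [||||||iS ES] := @mean_weighted_pair_avg_sqr _ _ _ P GX GU indXU mGX mGU n t xi M NM
  (fun _ _ _ => 1) G (`|dm (m + m) - dm m ^+ 2|).
- exact: normr_ge0.
- by move=> j l _ _; exact: measurable_cst.
- by move=> j l _ _; exists 1 => w; rewrite normr1.
- by move=> j l jn ln; apply: measurable_funB; [exact: mD|exact: measurable_cst].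
- move=> j l jn ln lj; have [h e] := iD jn ln lj mk'; have [h2 e2] := iD jn ln lj mk.
  have eG w : G j l w ^+ 2 = (V l w - V j w) ^+ (m + m) - (2 * dm m) * (V l w - V j w) ^+ m + dm m ^+ 2.
    by rewrite /G exprD; ring.
  under eq_fun do rewrite eG.
  have i1 := integrable_rvZ (2 * dm m) h.
  split; first by apply: integrable_rvD; [exact: integrable_rvB|exact: integrable_rv_cst].
  rewrite meanD; [|exact: integrable_rvB|exact: integrable_rv_cst].
  rewrite meanB// meanZ// mean_cst e e2; apply: le_trans (ler_norm _).
  by rewrite le_eqVlt; apply/orP; left; apply/eqP; ring.
- move=> j l j' l' jn ln jn' ln' lj lj' h1 h2 h3 h4.
  have [i1 e1] := hG _ _ jn ln lj; have [i2 e2] := hG _ _ jn' ln' lj'.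
  rewrite (mean_difference_indep (g := fun y => y ^+ m - dm m) indV)// ?e1 ?mul0r//.
  by apply: measurable_funB => //; exact: measurable_funX.
have SE w : S w = pair_avg n t xi (fun j l => 1 * G j l w).
  by apply: eq_pair_avg => j l _ _ _ _; rewrite mul1r.
under eq_fun do rewrite SE; split => //.
apply: le_trans ES _; rewrite -[leRHS]mulr1; apply: ler_wpM2l.
  by rewrite !mulr_ge0// invr_ge0.
rewrite (@eq_pair_avg _ _ _ _ _ (fun _ _ => 1)) ?pair_avg_cst//.
by move=> j l _ _ _ _; rewrite -[RHS](mean_cst P); apply: eq_Rintegral => w _; rewrite expr1n.
Qed.

(** [m.-1] is odd, so the noise factor is centred and pairs without a common index are uncorrelated.
    The weights contribute the additional factor [kappa]. *)
Lemma cross_average :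
  let S w := avg (fun j l => W j l w * (V l w - V j w) ^+ m.-1) in
  integrable_rv P (fun w => S w ^+ 2) /\
  mean P (fun w => S w ^+ 2) <= `|dm (m.-1 + m.-1)| * (4 * M)%:R / N * kappa.
Proof.
move=> S.
have mk : (m.-1 + m.-1 <= 4 * k)%N by rewrite /m; lia.
have mk' : (m.-1 <= 4 * k)%N by rewrite /m; lia.
have dm0 : dm m.-1 = 0.
  apply: difference_moment_odd; first by rewrite /m; lia.
  by move=> i oi im; apply: oddU => //; move: im; rewrite /m; lia.
have [||||||iS ES] := @mean_weighted_pair_avg_sqr _ _ _ P GX GU indXU mGX mGU n t xi M NM
  W (fun j l w => (V l w - V j w) ^+ m.-1) (`|dm (m.-1 + m.-1)|).
- exact: normr_ge0.
- exact: mW.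
- by move=> j l jn ln; exists (2 * A) => w; exact: W_le.
- by move=> j l jn ln; exact: mD.
- move=> j l jn ln lj; have [h e] := iD jn ln lj mk.
  have eG w : ((V l w - V j w) ^+ m.-1) ^+ 2 = (V l w - V j w) ^+ (m.-1 + m.-1).
    by rewrite exprD expr2.
  under eq_fun do rewrite eG.
  by split => //; rewrite e ler_norm.
- move=> j l j' l' jn ln jn' ln' lj lj' h1 h2 h3 h4.
  have [i1 e1] := iD jn ln lj mk'; have [i2 e2] := iD jn' ln' lj' mk'.
  rewrite (mean_difference_indep (g := fun y => y ^+ m.-1) indV)// ?e1 ?dm0 ?mul0r//.
by split => //; apply: le_trans ES _; apply: ler_wpM2l.
Qed.

Lemma remainder_average :
  let S w := avg (fun j l => W j l w ^+ 2 * ((1 + 2 * A) ^+ m + (V l w - V j w) ^+ m)) in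
  [/\ integrable_rv P S, forall w, 0 <= S w &
   mean P S <= `|(1 + 2 * A) ^+ m + dm m| * kappa].
Proof.
move=> S; have mk' : (m <= 4 * k)%N by rewrite /m; lia.
have em (y : R) : 0 <= y ^+ m by rewrite /m exprM exprn_ge0// sqr_ge0.
have key j l : (j <= n)%N -> (l <= n)%N -> l != j ->
    integrable_rv P (fun w => W j l w ^+ 2 * ((1 + 2 * A) ^+ m + (V l w - V j w) ^+ m)) /\
    mean P (fun w => W j l w ^+ 2 * ((1 + 2 * A) ^+ m + (V l w - V j w) ^+ m)) =
    mean P (fun w => W j l w ^+ 2) * ((1 + 2 * A) ^+ m + dm m).
  move=> jn ln lj; have [h e] := iD jn ln lj mk'.
  have i2 : integrable_rv P (fun w => (1 + 2 * A) ^+ m + (V l w - V j w) ^+ m).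
    by apply: integrable_rvD => //; exact: integrable_rv_cst.
  have m1 : measurable_fun (setT : set (g_sigma_algebraType GX)) (fun w => W j l w ^+ 2).
    by apply: measurable_funX; exact: mW.
  have m2 : measurable_fun (setT : set (g_sigma_algebraType GU))
      (fun w => (1 + 2 * A) ^+ m + (V l w - V j w) ^+ m).
    by apply: measurable_funD; [exact: measurable_cst|exact: mD].
  have [i3 e3] := mean_indepM indXU mGX mGU m1 m2 (iW2 jn ln) i2.
  split => //; rewrite e3; congr (_ * _).
  by rewrite meanD ?mean_cst ?e//; exact: integrable_rv_cst.
(* The diagonal does not occur in the average. It is set to 0 because the lemmas on averages ask for
   integrability at all index pairs, while [key] covers distinct indices. *)
pose T j l w := if (j != l)%N then W j l w ^+ 2 * ((1 + 2 * A) ^+ m + (V l w - V j w) ^+ m) else 0.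
have SE w : S w = avg (fun j l => T j l w).
  by apply: eq_pair_avg => j l _ _ _ lj; rewrite /T eq_sym lj.
have iT j l : (j <= n)%N -> (l <= n)%N -> integrable_rv P (T j l).
  move=> jn ln; rewrite /T; have [jl|jl] := eqVneq j l; first exact: integrable_rv_cst.
  by have [] := key j l jn ln; rewrite 1?eq_sym.
split.
- have -> : S = (fun w => avg (fun j l => T j l w)) by apply/funext.
  exact: integrable_pair_avg.
- move=> w; apply: pair_avg_ge0 => j l _ _; rewrite mulr_ge0 ?sqr_ge0// addr_ge0//; exact: em.
- have -> : S = (fun w => avg (fun j l => T j l w)) by apply/funext.
  rewrite /avg mean_pair_avg//.
  rewrite (@eq_pair_avg _ _ _ _ _ (fun j l => ((1 + 2 * A) ^+ m + dm m) * mean P (fun w => W j l w ^+ 2))).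
    rewrite pair_avgZ; apply: (@le_trans _ _ (`|(1 + 2 * A) ^+ m + dm m| *
      avg (fun j l => mean P (fun w => W j l w ^+ 2)))); last exact: ler_wpM2l.
    apply: ler_wpM2r; last exact: ler_norm.
    by apply: pair_avg_ge0 => j l _ _; apply: mean_ge0 => w; exact: sqr_ge0.
  move=> j l jn ln _ lj; have [_ e] := key j l jn ln lj; rewrite [RHS]mulrC -e.
  by apply: eq_Rintegral => w _; rewrite /T eq_sym lj.
Qed.

(** A pathwise expansion to second order on [good]. There increments of [x] are at most 2A, so the
    remainder is controlled by (1 + 2A + |dU|)^m <= 2^m ((1 + 2A)^m + dU^m), the exponent being
    even. *)
Lemma noisy_pair_avg_le w :
  avg (fun j l => (x l w - x j w) ^+ 2) <= kappa -> (forall j, (j <= n)%N -> `|x j w| <= A) ->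
  `|avg (fun j l => ((x l w + V l w) - (x j w + V j w)) ^+ m) - dm m| <=
  `|avg (fun j l => (V l w - V j w) ^+ m - dm m)| +
  m%:R * `|avg (fun j l => W j l w * (V l w - V j w) ^+ m.-1)| +
  m%:R ^+ 2 * 2 ^+ m *
    avg (fun j l => W j l w ^+ 2 * ((1 + 2 * A) ^+ m + (V l w - V j w) ^+ m)).
Proof.
move=> xk xA; have em (y : R) : y ^+ m = `|y| ^+ m.
  by rewrite /m !exprM real_normK ?num_real.
have gw : good w by split => // j; exact: xA.
have WE j l : W j l w = x l w - x j w by rewrite /W indicE mem_set// mulr1.
have -> : avg (fun j l => ((x l w + V l w) - (x j w + V j w)) ^+ m) - dm m =
    avg (fun j l => ((x l w + V l w) - (x j w + V j w)) ^+ m + (- dm m)).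
  by rewrite /avg pair_avgD pair_avg_cst.
rewrite /avg.
pose r j l := ((x l w - x j w) + (V l w - V j w)) ^+ m - (V l w - V j w) ^+ m -
   m%:R * (x l w - x j w) * (V l w - V j w) ^+ m.-1.
rewrite (@eq_pair_avg _ _ _ _ _ (fun j l => ((V l w - V j w) ^+ m - dm m) +
   (m%:R * (W j l w * (V l w - V j w) ^+ m.-1) + r j l))); last first.
  move=> j l _ _ _ _; rewrite WE /r.
  have -> : x l w + V l w - (x j w + V j w) = (x l w - x j w) + (V l w - V j w) by ring.
  by ring.
rewrite (pair_avgD _ _ _ (fun j l => (V l w - V j w) ^+ m - dm m))
  (pair_avgD _ _ _ (fun j l => m%:R * (W j l w * (V l w - V j w) ^+ m.-1)))
  (pair_avgZ _ _ _ _ (fun j l => W j l w * (V l w - V j w) ^+ m.-1)) addrA.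
apply: le_trans (ler_normD _ _) _; apply: lerD.
  by apply: le_trans (ler_normD _ _) _; rewrite [`|m%:R * _|]normrM normr_nat.
apply: le_trans (norm_pair_avg _ _ _ _) _; rewrite -pair_avgZ.
apply: le_pair_avg => j l jn ln _ _; rewrite WE.
apply: le_trans (exprD_remainder _ _ _) _.
rewrite -[leLHS]mulrA -[leRHS]mulrA; apply: ler_wpM2l; first exact: exprn_ge0.
rewrite mulrCA; apply: ler_wpM2l; first exact: sqr_ge0.
have A2 : 0 <= 1 + 2 * A by rewrite addr_ge0// mulr_ge0.
rewrite [(V l w - V j w) ^+ m]em; apply: le_trans (exprD_le m A2 (normr_ge0 _)).
rewrite lerXn2r ?nnegrE ?addr_ge0 ?mulr_ge0// lerD2r lerD2l.
apply: le_trans (ler_normB _ _) _; have := xA j jn; have := xA l ln; lra.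
Qed.

End NoisyPairAverage.

(** * Moment estimators *)

Section NoisyMoments.
Context {R : realType} {d : measure_display} {Omega : measurableType d}.
Variable P : probability Omega R.

Definition rate (n : nat) : R := n%:R `^ (- 2^-1).

Lemma rate_gt0 n : (1 <= n)%N -> 0 < rate n.
Proof. by move=> n1; rewrite powR_gt0// ltr0n. Qed.

Lemma rate_sqr n : rate n ^+ 2 = n%:R^-1.
Proof.
by rewrite /rate -powR_mulrn ?powR_ge0// -powRrM mulNr mulVf// powR_inv1.
Qed.

Lemma rate_le1 n : (1 <= n)%N -> rate n <= 1.
Proof.
move=> n1; have r0 := rate_gt0 n1.
rewrite leNgt; apply/negP => r1; have : rate n ^+ 2 <= 1.
  by rewrite rate_sqr invf_le1 ?ler1n// ltr0n.
by nra.
Qed.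

Lemma markov_rate (S : Omega -> R) (D kap : R) n : (1 <= n)%N -> 0 < kap ->
  integrable_rv P (fun w => S w ^+ 2) -> mean P (fun w => S w ^+ 2) <= D / n%:R ->
  (P [set w | kap * rate n < `|S w|]%R <= (D / kap ^+ 2)%:E)%E.
Proof.
move=> n1 kap0 iS ES; have r0 := rate_gt0 n1.
have kr0 : 0 < kap * rate n by exact: mulr_gt0.
have -> : [set w | kap * rate n < `|S w|] = [set w | (kap * rate n) ^+ 2 < S w ^+ 2].
  apply/seteqP; split => w /=; rewrite -[S w ^+ 2]real_normK ?num_real//;
    by have := normr_ge0 (S w); nra.
have kr2 : 0 < (kap * rate n) ^+ 2 by rewrite exprn_gt0.
apply: le_trans (markov_mean iS (fun w => sqr_ge0 _) kr2) _.
rewrite lee_fin exprMn rate_sqr ler_pdivrMr ?mulr_gt0 ?invr_gt0 ?ltr0n ?exprn_gt0//.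
apply: le_trans ES _; rewrite mulrA divfK// expf_neq0// gt_eqF//.
Qed.

Lemma measurable_moment_rec (a : Omega -> nat -> R) j :
  (forall i, measurable_fun setT (fun w => a w i)) ->
  measurable_fun setT (fun w => moment_rec (a w) j).
Proof.
move=> ma; elim/ltn_ind: j => -[_|j IH]; first exact: measurable_cst.
rewrite (_ : (fun w => _) = fun w => 2^-1 * (a w j.+1 - \sum_(1 <= i < j.+1)
    'C(2 * j.+1, 2 * i)%:R * moment_rec (a w) i * moment_rec (a w) (j.+1 - i))); last first.
  by apply/funext => w; rewrite moment_recE.
apply: measurable_funM => //; apply: measurable_funB => //.
rewrite (_ : (fun w => _) = fun w => \sum_(i <- index_iota 1 j.+1)
  (if (0 < i < j.+1)%N then 'C(2 * j.+1, 2 * i)%:R * moment_rec (a w) i *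
      moment_rec (a w) (j.+1 - i) else 0)); last first.
  by apply/funext => w; apply: eq_big_nat => i ->.
apply: measurable_sum => i /=; case: (boolP (0 < i < j.+1)%N) => [/andP[i0 ij]|_];
  last exact: measurable_cst.
apply: measurable_funM; last by apply: IH; rewrite ltn_subrL i0.
by apply: measurable_funM => //; exact: IH.
Qed.

(** Five exceptional events of probability at most [e]: the two given ones and one Markov bound for
    each term. Outside them the terms are at most kap * rate with weights 1, a and b. *)
Lemma three_term_rate (S1 S2 S3 Z : Omega -> R) (E1 E2 : set Omega)
    (a b kap e D1 D2 D3 : R) n : (1 <= n)%N -> 0 < kap -> 0 <= a -> 0 <= b ->
  measurable_fun setT Z -> measurable E1 -> measurable E2 ->
  (P E1 <= e%:E)%E -> (P E2 <= e%:E)%E ->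
  integrable_rv P (fun w => S1 w ^+ 2) -> mean P (fun w => S1 w ^+ 2) <= D1 / n%:R ->
  integrable_rv P (fun w => S2 w ^+ 2) -> mean P (fun w => S2 w ^+ 2) <= D2 / n%:R ->
  integrable_rv P S3 -> (forall w, 0 <= S3 w) -> mean P S3 <= D3 * rate n ->
  D1 / kap ^+ 2 <= e -> D2 / kap ^+ 2 <= e -> D3 / kap <= e ->
  (forall w, ~ E1 w -> ~ E2 w -> `|Z w| <= `|S1 w| + a * `|S2 w| + b * S3 w) ->
  (P [set w | kap * (1 + a + b) * rate n < `|Z w|]%R <= (5 * e)%:E)%E.
Proof.
move=> n1 kap0 a0 b0 mZ mE1 mE2 PE1 PE2 iS1 ES1 iS2 ES2 iS3 S30 ES3 hD1 hD2 hD3 hZ.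
have r0 := rate_gt0 n1.
have kr0 : 0 < kap * rate n by exact: mulr_gt0.
have msq (S : Omega -> R) : integrable_rv P (fun w => S w ^+ 2) ->
    measurable [set w | kap * rate n < `|S w|].
  move=> /integrable_rv_measurable mS.
  have -> : [set w | kap * rate n < `|S w|] =
      (fun w => S w ^+ 2) @^-1` `](kap * rate n) ^+ 2, +oo[%classic.
    apply/seteqP; split => w /=; rewrite in_itv/= andbT -[S w ^+ 2]real_normK ?num_real//;
      by have := normr_ge0 (S w); nra.
  by rewrite -[_ @^-1` _]setTI; exact: mS.
have mgt (f : Omega -> R) q : measurable_fun setT f -> measurable [set w | q < f w].
  move=> mf.
  have -> : [set w | q < f w] = f @^-1` `]q, +oo[%classic.
    by apply/seteqP; split => w /=; rewrite in_itv/= andbT.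
  by rewrite -[_ @^-1` _]setTI; exact: mf.
have P1 : (P [set w | kap * rate n < `|S1 w|]%R <= e%:E)%E.
  by apply: (le_trans (markov_rate n1 kap0 iS1 ES1)); rewrite lee_fin.
have P2 : (P [set w | kap * rate n < `|S2 w|]%R <= e%:E)%E.
  by apply: (le_trans (markov_rate n1 kap0 iS2 ES2)); rewrite lee_fin.
have P3 : (P [set w | kap * rate n < S3 w]%R <= e%:E)%E.
  apply: (le_trans (markov_mean iS3 S30 kr0)); rewrite lee_fin.
  apply: le_trans hD3; rewrite ler_pdivrMr// mulrA divfK ?gt_eqF//.
have m3 := mgt S3 (kap * rate n) (integrable_rv_measurable iS3).
have -> : 5 * e = e + (e + (e + (e + e))) by ring.
have mA : measurable [set w | kap * (1 + a + b) * rate n < `|Z w|].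
  by apply: mgt; exact: measurableT_comp.
pose U1 := [set w | kap * rate n < `|S2 w|] `|` [set w | kap * rate n < S3 w].
have mU1 : measurable U1 by apply: measurableU => //; exact: msq.
pose U2 := [set w | kap * rate n < `|S1 w|] `|` U1.
have mU2 : measurable U2 by apply: measurableU => //; exact: msq.
apply: (@prob_le_setU _ _ _ _ _ E1 (E2 `|` U2)) => //; first exact: measurableU.
  move=> w /= hw; apply: contrapT => /not_orP[nE1 /not_orP[nE2 /not_orP[/negP n1']]].
  move=> /not_orP[/negP n2' /negP n3']; move: n1' n2' n3'; rewrite -!leNgt => h1 h2 h3.
  have := hZ w nE1 nE2.
  have h2' := ler_wpM2l a0 h2; have h3' := ler_wpM2l b0 h3.
  by move: hw h1 h2' h3'; lra.
apply: (@prob_le_setU _ _ _ _ _ E2 U2) => //; first exact: measurableU.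
apply: (@prob_le_setU _ _ _ _ _ [set w | kap * rate n < `|S1 w|] U1) => //; first exact: msq.
apply: (@prob_le_setU _ _ _ _ _ [set w | kap * rate n < `|S2 w|]
  [set w | kap * rate n < S3 w]) => //; by exact: msq.
Qed.

Variables (t : nat -> nat -> R) (xi : nat -> R) (C0 : R).
Hypotheses (C00 : 0 < C0) (NC : forall n, (1 <= n)%N ->
  [/\ (0 < N_max n (t n) (xi n))%N, (0 < N_total n (t n) (xi n))%N,
      (N_max n (t n) (xi n))%:R / (N_total n (t n) (xi n))%:R <= C0 / n%:R &
      (N_max n (t n) (xi n) ^ 2)%:R / (N_total n (t n) (xi n))%:R <= C0 * xi n]).
Hypothesis NM3 : forall n j, (1 <= n)%N -> (j <= n)%N ->
  ((N_ n (t n) (xi n) j).+1 <= 3 * N_max n (t n) (xi n))%N.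
Hypotheses (xi0 : forall n, (1 <= n)%N -> 0 < xi n)
  (xi_rate : \forall n \near \oo, xi n <= rate n).
Variables (GX : set (set Omega)) (GU : nat -> set (set Omega)).
Hypotheses (mGX : GX `<=` measurable) (mGU : forall n, GU n `<=` measurable)
  (indXU : forall n, (1 <= n)%N -> indep_systems P <<s GX >> <<s GU n >>).
Variable x : nat -> nat -> Omega -> R.
Hypothesis mx : forall n j, (1 <= n)%N -> (j <= n)%N ->
  measurable_fun (setT : set (g_sigma_algebraType GX)) (x n j).
Hypothesis x_avg : forall eps : R, 0 < eps -> exists2 K : R, 0 < K &
  \forall n \near \oo, (P [set w | K * xi n <
    pair_avg n (t n) (xi n) (fun j l => (x n l w - x n j w) ^+ 2)]%R <= eps%:E)%E.
Hypothesis x_sup : forall eps : R, 0 < eps -> exists A : R, exists E : set Omega,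
  [/\ 0 <= A, measurable E, (P E <= eps%:E)%E &
   forall w, ~ E w -> forall n j, (1 <= n)%N -> (j <= n)%N -> `|x n j w| <= A].
Variables (U0 : {RV P >-> R}) (U : nat -> nat -> {RV P >-> R}) (k : nat).
Hypothesis indU : forall n, (1 <= n)%N ->
  mutually_independent P n.+1 (fun j => U n j : Omega -> R).
Hypothesis lawU : forall n j, (1 <= n)%N -> (j <= n)%N -> forall A, measurable A ->
  distribution P U0 A = distribution P (U n j) A.
Hypothesis iU : forall a, (a <= 4 * k)%N -> integrable_rv P (fun w => `|U0 w| ^+ a).
Hypothesis oddU : forall i, odd i -> (i <= 2 * k)%N -> moment U0 i = 0.
Hypothesis mU : forall n j, (1 <= n)%N -> (j <= n)%N ->
  measurable_fun (setT : set (g_sigma_algebraType (GU n))) (U n j : Omega -> R).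

Let y n w j := x n j w + U n j w.

Lemma measurable_M_tilde_hat n k' : (1 <= n)%N ->
  measurable_fun setT (fun w => M_tilde_hat n (t n) (xi n) (y n w) k').
Proof.
move=> n1.
apply: (@measurable_pair_avg R n (t n) (xi n) _ Omega
  (fun j l w => (y n w l - y n w j) ^+ (2 * k'))) => j l jn ln.
apply: measurable_funX.
have my i : (i <= n)%N -> measurable_fun setT (fun w => y n w i).
  move=> i_n; apply: measurable_funD; last exact: measurable_funP.
  by apply: measurable_rv_sub (mx n1 i_n).
by apply: measurable_funB; exact: my.
Qed.

Lemma M_tilde_hat_rate k' : (1 <= k' <= k)%N ->
  forall eps : R, 0 < eps -> exists2 K : R, 0 < K &
  \forall n \near \oo, (P [set w | K * rate n <
     `|M_tilde_hat n (t n) (xi n) (y n w) k' - difference_moment U0 (2 * k')|]%R <= eps%:E)%E.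
Proof.
move=> /andP[k1 kk] eps eps0; have e50 : 0 < eps / 5 by rewrite divr_gt0.
have [K1 K10 hK1] := x_avg e50.
have [A [E [A0 mE PE hE]]] := x_sup e50.
pose m := (2 * k')%N; pose dm := difference_moment U0.
(* 12 C0 arises from (4M) / N with M = 3 N_max and N_max / N <= C0 / n. *)
pose D1 := `|dm (m + m)%N - dm m ^+ 2| * (12 * C0).
pose D2 := `|dm (m.-1 + m.-1)%N| * (12 * C0) * K1.
pose D3 := `|(1 + 2 * A) ^+ m + dm m| * K1.
have D10 : 0 <= D1 by rewrite !mulr_ge0// ltW.
have D20 : 0 <= D2 by rewrite !mulr_ge0// ltW.
have D30 : 0 <= D3 by rewrite !mulr_ge0// ltW.
(* Chosen so that D1 + D2 + D3 <= kap * (eps / 5); being at least 1, [kap] may be replaced by its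
   square in the two second moment bounds. *)
pose kap := 1 + 5 * (D1 + D2 + D3) / eps.
have kap1 : 1 <= kap by rewrite /kap lerDl divr_ge0 ?(ltW eps0)// mulr_ge0// !addr_ge0.
have kap0 : 0 < kap by exact: lt_le_trans kap1.
have kapD : D1 + D2 + D3 <= kap * (eps / 5).
  have -> : kap * (eps / 5) = eps / 5 + (D1 + D2 + D3).
    by rewrite /kap; field; rewrite gt_eqF.
  by rewrite lerDr ltW.
have kap2 (D : R) : 0 <= D -> D <= D1 + D2 + D3 -> D / kap ^+ 2 <= eps / 5.
  move=> Dp hD; rewrite ler_pdivrMr ?exprn_gt0//.
  apply: (le_trans hD); apply: (le_trans kapD); rewrite mulrC ler_wpM2l ?(ltW e50)//.
  by rewrite expr2 ler_peMl// ltW.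
have kap3 (D : R) : D <= D1 + D2 + D3 -> D / kap <= eps / 5.
  by move=> hD; rewrite ler_pdivrMr// mulrC; apply: (le_trans hD).
exists (kap * (1 + m%:R + m%:R ^+ 2 * 2 ^+ m)).
  by rewrite mulr_gt0// -addrA ltr_pwDl// addr_ge0// mulr_ge0// ?sqr_ge0// exprn_ge0.
near=> n.
have n1 : (1 <= n)%N by near: n; exists 1%N.
have xr : xi n <= rate n by near: n.
have hB1 : (P [set w | K1 * xi n <
    pair_avg n (t n) (xi n) (fun j l => (x n l w - x n j w) ^+ 2)]%R <= (eps / 5)%:E)%E by near: n.
have r0 := rate_gt0 n1; have r1 := rate_le1 n1; have xn0 := xi0 n1.
have [Nmax0 N0 NC1 _] := NC n1.
pose M := (3 * N_max n (t n) (xi n))%N.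
have NM j : (j <= n)%N -> (N_ n (t n) (xi n) j <= M)%N by move=> jn; apply: ltnW; exact: NM3.
have kx0 : 0 <= K1 * xi n by rewrite mulr_ge0// ltW.
have MN : (4 * M)%:R / (N_total n (t n) (xi n))%:R <= 12 * C0 / n%:R :> R.
  have -> : (4 * M)%:R = 12 * (N_max n (t n) (xi n))%:R :> R by rewrite /M !natrM; ring.
  by rewrite -!mulrA; apply: ler_wpM2l.
have mGUn : GU n `<=` measurable := @mGU n.
have mUn j : (j <= n)%N ->
    measurable_fun (setT : set (g_sigma_algebraType (GU n))) (U n j : Omega -> R).
  exact: mU.
have mxn j : (j <= n)%N -> measurable_fun (setT : set (g_sigma_algebraType GX)) (x n j).
  exact: mx.
have lawn j (jn : (j <= n)%N) := lawU n1 jn.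
have [iS1 ES1] := noise_average (indXU n1) mGX mGUn NM N0 (indU n1) lawn iU mUn mxn
  A0 kx0 k1 kk.
have [iS2 ES2] := cross_average (indXU n1) mGX mGUn NM N0 (indU n1) lawn iU oddU mUn mxn
  A0 kx0 k1 kk.
have [iS3 S30 ES3] := remainder_average (indXU n1) mGX mGUn N0 (indU n1) lawn iU mUn mxn
  A0 kx0 k1 kk.
have hle w := noisy_pair_avg_le N0 U0 (U n) (x := x n) (kappa := K1 * xi n) A0 k' (w := w).
have -> : eps = 5 * (eps / 5) by field.
have nM (D : R) : 0 <= D -> D * (4 * M)%:R / (N_total n (t n) (xi n))%:R <=
    D * (12 * C0) / n%:R.
  by move=> D0'; rewrite -!mulrA; apply: ler_wpM2l => //; rewrite !mulrA.
apply: (three_term_rate (a := m%:R) (b := m%:R ^+ 2 * 2 ^+ m) n1 kap0 _ _ _ mE _ PE hB1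
  iS1 _ iS2 _ iS3 S30 _ (kap2 D1 _ _) (kap2 D2 _ _) (kap3 D3 _)) => //.
- by apply: measurable_funB => //; exact: measurable_M_tilde_hat.
- have mx2 : measurable_fun setT (fun w => pair_avg n (t n) (xi n)
      (fun j l => (x n l w - x n j w) ^+ 2)).
    apply: (@measurable_pair_avg R n (t n) (xi n) _ Omega
      (fun j l w => (x n l w - x n j w) ^+ 2)) => j l jn ln.
    apply: measurable_funX; apply: measurable_funB;
      by apply: measurable_rv_sub; first exact: mGX; exact: mxn.
  rewrite (_ : [set w | _] = (fun w => pair_avg n (t n) (xi n)
      (fun j l => (x n l w - x n j w) ^+ 2)) @^-1` `]K1 * xi n, +oo[%classic).
    by rewrite -[_ @^-1` _]setTI; exact: mx2.
  by apply/seteqP; split => w /=; rewrite in_itv/= andbT.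
- by apply: (le_trans ES1); exact: nM.
- apply: (le_trans ES2); apply: (le_trans (ler_wpM2r kx0 (nM _ (normr_ge0 _)))).
  rewrite /D2 mulrAC ler_wpM2r ?invr_ge0//.
  by rewrite ler_wpM2l ?mulr_ge0 ?(ltW C00)// ler_piMr ?(ltW K10)// (le_trans xr).
(* The remainder is of order xi itself, and xi <= n^(-1/2) brings it down to the rate. For the cross
   term xi <= 1 was enough. *)
- apply: (le_trans ES3); rewrite /D3 -mulrA; apply: ler_wpM2l => //.
  by rewrite ler_wpM2l// ltW.
- by rewrite -addrA lerDl addr_ge0.
- by rewrite addrAC lerDr addr_ge0.
- by rewrite lerDr addr_ge0.
move=> w nE nB; apply: hle => [|j jn]; last exact: hE.
by rewrite leNgt; exact/negP.
Unshelve. all: by end_near.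
Qed.

Lemma M_hat_rate : (1 <= k)%N -> forall eps : R, 0 < eps -> exists2 K : R, 0 < K &
  \forall n \near \oo, (P [set w | K * rate n <
     `|M_hat n (t n) (xi n) (y n w) k - moment U0 (2 * k)|]%R <= eps%:E)%E.
Proof.
move=> k1 eps eps0; have ek0 : 0 < eps / k%:R by rewrite divr_gt0// ltr0n.
pose dm j := difference_moment U0 (2 * j).
pose E K j n := [set w | K * rate n < `|M_tilde_hat n (t n) (xi n) (y n w) j.+1 - dm j.+1|].
have /choice[Kf hKf] : forall j : 'I_k, exists K,
    0 < K /\ \forall n \near \oo, (P (E K j n) <= (eps / k%:R)%:E)%E.
  move=> j; have jk : (1 <= j.+1 <= k)%N by rewrite ltn_ord.
  by have [K K0 hK] := M_tilde_hat_rate jk ek0; exists K.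
(* The sum of nonnegative constants dominates each of them, so one [K] covers all [k] estimators. *)
pose K := \sum_(j < k) Kf j.
have KfK j : Kf j <= K.
  rewrite /K (bigD1 j)//= lerDl sumr_ge0// => i _; exact: ltW (hKf i).1.
have K0 : 0 <= K by apply: sumr_ge0 => i _; exact: ltW (hKf i).1.
have [C C1 hC] := moment_rec_lipschitz dm k K0.
have dmE : moment_rec dm k = moment U0 (2 * k).
  apply: (moment_rec_solution (m := fun j => moment U0 (2 * j)) (k := k)); last first.
    by rewrite k1 leqnn.
  move=> j /andP[j1 jk]; apply: difference_moment_even => // i oi ij; apply: oddU => //.
  by apply: (leq_trans ij); rewrite leq_mul2l.
exists (C + 1); first by rewrite ltr_wpDl.
near=> n.
have n1 : (1 <= n)%N by near: n; exists 1%N.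
have r0 := rate_gt0 n1.
have hE : forall j : 'I_k, (P (E (Kf j) j n) <= (eps / k%:R)%:E)%E.
  near: n; apply: filter_forall => j; exact: (hKf j).2.
have mtil j : measurable_fun setT (fun w => M_tilde_hat n (t n) (xi n) (y n w) j).
  exact: measurable_M_tilde_hat.
have mgt (f : Omega -> R) q : measurable_fun setT f -> measurable [set w | q < `|f w|].
  move=> mf.
  have -> : [set w | q < `|f w|] = (fun w => `|f w|) @^-1` `]q, +oo[%classic.
    by apply/seteqP; split => w /=; rewrite in_itv/= andbT.
  by rewrite -[_ @^-1` _]setTI; apply: (measurableT_comp (@normr_measurable R setT) mf).
(* Extends the family from ordinals to [nat], the index type of the union bound. *)
pose Ek j := oapp (fun i : 'I_k => E (Kf i) i n) set0 (insub j).
have EkE (j : 'I_k) : Ek j = E (Kf j) j n by rewrite /Ek valK.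
have [mEk PU] : measurable (\big[setU/set0]_(j < k) Ek j) /\
    (P (\big[setU/set0]_(j < k) Ek j) <= (k%:R * (eps / k%:R))%:E)%E.
  apply: prob_bigsetU_le => j jk; rewrite (EkE (Ordinal jk)) ?hE//.
  by apply: mgt; apply: measurable_funB.
rewrite mulrC divfK ?pnatr_eq0 -?lt0n// in PU; apply: le_trans PU.
apply: le_measure; rewrite ?inE//.
  apply: mgt; apply: measurable_funB => //; exact: measurable_moment_rec.
move=> w /= hw; apply: contrapT => nU.
move: hw; apply/negP; rewrite -leNgt -dmE.
have rn : 0 <= rate n <= 1 by rewrite ltW// rate_le1.
apply: (@le_trans _ _ (C * rate n)); last by rewrite ler_wpM2r ?(ltW r0)// lerDl.
(* The Lipschitz bound is used with [dlt] equal to the rate, which is at most 1. The index 0 is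
   excluded, hence the shift by one in [E]. *)
apply: (hC _ _ rn) => [[//|j] /andP[_ jk]|]; last by rewrite k1 leqnn.
rewrite leNgt; apply/negP => hj; apply: nU; rewrite -bigcup_mkord.
exists j => //; rewrite /= (EkE (Ordinal jk)) /E /=.
by apply: le_lt_trans hj; rewrite ler_wpM2r// ltW.
Unshelve. all: by end_near.
Qed.

End NoisyMoments.

(** * From the hypotheses of the theorem to the abstract setting *)

Section TheoremHypotheses.
Context {R : realType} {d : measure_display} {Omega : measurableType d}.
Variable P : probability Omega R.

(** The generating system inside [generated_sigma], isolated so that the independence hypothesis
    reads as independence of two generated sigma-algebras. *)
Definition preimages {J : Type} (D : set J) (V : J -> Omega -> R) : set (set Omega) :=
  [set E | exists j, D j /\ exists A, measurable A /\ E = V j @^-1` A].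

Lemma preimages_measurable {J : Type} (D : set J) (V : J -> Omega -> R) :
  (forall j, D j -> measurable_fun setT (V j)) -> preimages D V `<=` measurable.
Proof.
move=> mV _ [j [Dj [A [mA ->]]]]; rewrite -[_ @^-1` _]setTI.
by apply: mV.
Qed.

Lemma measurable_preimages {J : Type} (D : set J) (V : J -> Omega -> R) j : D j ->
  measurable_fun (setT : set (g_sigma_algebraType (preimages D V))) (V j).
Proof.
move=> Dj _ A mA; rewrite setTI; apply: sub_gen_smallest.
by exists j; split => //; exists A.
Qed.

Lemma integrable_pow_expectation (V : {RV P >-> R}) (q : R) a :
  ('E_P[fun w => (`|V w| `^ q)%R] < +oo)%E -> a%:R <= q ->
  integrable_rv P (fun w => `|V w| ^+ a).
Proof.
rewrite unlock => hV aq.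
have mq : measurable_fun setT (fun w => `|V w| `^ q).
  by apply: (measurableT_comp (measurable_powR q)); exact: measurableT_comp.
have iq : integrable_rv P (fun w => `|V w| `^ q).
  apply/integrableP; split; first exact/measurable_EFinP.
  apply: le_lt_trans hV; apply: ge0_le_integral => //.
  - by apply: measurableT_comp => //; exact/measurable_EFinP.
  - exact/measurable_EFinP.
  - by move=> w _ /=; rewrite ger0_norm ?powR_ge0.
apply: (integrable_rv_le (Y := fun w => 1 + `|V w| `^ q)).
- by apply: measurable_funX; exact: measurableT_comp.
- move=> w; rewrite ger0_norm ?exprn_ge0//.
  have [V1|V1] := leP `|V w| 1; first by rewrite (le_trans (exprn_ile1 _ _ V1))// lerDl powR_ge0.
  rewrite -powR_mulrn// (le_trans (ler_powR (ltW V1) aq))// lerDr//.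
- by apply: integrable_rvD => //; exact: integrable_rv_cst.
Qed.

(** p / (2 (p - 1)) >= 1/2 because p >= p - 1 > 0; the little-o is used with constant 1. *)
Lemma littleo_bandwidth_le (xi : nat -> R) (p : R) : 2 < p <= 3 ->
  (xi : nat -> R^o) =o_\oo
    ((fun n => n%:R `^ (- (p / (2 * (p - 1))))) : nat -> R^o) ->
  \forall n \near \oo, xi n <= rate n.
Proof.
move=> /andP[p2 p3] /eqoP/(_ 1 ltr01) h.
near=> n.
have n1 : (1 <= n)%N by near: n; exists 1%N.
have : `|xi n| <= 1 * `|n%:R `^ (- (p / (2 * (p - 1))))| by near: n.
rewrite mul1r [X in _ <= X]ger0_norm ?powR_ge0// => hn.
apply: (le_trans (ler_norm _)); apply: (le_trans hn).
apply: ler_powR; rewrite ?ler1n// lerN2.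
have p1 : 0 < p - 1 by move: p2; lra.
rewrite ler_pdivlMr ?mulr_gt0// mulrA mulVf// mul1r; lra.
Unshelve. all: by end_near.
Qed.

End TheoremHypotheses.

Theorem theorem3 (R : realType) (d : measure_display)
  (Omega : measurableType d) (P : probability Omega R)
  (T : R) (hT : 0 < T)
  (* the price process *)
  (F : R -> set (set Omega)) (hF : filtration T F)
  (B : R -> Omega -> R) (hB : brownian_motion P T F B)
  (mu : R -> Omega -> R)
  (hmu_prog : progressively_measurable T F mu)
  (hmu_bdd : locally_bounded P T F mu)
  (sigma : R -> Omega -> R)
  (hsigma_pos : {ae P, forall w, forall t, 0 <= t <= T -> 0 < sigma t w})
  (hsigma_bdd : locally_bounded P T F sigma)
  (hsigma_ito : ito_semimartingale P T F sigma)
  (X : R -> Omega -> R) (hX : ito_process P T F B mu sigma X)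
  (* the sampling grids *)
  (t : nat -> nat -> R)
  (ht : forall n, (1 <= n)%N -> grid T n (t n))
  (hmesh : mesh_max n (t n) @[n --> \oo] --> (0 : R))
  (* the errors; U0 is a generic error *)
  (fU : R -> R) (U0 : {RV P >-> R}) (hU0 : has_density U0 fU)
  (U : nat -> nat -> {RV P >-> R})
  (* Assumption 1 *)
  (hU_density : forall n j, (1 <= n)%N -> (j <= n)%N ->
     has_density (U n j) fU)
  (hU_indep : forall n, (1 <= n)%N ->
     mutually_independent P n.+1 (fun j => U n j : Omega -> R))
  (hUX_indep : forall n, (1 <= n)%N ->
     independent_families P
       [set j | (j <= n)%N] (fun j => U n j : Omega -> R)
       [set s | 0 <= s <= T] X)
  (* Assumption 2 *)
  (hratio : exists c1 c2 : R, [/\ 0 < c1, 0 < c2 & \forall n \near \oo,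
     c1 <= mesh_min n (t n) / mesh_max n (t n) <= c2])
  (* Assumption 3 *)
  (hfourier : forall s : R, fourier fU s \is Num.real /\ fourier fU s != 0)
  (* the bandwidths *)
  (xi : nat -> R) (hxi_pos : forall n, (1 <= n)%N -> 0 < xi n)
  (hN_max_min : asymp (fun n => (N_max n (t n) (xi n))%:R : R)
                      (fun n => (N_min n (t n) (xi n))%:R : R))
  (hN_min_nxi : asymp (fun n => (N_min n (t n) (xi n))%:R : R)
                      (fun n => n%:R * xi n))
  (k : nat) (hk : (1 <= k)%N)
  (hmu_mom : (\int[P]_w \int[lebesgue_measure]_(s in `[0%R, T])
                ((mu s w) ^+ (2 * k))%:E < +oo)%E)
  (hsigma_mom : (\int[P]_w \int[lebesgue_measure]_(s in `[0%R, T])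
                ((sigma s w) ^+ (2 * k))%:E < +oo)%E)
  (p : R) (hp : 2 < p <= 3)
  (hU_mom : ('E_P[fun w => (`|U0 w| `^ ((2 * k)%:R * p))%R] < +oo)%E)
  (hxi : (xi : nat -> R^o) =o_\oo
         ((fun n => n%:R `^ (- (p / (2 * (p - 1))))) : nat -> R^o)) :
  Op P
    (fun n w =>
       M_hat n (t n) (xi n) (fun j => X (t n j) w + U n j w) k
       - fine ('E_P[fun w' => (U0 w' ^+ (2 * k))%R])%E)
    (fun n => n%:R `^ (- 2^-1)).
Proof.
have [_ cadlag_sigma _] := hsigma_ito; have [asigma _ _] := hsigma_ito.
have [mX _ _] := hX.
have [C C0 NC] := N_asymp hN_max_min hN_min_nxi hxi_pos.
have xi_rate := littleo_bandwidth_le hp hxi.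
have tT n j : (1 <= n)%N -> (j <= n)%N -> 0 <= t n j <= T.
  by move=> n1 jn; exact: (grid_itv (ht n n1)).
(* 4k <= 2kp because p > 2. *)
have iU a : (a <= 4 * k)%N -> integrable_rv P (fun w => `|U0 w| ^+ a).
  move=> ak; apply: (integrable_pow_expectation hU_mom).
  have k0 : 0 <= k%:R :> R by [].
  have : a%:R <= 4 * k%:R :> R by rewrite -natrM ler_nat.
  by case/andP: hp => p2 _; rewrite natrM; nra.
(* [odd_moment0] uses the absolute moment of order i + 2. An odd i is at most 2k - 1, and 2k + 1 <=
   4k. *)
have oddU i : odd i -> (i <= 2 * k)%N -> moment U0 i = 0.
  move=> oi ik; have iE : i = i./2.*2.+1 by rewrite -[LHS]odd_double_half oi.
  rewrite iE /moment; apply: (odd_moment0 hU0 (fun s => (hfourier s).1)).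
    by apply: iU; lia.
  apply: integrable_rv_le (iU i _); last by lia.
    by apply: measurable_funX; exact: measurable_funP.
  by move=> w; rewrite normrX -iE.
have lawU n j : (1 <= n)%N -> (j <= n)%N -> forall A, measurable A ->
    distribution P U0 A = distribution P (U n j) A.
  move=> n1 jn A mA; have [_ _ hf] := hU_density n j n1 jn; have [_ _ ->] := hU0 => //.
  by rewrite hf.
have NM3 n j : (1 <= n)%N -> (j <= n)%N ->
    ((N_ n (t n) (xi n) j).+1 <= 3 * N_max n (t n) (xi n))%N.
  by move=> n1 jn; have [Nmax0 _ _ _] := NC n n1; exact: (N_le_max3 n1 (ht n n1)).
have x_avg eps : 0 < eps -> exists2 K : R, 0 < K & \forall n \near \oo,
    (P [set w | K * xi n < pair_avg n (t n) (xi n)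
       (fun j l => (X (t n l) w - X (t n j) w) ^+ 2)]%R <= eps%:E)%E.
  (* The neighbour bound is 3 N_max, so its square carries a factor 9. *)
  move=> eps0; have C9 : 0 < 9 * C by exact: mulr_gt0.
  have [K K0 hK] := ito_process_pair_avg_whp hT hF hB hmu_prog hmu_bdd cadlag_sigma
    asigma hsigma_bdd hX C9 eps0.
  exists K => //; near=> n.
  have n1 : (1 <= n)%N by near: n; exists 1%N.
  have [_ N0 _ NC2] := NC n n1.
  apply: (hK n (t n) (xi n) (3 * N_max n (t n) (xi n))%N) => //; first exact: ht.
  - by move=> j; exact: NM3.
  - rewrite hxi_pos//=; apply: le_trans (rate_le1 n1); near: n; exact: xi_rate.
  - by rewrite expnMn natrM -!mulrA ler_pM2l.
have -> : fine ('E_P[fun w => (U0 w ^+ (2 * k))%R])%E = moment U0 (2 * k).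
  by rewrite unlock.
move=> eps eps0.
pose GX := preimages [set s | 0 <= s <= T] X.
pose GU n := preimages [set j | (j <= n)%N] (fun j => U n j : Omega -> R).
apply: (@M_hat_rate _ _ _ P t xi C C0 NC NM3 hxi_pos xi_rate GX GU _ _ _
  (fun n j => X (t n j)) _ x_avg _ U0 U k hU_indep lawU iU oddU _ hk eps eps0).
- exact: preimages_measurable.
- by move=> n; apply: preimages_measurable.
- by move=> n n1 E G sE sG; rewrite setIC (hUX_indep n n1 G E sG sE) muleC.
- by move=> n j n1 jn; apply: measurable_preimages; exact: tT.
- by move=> e e0; exact: (ito_process_sup_whp hT hmu_prog hmu_bdd hX ht e0).
- by move=> n j n1 jn; apply: (measurable_preimages (V := fun j => U n j : Omega -> R)).
Unshelve. all: by end_near.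
Qed.
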